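(* Let $n\ge 2$ and let $G_1,\dots,G_n$ be non-trivial finitely generated groups with finite generating sets $S_1,\dots,S_n$, such that the free product $G_1*\cdots*G_n$ is not virtually $\mathbb{Z}$. Consider the Cayley graph of $G_1*\cdots*G_n$ with respect to $\bigcup_{i=1}^nS_i$ and of each $G_i$ with respect to $S_i$. Then $$p_c(G_1*\cdots*G_n)<\min_{1\le i\le n}\{p_c(G_i)\}\le\min_{1\le i\le n}\{p_{\mathrm{exp}}(G_i)\}=p_{\mathrm{exp}}(G_1*\cdots*G_n)\le p_u(G_1*\cdots*G_n)=1.$$
   Context: Cayley graph: for a group $G$ with finite generating set $S$, the graph has vertex set $G$, and $g,h$ are adjacent iff $g^{-1}h\in S$ or $h^{-1}g\in S$, with the appropriate multiplicity (one edge joining $g$ and $gs$ for each pair $(g,s)\in G\times S$). The origin $o$ is the identity element. Bernoulli bond percolation with parameter $p\in[0,1]$ on a graph with vertex set $V$: each edge is independently open with probability $p$ and closed otherwise, with product measure $\mathrm{P}_p$. A cluster is a connected component of the random subgraph of open edges; $C$ is the cluster of $o$, $|C|$ its number of vertices. Define - $\theta(p)=\mathrm{P}_p(|C|=\infty)$ and $p_c=\inf\{p\in[0,1]:\theta(p)>0\}$; - $p_u=\inf\{p\in[0,1]:$ there is $\mathrm{P}_p$-a.s. exactly one infinite cluster$\}$; - $p_{\mathrm{exp}}=\sup\{p\in[0,1]:\ \exists\, C,\gamma>0\ \forall x,y\in V\ \mathrm{P}_p(x\leftrightarrow y)\le Ce^{-\gamma\,\mathrm{dist}(x,y)}\}$,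 where $x\leftrightarrow y$ means $x,y$ are joined by a path of open edges and $\mathrm{dist}$ is graph distance. For a finite group $G_i$ one sets $p_c(G_i)=p_{\mathrm{exp}}(G_i)=1$. A group is virtually $\mathbb{Z}$ if it has a finite-index subgroup isomorphic to $\mathbb{Z}$. *)

(* Defs.v *)
From HB Require Import structures.
From mathcomp Require Import all_boot all_order all_algebra.
From mathcomp Require Import all_classical all_reals all_analysis.

Set Implicit Arguments.
Unset Strict Implicit.
Unset Printing Implicit Defensive.

Import Order.TTheory GRing.Theory Num.Theory.
Import numFieldNormedType.Exports.

Local Open Scope classical_set_scope.
Local Open Scope ring_scope.

Definition config (E : choiceType) := E -> bool.

HB.instance Definition _ (E : choiceType) := Pointed.copy (config E) (E -> bool).
HB.instance Definition _ (E : choiceType) :=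
  Topological.copy (config E) (prod_topology (fun _ : E => bool)).

Section cylinders.
Variable E : choiceType.
Implicit Types (A B : set (config E)) (s t : seq E).

(* [f] depends only on the states of the edges in [s] *)
Definition determined (X : Type) s (f : config E -> X) :=
  forall w w', {in s, w =1 w'} -> f w = f w'.

Definition cylinder A := exists s, determined s A.

Lemma determinedW X s t (f : config E -> X) :
  {subset s <= t} -> determined s f -> determined t f.
Proof. by move=> st fs w w' ww'; apply: fs => e /st; exact: ww'. Qed.

Lemma cylinder0 : cylinder set0.
Proof. by exists [::]. Qed.

Lemma cylinderC A : cylinder A -> cylinder (~` A).
Proof. by move=> [s As]; exists s => w w' /As AA; rewrite /setC/mkset AA. Qed.

Lemma cylinderU A B : cylinder A -> cylinder B -> cylinder (A `|` B).
Proof.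
move=> [s As] [t Bt]; exists (s ++ t) => w w' ww'.
rewrite /setU /mkset (As w w') ?(Bt w w')// => e es; apply: ww';
  by rewrite mem_cat es ?orbT.
Qed.

End cylinders.

Fact cylinder_display : measure_display.
Proof. exact: default_measure_display. Qed.

HB.instance Definition _ (E : choiceType) :=
  @isAlgebraOfSets.Build cylinder_display (config E) (@cylinder E)
    (@cylinder0 E) (@cylinderU E) (@cylinderC E).

Section bernoulli_content.
Context {R : realType} {E : choiceType} (p : {i01 R}).
Implicit Types (A B : set (config E)) (s t : seq E) (f g : config E -> R).

Definition set_edge (e : E) (b : bool) (w : config E) : config E :=
  fun e' => if e' == e then b else w e'.

(* expectation of [f] when the state of [e] is resampled as Bernoulli(p) *)
Definition average f (e : E) : config E -> R := fun w =>
  p%:num * f (set_edge e true w) + (1 - p%:num) * f (set_edge e false w).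

Definition average_seq f s : config E -> R := foldl average f s.

Definition determining A : seq E := xget [::] [set s | determined s A].

(* The cylinder [A] depends on finitely many edges only, and its probability is
   obtained by averaging its indicator over these edges; the result depends
   neither on the chosen edges nor on the starting configuration [point]
   (see [bernoulli_contentE]). *)
Definition bernoulli_content A : \bar R :=
  (average_seq \1_A (determining A) point)%:E.

Let q0 : 0 <= 1 - p%:num. Proof. by rewrite subr_ge0. Qed.

Lemma averageC f e e' : average (average f e) e' = average (average f e') e.
Proof.
apply/funext => w; rewrite /average.
have [->//|ee'] := eqVneq e e'.
have C b b' : set_edge e b (set_edge e' b' w) = set_edge e' b' (set_edge e b w).
  apply/funext => x; rewrite /set_edge.
  by case: (eqVneq x e) => // ->; rewrite (negbTE ee').
rewrite !C !mulrDr !mulrA addrACA; congr (_ + _ + (_ + _)) => //;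
  by rewrite [_ * (1 - _)]mulrC.
Qed.

Lemma average_seq_average f e s :
  average_seq (average f e) s = average (average_seq f s) e.
Proof. by elim: s f => //= e' s IH f; rewrite averageC IH. Qed.

Lemma average_seqC f s t :
  average_seq (average_seq f s) t = average_seq (average_seq f t) s.
Proof.
elim: s f => //= e s IH f; rewrite IH; congr (average_seq _ s).
by rewrite average_seq_average.
Qed.

Lemma average_cst (c : R) e : average (cst c) e = cst c.
Proof. by apply/funext => w; rewrite /average/= -mulrDl addrC subrK mul1r. Qed.

Lemma average_seq_cst (c : R) s : average_seq (cst c) s = cst c.
Proof. by elim: s => //= e s; rewrite average_cst. Qed.

Lemma average_seq_determined f s :
  determined s f -> average_seq f s = cst (average_seq f s point).
Proof.
elim: s f => [|e s IH] f fs /=.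
  by apply/funext => w; apply: fs.
apply: IH => w w' ww'; rewrite /average; congr (_ * _ + _ * _); apply: fs => x;
  by rewrite inE /set_edge; case: eqVneq => //= _; exact: ww'.
Qed.

Lemma average_seq_indep f s t :
  determined s f -> determined t f -> average_seq f s = average_seq f t.
Proof.
move=> fs ft; transitivity (average_seq (average_seq f s) t).
  by rewrite (average_seq_determined fs) average_seq_cst.
by rewrite average_seqC (average_seq_determined ft) average_seq_cst.
Qed.

Lemma average_seqD f g s :
  average_seq (f \+ g) s = average_seq f s \+ average_seq g s.
Proof.
elim: s f g => //= e s IH f g; rewrite -IH; congr (average_seq _ s).
by apply/funext => w; rewrite /average /= !mulrDr addrACA.
Qed.

Lemma average_seqZ (c : R) f s :
  average_seq (fun w => c * f w) s = fun w => c * average_seq f s w.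
Proof.
elim: s f => //= e s IH f; rewrite -IH; congr (average_seq _ s).
by apply/funext => w; rewrite /average /= mulrDr; congr (_ + _);
  rewrite mulrCA.
Qed.

Lemma average_seq_ge0 f s w : (forall w, 0 <= f w) -> 0 <= average_seq f s w.
Proof.
elim: s f => //= e s IH f f0; apply: IH => v.
by rewrite /average addr_ge0// mulr_ge0.
Qed.

Lemma determined_indic A s : determined s A -> determined s (\1_A : _ -> R).
Proof.
move=> As w w' ww'; rewrite !indicE; congr (nat_of_bool _)%:R.
by apply/idP/idP; rewrite !inE (As _ _ ww').
Qed.

Lemma bernoulli_contentE A s : determined s A ->
  bernoulli_content A = (average_seq \1_A s point)%:E.
Proof.
move=> As; rewrite /bernoulli_content (average_seq_indep (t := s))//.
  by apply: determined_indic; exact: (@xgetPex _ [::] [set s | determined s A] (ex_intro _ s As)).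
exact: determined_indic.
Qed.

Lemma bernoulli_content0 : bernoulli_content set0 = 0%E.
Proof. by rewrite (@bernoulli_contentE _ [::])//= indicE in_set0. Qed.

Lemma bernoulli_contentT : bernoulli_content setT = 1%E.
Proof. by rewrite (@bernoulli_contentE _ [::])//= indicE in_setT. Qed.

Lemma bernoulli_content_ge0 A : (0 <= bernoulli_content A)%E.
Proof. by rewrite lee_fin average_seq_ge0// => w; rewrite indicE. Qed.

Lemma bernoulli_content_additive : measure_function.semi_additive bernoulli_content.
Proof.
apply/(additive2P bernoulli_content0) => A B [s As] [t Bt] AB0.
have sst : {subset s <= s ++ t} by move=> e; rewrite mem_cat => ->.
have tst : {subset t <= s ++ t} by move=> e; rewrite mem_cat orbC => ->.
have {}As := determinedW sst As; have {}Bt := determinedW tst Bt.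
rewrite (bernoulli_contentE As) (bernoulli_contentE Bt).
rewrite (@bernoulli_contentE _ (s ++ t)); last first.
  by move=> w w' ww'; rewrite /setU/mkset (As _ _ ww') (Bt _ _ ww').
rewrite -EFinD; congr EFin.
rewrite -[RHS]/((average_seq _ _ \+ average_seq _ _) _) -average_seqD.
congr (average_seq _ _ _); apply/funext => w; rewrite /= !indicE in_setU.
case: (boolP (w \in A)) => wA; case: (boolP (w \in B)) => wB;
  rewrite ?addr0 ?add0r//.
by have : set0 w by rewrite -AB0; split; apply: set_mem.
Qed.

HB.instance Definition _ := isContent.Build _ (config E) R bernoulli_content
  bernoulli_content_ge0 bernoulli_content_additive.

Lemma cylinder_open A : cylinder A -> open (A : set (config E)).
Proof.
move=> [s As]; rewrite openE => w Aw.
have: \forall w' \near w, {in s, (w : E -> bool) =1 w'}.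
  elim: {As} s => [|e s IH]; first by near=> w' => e; rewrite in_nil.
  have He : \forall w' \near w, w e = w' e.
    have : nbhs (w e) [set w e] by rewrite nbhs_principalE.
    by move=> /(@proj_continuous E (fun=> bool) e w); apply: filterS => w' /= ->.
  near=> w' => x; rewrite inE => /orP[/eqP->|]; first by near: w'.
  by move: x; near: w'.
by apply: filterS => w' /As <-.
Unshelve. all: by end_near. Qed.

Lemma bernoulli_content_sigma_subadditive :
  measurable_subset_sigma_subadditive bernoulli_content.
Proof.
move=> A F mF mA AF.
have cA : compact (A : set (config E)).
  apply: (@subclosed_compact (config E) _ setT).
  - rewrite -[A]setCK closedC; apply: cylinder_open; exact: cylinderC.
  - have := @tychonoff E (fun=> bool) (fun=> setT) (fun=> bool_compact).
    by congr compact; apply/seteqP; split.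
  - by [].
move: cA; rewrite compact_cover => /(_ nat setT F)[||D _ AD].
- by move=> n _; exact: cylinder_open (mF n).
- exact: AF.
pose N := (\max_(i <- finmap.enum_fset D) i).+1.
apply: (@le_trans _ _ (\sum_(0 <= k < N) bernoulli_content (F k))%E); last first.
  by apply: nneseries_lim_ge => *; exact: bernoulli_content_ge0.
rewrite big_mkord; apply: content_subadditive => //.
rewrite -bigcup_mkord => w /AD[k /= kD Fkw]; exists k => //=.
by rewrite ltnS; apply: (@leq_bigmax_seq _ (finmap.enum_fset D) xpredT (fun i => i)).
Qed.

HB.instance Definition _ := @Content_SigmaSubAdditive_isMeasure.Build
  cylinder_display R (config E) bernoulli_content
  bernoulli_content_sigma_subadditive.

End bernoulli_content.

(* The product measure on [config E], as the Caratheodory extension of the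
   content on cylinders; it is characterized by [bond_percolation_cylinder]. *)
Definition bond_percolation {R : realType} {E : choiceType} (p : {i01 R}) :=
  measure_extension (@bernoulli_content R E p).

Section bond_percolation.
Context {R : realType} {E : choiceType} (p : {i01 R}).

HB.instance Definition _ := Measure.on (@bond_percolation R E p).

Let bond_percolation_setT : bond_percolation p [set: config E] = 1%E.
Proof.
rewrite /bond_percolation /measure_extension measurable_mu_extE//.
exact: bernoulli_contentT.
Qed.

HB.instance Definition _ := @Measure_isProbability.Build _ _ R
  (@bond_percolation R E p) bond_percolation_setT.

Lemma bond_percolation_cylinder (s : seq E) (a : config E) : uniq s ->
  bond_percolation p [set w : config E | {in s, w =1 a}] =
  (\prod_(e <- s) if a e then p%:num else 1 - p%:num)%:E.
Proof.
move=> us; pose A (r : seq E) : set (config E) := [set w : config E | {in r, w =1 a}].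
have As r : determined r (A r).
  move=> w w' ww'; apply/propext; rewrite /A/=.
  by split=> + e er => /(_ e er) <-; rewrite ww'.
transitivity (bernoulli_content p (A s)).
  by apply: measurable_mu_extE; exists s.
rewrite (bernoulli_contentE p (As s)); congr EFin.
elim: s us => [_|e s IH /= /andP[es us]].
  by rewrite big_nil/= indicE mem_set.
rewrite big_cons -IH// -[RHS]/((fun w => _ * average_seq p _ s w) point).
rewrite -average_seqZ; congr (average_seq _ _ _ _); apply/funext => w.
have Ae b : \1_(A (e :: s)) (set_edge e b w) = (b == a e)%:R * \1_(A s) w :> R.
  rewrite !indicE -natrM mulnb; congr (nat_of_bool _)%:R.
  apply/idP/andP; rewrite !inE /A/=.
    move=> H; split; first by rewrite -(H e) ?mem_head// /set_edge eqxx.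
    move=> x xs; rewrite -H ?inE ?xs ?orbT// /set_edge ifN//.
    by apply: contraNneq es => <-.
  move=> [/eqP ba H] x; rewrite inE /set_edge; case: eqVneq => [->//|_ /=].
  exact: H.
by rewrite /average !Ae; case: (a e);
  rewrite eqxx /= mul0r mulr0 mul1r ?addr0 ?add0r.
Qed.

End bond_percolation.

(* Loops and multiple edges are allowed; the order of the two endpoints returned
   by [ends] is irrelevant. *)
Record multigraph := Multigraph {
  vertex : choiceType;
  edge : choiceType;
  ends : edge -> vertex * vertex }.

Section graph.
Variable Gr : multigraph.
Implicit Types (x y z : vertex Gr) (w : config (edge Gr)).

Definition open_adj w x y :=
  exists2 e, w e & ends e = (x, y) \/ ends e = (y, x).

Fixpoint open_walk w (k : nat) x y : Prop :=
  if k is k'.+1 then exists2 z, open_adj w x z & open_walk w k' z y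
  else x = y.

Definition connected_in w x y := exists k, open_walk w k x y.

Definition cluster_of w x : set (vertex Gr) := [set y | connected_in w x y].

Definition walk_length x y : pred nat :=
  fun k => `[< open_walk (fun=> true) k x y >].

(* 0 by convention when [x] and [y] are not connected in [Gr] *)
Definition graph_dist x y : nat :=
  if pselect (exists k, walk_length x y k) is left xy then ex_minn xy else 0%N.

Definition infinite_cluster w (K : set (vertex Gr)) :=
  infinite_set K /\ exists x, K = cluster_of w x.

End graph.

Section critical_parameters.
Variables (R : realType) (Gr : multigraph).
Implicit Types p : {i01 R}.

Local Notation "'P_ p" := (@bond_percolation R (edge Gr) p) (at level 8, p at level 2).

Definition percolation_probability (o : vertex Gr) p : \bar R :=
  'P_p [set w | infinite_set (cluster_of w o)].

Definition p_c (o : vertex Gr) : R :=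
  inf [set p%:num | p in [set p | (0 < percolation_probability o p)%E]].

Definition p_u : R :=
  inf [set p%:num | p in
    [set p | {ae 'P_p, forall w, exists! K, infinite_cluster w K}]].

Definition exponential_decay p :=
  exists C gamma : R, [/\ 0 < C, 0 < gamma &
    forall x y : vertex Gr, ('P_p [set w | connected_in w x y] <=
      (C * expR (- gamma * (graph_dist x y)%:R))%:E)%E].

Definition p_exp : R := sup [set p%:num | p in exponential_decay].

Lemma p_c_le1 o : p_c o <= 1.
Proof.
rewrite /p_c; set A := [set _ | _ in _].
have [->|/set0P[x Ax]] := eqVneq A set0; first by rewrite inf0.
apply: (@le_trans _ _ x); last by case: Ax => p _ <-.
by apply: ge_inf => //; exists 0 => _ [p _ <-].
Qed.

Lemma p_exp_le1 : p_exp <= 1.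
Proof.
rewrite /p_exp; set A := [set _ | _ in _].
have [->|/set0P A0] := eqVneq A set0; first by rewrite sup0.
by apply: ge_sup => // _ [p _ <-].
Qed.

End critical_parameters.

Section free_product.
Variables (I : choiceType) (G : I -> groupType).
Local Open Scope group_scope.

Local Notation letter := {i : I & G i}.
Implicit Types (u v w : seq letter) (a b : letter).

(* Elements of the free product are reduced words: no letter is trivial and
   consecutive letters belong to different factors. *)
Definition reduced w :=
  all (fun a => tagged a != 1) w && sorted (fun a b => tag a != tag b) w.

Definition push i (g : G i) w := if g == 1 then w else Tagged G g :: w.

(* [peel i w] splits off the leading letter of [w] if it lies in the factor [i],
   and the trivial letter of [G i] otherwise. *)
Definition peel i w : G i * seq letter :=
  if w is a :: w' then
    if tag a == i then (@untag I G (G i) 1 i id a, w') else (1, w)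
  else (1, w).

(* left multiplication of a reduced word by [g : G i] *)
Definition lact i (g : G i) w := push (g * (peel i w).1) (peel i w).2.

Definition word_mul u v := foldr (fun a => lact (tagged a)) v u.

Definition word_inv u := rev [seq Tagged G (tagged a)^-1 | a <- u].

Definition headfree (i : I) w := if w is a :: _ then tag a != i else true.

Lemma reduced_cons a w :
  reduced (a :: w) = [&& tagged a != 1, headfree (tag a) w & reduced w].
Proof.
rewrite /reduced /=; case: w => [|b w] /=; first by rewrite !andbT.
rewrite [tag a == _]eq_sym; case: (_ != 1); case: (tag b != _);
  by rewrite ?andbF.
Qed.

Lemma push_reduced i (g : G i) w :
  reduced w -> headfree i w -> reduced (push g w).
Proof. by rewrite /push; case: eqVneq => // g1 rw hw; rewrite reduced_cons/= g1 hw. Qed.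

Lemma peel_reduced i w : reduced w ->
  reduced (peel i w).2 /\ headfree i (peel i w).2.
Proof.
case: w => // a w; rewrite reduced_cons /= => /and3P[a1 ha rw].
case: eqVneq => [<-|] //= ai; split=> //.
by rewrite reduced_cons a1 ha.
Qed.

Lemma push_peel i w : reduced w -> push (peel i w).1 (peel i w).2 = w.
Proof.
case: w => [|a w]; first by rewrite /push eqxx.
rewrite reduced_cons /= => /and3P[a1 _ _].
case: eqVneq => /= [ai|_]; last by rewrite /push eqxx.
by case: a ai a1 => j g /= <- g1; rewrite untagE /push /= (negbTE g1).
Qed.

Lemma peel_push i (g : G i) w : headfree i w -> peel i (push g w) = (g, w).
Proof.
rewrite /push; case: (eqVneq g 1) => [->|_ _].
  by case: w => //= a w /negbTE->.
by rewrite /= eqxx untagE.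
Qed.

Lemma lact_reduced i (g : G i) w : reduced w -> reduced (lact g w).
Proof. by move=> /(@peel_reduced i)[]; apply: push_reduced. Qed.

Lemma lact1 i w : reduced w -> lact (1 : G i) w = w.
Proof. by move=> rw; rewrite /lact mul1g push_peel. Qed.

Lemma lactM i (g h : G i) w : reduced w -> lact g (lact h w) = lact (g * h) w.
Proof.
move=> /(@peel_reduced i)[_ hw].
by rewrite [lact g _]/lact /lact peel_push//= mulgA.
Qed.

Lemma lact_cons a w : reduced (a :: w) -> lact (tagged a) w = a :: w.
Proof.
rewrite reduced_cons => /and3P[a1 hw _]; case: a a1 hw => i g /= g1 hw.
have -> : lact g w = push g w.
  by rewrite /lact; case: w hw => [|b w] /=; [|move/negbTE->]; rewrite mulg1.
by rewrite /push (negbTE g1).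
Qed.

Lemma word_mul_reduced u v : reduced v -> reduced (word_mul u v).
Proof. by move=> rv; elim: u => //= a u; apply: lact_reduced. Qed.

Lemma word_mul_push i (g : G i) u v : reduced v ->
  word_mul (push g u) v = lact g (word_mul u v).
Proof.
move=> rv; rewrite /push; case: eqVneq => // ->.
by rewrite lact1// word_mul_reduced.
Qed.

Lemma word_mul_lact i (g : G i) u v : reduced u -> reduced v ->
  word_mul (lact g u) v = lact g (word_mul u v).
Proof.
move=> ru rv; rewrite -{2}(push_peel i ru) [lact g u]/lact !word_mul_push//.
by rewrite lactM// word_mul_reduced.
Qed.

Lemma word_mulA u v w : reduced v -> reduced w ->
  word_mul u (word_mul v w) = word_mul (word_mul u v) w.
Proof.
move=> rv rw; elim: u => //= a u ->.
by rewrite word_mul_lact// word_mul_reduced.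
Qed.

Lemma word_mulw1 u : reduced u -> word_mul u [::] = u.
Proof.
elim: u => //= a u IH rau; rewrite IH; first exact: lact_cons.
by move: rau; rewrite reduced_cons => /and3P[].
Qed.

Lemma word_inv_reduced u : reduced u -> reduced (word_inv u).
Proof.
rewrite /reduced /word_inv all_rev rev_sorted all_map sorted_map.
move=> /andP[u1 us]; apply/andP; split.
  by apply: sub_all u1 => a /=; rewrite invg_eq1.
by apply: sub_sorted us => a b /=; rewrite eq_sym.
Qed.

Lemma word_invK : involutive word_inv.
Proof.
move=> u; rewrite /word_inv map_rev revK -map_comp map_id_in// => -[i g] _ /=.
by rewrite invgK.
Qed.

Lemma word_mulVw u : reduced u -> word_mul (word_inv u) u = [::].
Proof.
elim: u => //= a u IH rau.
have ru : reduced u by move: rau; rewrite reduced_cons => /and3P[].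
rewrite /word_inv /= rev_cons /word_mul foldr_rcons /= -(lact_cons rau).
by rewrite lactM// mulVg lact1//; exact: IH.
Qed.

Record free_product := FreeProduct {
  word_of : seq letter;
  _ : reduced word_of }.

HB.instance Definition _ := [isSub for word_of].
HB.instance Definition _ := [Choice of free_product by <:].

Implicit Types x y z : free_product.

Definition fp_one := @FreeProduct [::] isT.
Definition fp_mul x y :=
  FreeProduct (word_mul_reduced (word_of x) (valP y)).
Definition fp_inv x := FreeProduct (word_inv_reduced (valP x)).

Fact fp_mulA : associative fp_mul.
Proof. by move=> x y z; apply/val_inj/word_mulA; exact: valP. Qed.
Fact fp_mul1g : left_id fp_one fp_mul.
Proof. by move=> x; apply/val_inj. Qed.
Fact fp_mulg1 : right_id fp_one fp_mul.
Proof. by move=> x; apply/val_inj/word_mulw1/valP. Qed.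
Fact fp_mulVg : left_inverse fp_one fp_inv fp_mul.
Proof. by move=> x; apply/val_inj/word_mulVw/valP. Qed.
Fact fp_mulgV : right_inverse fp_one fp_inv fp_mul.
Proof.
move=> x; apply/val_inj; rewrite /= -[in LHS](word_invK (word_of x)).
by rewrite word_invK -[X in word_mul X _]word_invK word_mulVw// word_inv_reduced// (valP x).
Qed.

HB.instance Definition _ := isGroup.Build free_product
  fp_mulA fp_mul1g fp_mulg1 fp_mulVg fp_mulgV.

Definition fp_in i (g : G i) : free_product :=
  FreeProduct (@push_reduced i g [::] isT isT).

Lemma fp_inM i : {morph @fp_in i : g h / g * h}.
Proof.
move=> g h; apply/val_inj.
change (push (g * h) [::] = word_mul (push g [::]) (push h [::])).
rewrite word_mul_push; last exact: push_reduced.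
by rewrite /word_mul [foldr _ _ _]/= /lact peel_push.
Qed.

Lemma fp_in_inj i : injective (@fp_in i).
Proof.
have K (k : G i) : (peel i (word_of (fp_in k))).1 = k :=
  congr1 fst (@peel_push i k [::] isT).
by move=> g h /(congr1 (fun x => (peel i (word_of x)).1)); rewrite !K.
Qed.

End free_product.

Section universal.
Variables (I : choiceType) (G : I -> groupType) (H : groupType).
Variable f : forall i, G i -> H.
Hypothesis fM : forall i, {morph @f i : g h / (g * h)%g}.
Local Open Scope group_scope.

Let f1 i : f (1 : G i) = 1.
Proof. by apply: (mulgI (f (1 : G i))); rewrite -fM !mulg1. Qed.

Let ev (w : seq {i : I & G i}) : H := foldr (fun a y => f (tagged a) * y) 1 w.

Let ev_push i (g : G i) w : ev (push g w) = f g * ev w.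
Proof. by rewrite /push; case: eqVneq => // ->; rewrite f1 mul1g. Qed.

Let ev_lact i (g : G i) w : reduced w -> ev (lact g w) = f g * ev w.
Proof.
by move=> rw; rewrite -{2}(push_peel i rw) /lact !ev_push fM mulgA.
Qed.

Lemma free_product_universal :
  exists! F : free_product G -> H,
    {morph F : x y / x * y} /\ forall i (g : G i), F (fp_in g) = f g.
Proof.
exists (fun x => ev (word_of x)); split.
  split=> [[u ru] [v rv] /=|i g]; last by rewrite /= ev_push /= mulg1.
  elim: u ru => [|a u IH] rau /=; first by rewrite mul1g.
  have := rau; rewrite reduced_cons => /and3P[_ _ ru].
  by rewrite ev_lact ?word_mul_reduced// IH// mulgA.
move=> F [FM Fin]; apply/funext => -[u ru] /=.
elim: u ru => [|a u IH] rau /=.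
  have -> : FreeProduct rau = 1 by apply/val_inj.
  by apply: (mulgI (F 1)); rewrite -FM !mulg1.
have := rau; rewrite reduced_cons => /and3P[_ _ ru].
have -> : FreeProduct rau = fp_in (tagged a) * FreeProduct ru.
  apply/val_inj; rewrite /= word_mul_push//; exact/esym/lact_cons.
by rewrite FM Fin -IH.
Qed.

End universal.

Section groups.
Local Open Scope group_scope.

Definition is_subgroup (G : groupType) (H : set G) :=
  [/\ H 1, forall x y, H x -> H y -> H (x * y) & forall x, H x -> H x^-1].

Definition generates (G : groupType) (S : set G) :=
  forall H : set G, is_subgroup H -> S `<=` H -> H = setT.

Definition virtually_Z (G : groupType) :=
  exists H : set G, [/\ is_subgroup H,
    finite_set [set [set x * h | h in H] | x in [set: G]] &
    exists f : int -> G, [/\ injective f, range f = H &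
      forall m n : int, f (m + n)%R = f m * f n]].

Definition nontrivial (G : groupType) := exists g : G, g <> 1.

(* one edge joining [g] and [g * s] for every pair [(g, s)] *)
Definition cayley (G : groupType) (S : set G) : multigraph :=
  @Multigraph G (G * set_type S)%type (fun e => (e.1, e.1 * set_val e.2)).

(* The critical values of a finite group are 1 by convention; for p_c the
   infimum would range over the empty set. *)
Definition cayley_p_c (R : realType) (G : groupType) (S : set G) : R :=
  if `[< finite_set [set: G] >] then 1%R else p_c R (1 : vertex (cayley S)).

Definition cayley_p_exp (R : realType) (G : groupType) (S : set G) : R :=
  if `[< finite_set [set: G] >] then 1%R else p_exp R (cayley S).

Definition cayley_p_u (R : realType) (G : groupType) (S : set G) : R :=
  p_u R (cayley S).

Lemma cayley_p_c_le1 (R : realType) (G : groupType) (S : set G) :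
  (cayley_p_c R S <= 1)%R.
Proof. by rewrite /cayley_p_c; case: ifP => // _; exact: p_c_le1. Qed.

Lemma cayley_p_exp_le1 (R : realType) (G : groupType) (S : set G) :
  (cayley_p_exp R S <= 1)%R.
Proof. by rewrite /cayley_p_exp; case: ifP => // _; exact: p_exp_le1. Qed.

Definition free_product_gens (I : choiceType) (G : I -> groupType)
    (S : forall i, set (G i)) : set (free_product G) :=
  \bigcup_i (@fp_in I G i @` S i).

End groups.

(* Main.v *)
Require Import Defs.
From HB Require Import structures.
From mathcomp Require Import all_boot all_order all_algebra.
From mathcomp Require Import all_classical all_reals all_analysis.
From mathcomp Require Import finmap ring lra zify.

Set Implicit Arguments.
Unset Strict Implicit.
Unset Printing Implicit Defensive.

Import Order.TTheory GRing.Theory Num.Theory.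
Import numFieldNormedType.Exports.
Local Open Scope classical_set_scope.
Local Open Scope ring_scope.

(** Sharpness of the phase transition, in the form of Duminil-Copin and Tassion,
    drives the proof.  For a finite set [S] containing the identity let
    [phi_p(S)] be the expected number of open edges leaving [S] from points
    connected to the identity inside [S].  If [phi_p(S) < 1] for some [S], the
    Simon-Lieb inequality gives exponential decay and a finite susceptibility;
    if [phi_p(S) >= 1] for all [S], Russo's formula gives percolation at every
    larger parameter.  Hence [p_c <= p_exp], and the susceptibility of an
    infinite factor diverges at its [p_c].

    In a free product, retracting onto a copy of a factor and onto the subtree
    hanging at one of its points shows [tau(g x) <= tau_i(g) tau(x)] for a
    reduced word [g x].  Since [tau_i] is bounded away from 1 off the identity,
    exponential decay in every factor has multiplicative constant 1 and passes
    to the free product, and [tau] is not bounded below at any [p < 1], which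
    by Harris' inequality excludes a unique infinite cluster.

    For the strict inequality, choose finitely many two-letter words, with first
    letters in one factor and second letters outside it, whose connection
    probabilities sum to more than 1 at [p_c] of that factor, hence also slightly
    below it; by Harris' inequality their products make the susceptibility of
    the free product infinite there.  Such words exist unless the group is the
    infinite dihedral group, which is virtually Z. *)

(** * Expectations over finitely many edges *)

(** All estimates are made for [expect q s f], a polynomial in a real parameter [q] obtained by
    averaging over a finite list of edges. Independence then means disjoint lists of edges, and the
    exploration of a random set becomes a finite sum over its values; infinite volume is reached by
    monotone limits along balls. Continuity in the parameter is available only in finite volume, so
    a strict bound that must survive a small change of [p] is stated for a finite-volume minorant of
    [tau].

    No disjoint-occurrence inequality is used: in the Simon-Lieb inequality and in the free product,
    a path is cut into pieces whose edges belong to lists known to be disjoint.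

    Two obstacles shape the free product part. A factor decaying with a constant [C > 1] would cost
    [C] again for every letter of a word, whence the constant 1. And the diverging susceptibility of
    a factor must outweigh the fixed price of a second letter; if all factors are finite there is no
    such divergence, but the minimum is then 1, and at parameter 1 every word has weight 1, so that
    two words suffice. *)

Section expectation.
Variables (R : realType) (E : choiceType).
Implicit Types (q : R) (f g : config E -> R) (e : E) (s a b : seq E).
Implicit Types (w : config E).

(** The formula of [average] with an arbitrary real [q], so that [expect q s f] is defined on the
    whole line and can be differentiated in [q]. *)
Definition resample q f e : config E -> R := fun w =>
  q * f (set_edge e true w) + (1 - q) * f (set_edge e false w).

Definition expect q s f : R := foldl (resample q) f s point.

Lemma expect_cons q e s f : expect q (e :: s) f = expect q s (resample q f e).
Proof. by []. Qed.

Lemma average_seq_expect (p : {i01 R}) s f :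
  average_seq p f s point = expect p%:num s f.
Proof. by []. Qed.

Lemma expect_le q s f g : 0 <= q <= 1 -> (forall w, f w <= g w) ->
  expect q s f <= expect q s g.
Proof.
move=> /andP[q0 q1]; elim: s f g => [|e s IH] f g fg; first exact: fg.
apply: IH => w; rewrite /resample lerD// ler_wpM2l// subr_ge0//.
Qed.

Lemma expectD q s f g :
  expect q s (fun w => f w + g w) = expect q s f + expect q s g.
Proof.
elim: s f g => //= e s IH f g; rewrite !expect_cons -IH.
by congr (expect _ _ _); apply/funext => w; rewrite /resample; ring.
Qed.

Lemma expectZ q s (c : R) f : expect q s (fun w => c * f w) = c * expect q s f.
Proof.
elim: s f => //= e s IH f; rewrite !expect_cons -IH.
by congr (expect _ _ _); apply/funext => w; rewrite /resample; ring.
Qed.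

Lemma expect_cst q s (c : R) : expect q s (fun=> c) = c.
Proof.
elim: s => //= e s IH; rewrite expect_cons -[RHS]IH.
by congr (expect _ _ _); apply/funext => w; rewrite /resample; ring.
Qed.

Lemma expect_sum q s (I : Type) (r : seq I) (P : pred I) (F : I -> config E -> R) :
  expect q s (fun w => \sum_(i <- r | P i) F i w) =
  \sum_(i <- r | P i) expect q s (F i).
Proof.
elim: r => [|i r IH]; first by rewrite big_nil; under [fun w => _]eq_fun do rewrite big_nil;
  exact: expect_cst.
rewrite big_cons -IH; case: ifP => Pi; last first.
  by congr expect; apply/funext => w; rewrite big_cons Pi.
by rewrite -expectD; congr expect; apply/funext => w; rewrite big_cons Pi.
Qed.

Lemma expect_ge0 q s f : 0 <= q <= 1 -> (forall w, 0 <= f w) -> 0 <= expect q s f.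
Proof. by move=> q01 f0; rewrite -(expect_cst q s 0); apply: expect_le. Qed.

Lemma set_edge_id e c w : w e = c -> set_edge e c w = w.
Proof. by move=> <-; apply/funext => x; rewrite /set_edge; case: eqVneq => [->|]. Qed.

Lemma set_edge_set e c c' w : set_edge e c (set_edge e c' w) = set_edge e c w.
Proof. by apply/funext => x; rewrite /set_edge; case: eqVneq. Qed.

Lemma set_edgeC e e' c c' w : e != e' ->
  set_edge e c (set_edge e' c' w) = set_edge e' c' (set_edge e c w).
Proof.
move=> ee'; apply/funext => x; rewrite /set_edge.
by case: (eqVneq x e) => // ->; rewrite (negbTE ee').
Qed.

Lemma determined_set_edge (X : Type) a (f : config E -> X) e c w :
  determined a f -> e \notin a -> f (set_edge e c w) = f w.
Proof.
move=> fa ea; apply: fa => x xa; rewrite /set_edge; case: eqVneq => // xe.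
by rewrite -xe xa in ea.
Qed.

Lemma resample_determined q a f e : determined a f -> determined a (resample q f e).
Proof.
move=> fa w w' ww'; rewrite /resample; congr (_ * _ + _ * _); apply: fa => x xa;
by rewrite /set_edge; case: eqVneq => // _; exact: ww'.
Qed.

(** A resampled edge lies outside [a] or outside [b]; the corresponding factor does not feel it and
    comes out of the average. *)
Lemma expectM q s a b f g : determined a f -> determined b g ->
  (forall e, e \in a -> e \notin b) ->
  expect q s (fun w => f w * g w) = expect q s f * expect q s g.
Proof.
move=> + + ab; elim: s f g => //= e s IH f g fa gb; rewrite !expect_cons.
rewrite -IH; [|exact: resample_determined..].
congr (expect _ _ _); apply/funext => w; rewrite /resample.
case: (boolP (e \in a)) => ea.
  have eb := ab _ ea; rewrite !(determined_set_edge _ _ gb eb); ring.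
rewrite !(determined_set_edge _ _ fa ea); ring.
Qed.

Definition increasing f := forall w w', (forall e, w e -> w' e) -> f w <= f w'.

Lemma set_edge_le e c w w' : (forall x, w x -> w' x) ->
  forall x, set_edge e c w x -> set_edge e c w' x.
Proof. by move=> ww' x; rewrite /set_edge; case: eqVneq => // _; exact: ww'. Qed.

Lemma set_edge_ft e w x : set_edge e false w x -> set_edge e true w x.
Proof. by rewrite /set_edge; case: eqVneq. Qed.

Lemma resample_increasing q f e : 0 <= q <= 1 ->
  increasing f -> increasing (resample q f e).
Proof.
move=> /andP[q0 q1] fi w w' ww'; rewrite /resample lerD// ler_wpM2l ?subr_ge0//;
by apply: fi; apply: set_edge_le.
Qed.

(** Induction on the edges: resampling preserves monotonicity, and for a single edge the difference
    of the two sides is [q (1 - q) (f1 - f0) (g1 - g0)]. *)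
Lemma expect_harris q s f g : 0 <= q <= 1 -> increasing f -> increasing g ->
  expect q s f * expect q s g <= expect q s (fun w => f w * g w).
Proof.
move=> q01; elim: s f g => //= e s IH f g fi gi; rewrite !expect_cons.
apply: (le_trans (IH _ _ (@resample_increasing _ _ e q01 fi) (@resample_increasing _ _ e q01 gi))).
apply: expect_le => // w; rewrite /resample.
have := fi _ _ (@set_edge_ft e w); have := gi _ _ (@set_edge_ft e w).
case/andP: q01; set f1 := f (set_edge e true w); set f0 := f (set_edge e false w);
set g1 := g (set_edge e true w); set g0 := g (set_edge e false w).
move=> q0 q1 g01 f01; rewrite -subr_ge0.
rewrite [leRHS](_ : _ = q * (1 - q) * ((f1 - f0) * (g1 - g0))); last by ring.
by rewrite mulr_ge0// mulr_ge0// subr_ge0.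
Qed.

Lemma expect_le_param q q' s f : 0 <= q -> q <= q' -> q' <= 1 -> increasing f ->
  expect q s f <= expect q' s f.
Proof.
move=> q0 qq' q'1; have q01 : 0 <= q <= 1 by rewrite q0 (le_trans qq').
have q'01 : 0 <= q' <= 1 by rewrite q'1 (le_trans q0).
elim: s f => //= e s IH f fi; rewrite !expect_cons.
apply: (le_trans (IH _ (@resample_increasing _ _ e q01 fi))); apply: expect_le => // w.
rewrite /resample; have := fi _ _ (@set_edge_ft e w).
set f1 := f (set_edge e true w); set f0 := f (set_edge e false w) => f01; rewrite -subr_ge0.
rewrite [leRHS](_ : _ = (q' - q) * (f1 - f0)); last by ring.
by rewrite mulr_ge0 ?subr_ge0.
Qed.

Lemma expect_closed q s f : 0 <= q <= 1 -> (forall w, 0 <= f w) ->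
  (forall w, {in s, forall e, w e = false} -> 1 <= f w) ->
  (1 - q) ^+ size s <= expect q s f.
Proof.
move=> /[dup] q01 /andP[q0 q1].
elim: s f => [|e s IH] f f0 f1; first by rewrite expr0; apply: f1.
rewrite expect_cons /=.
apply: (@le_trans _ _ (expect q s (fun w => (1 - q) * f (set_edge e false w)))).
  rewrite expectZ exprS ler_wpM2l ?subr_ge0//; apply: IH => // w ws.
  apply: f1 => x; rewrite inE /set_edge; case: eqVneq => //= _; exact: ws.
by apply: expect_le => // w; rewrite /resample lerDr mulr_ge0.
Qed.

Lemma expect_edge q s e : e \in s ->
  expect q s (fun w => (w e)%:R) = q.
Proof.
elim: s => // x s IH; rewrite inE expect_cons; case: eqVneq => [-> _|ex /= es].
  rewrite -[RHS](expect_cst q s); congr (expect _ _ _); apply/funext => w.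
  by rewrite /resample /set_edge eqxx /=; ring.
rewrite -[RHS]IH//; congr (expect _ _ _); apply/funext => w.
by rewrite /resample /set_edge (negbTE ex); ring.
Qed.

(** Conditioning on the value of a random subset of [B]. Once the value [C] is fixed, [f C] may live
    on edges that the event [X w = C] does not examine, and [expectM] applies to each term. *)
Lemma expect_partition q s (V : choiceType) (X : config E -> {fset V}) (B : {fset V})
    (f : {fset V} -> config E -> R) : (forall w, X w `<=` B)%fset ->
  expect q s (fun w => f (X w) w) =
  \sum_(C <- fpowerset B) expect q s (fun w => (X w == C)%:R * f C w).
Proof.
move=> XB; rewrite -expect_sum; congr (expect _ _ _); apply/funext => w.
rewrite (big_rem (X w)) /=; last by rewrite fpowersetE.
rewrite eqxx mul1r big1_seq ?addr0// => C /=.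
rewrite mem_rem_uniq ?fset_uniq// inE => /andP[CX _].
by rewrite eq_sym (negbTE CX) mul0r.
Qed.

Lemma expect_indep q s a f : determined a f -> {subset a <= s} ->
  forall t, {subset a <= t} -> expect q s f = expect q t f.
Proof.
(* Once the edges of [a] are resampled nothing is left to average, so resampling
   [s] and then [t] agrees with resampling [t] and then [s]. *)
pose ev (s : seq E) (f : config E -> R) (w : config E) : R := foldl (resample q) f s w.
have evC e e' g : resample q (resample q g e) e' = resample q (resample q g e') e.
  apply/funext => w; rewrite /resample; have [->//|ee'] := eqVneq e e'.
  rewrite !(@set_edgeC e e')//; ring.
have ev1 e r g : ev r (resample q g e) = resample q (ev r g) e.
  elim: r g => // e' r IH g.
  by rewrite -[LHS]/(ev r (resample q (resample q g e) e')) evC IH.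
have evCC r r' g : ev r' (ev r g) = ev r (ev r' g).
  elim: r g => // e r IH g.
  by rewrite -[ev (e :: r) g]/(ev r (resample q g e)) IH ev1.
have evdet r g c : determined c g -> determined [seq x <- c | x \notin r] (ev r g).
  elim: r g c => [|e r IH] g c gc.
    by move=> w w' ww'; apply: gc => x xc; apply: ww'; rewrite mem_filter /= xc.
  move=> w w' ww'.
  have : determined [seq x <- c | x != e] (resample q g e).
    move=> v v' vv'; rewrite /resample; congr (_ * _ + _ * _); apply: gc => x xc;
    by rewrite /set_edge; case: eqVneq => // xe; apply: vv'; rewrite mem_filter /= xe.
  move=> /IH; apply => x; rewrite !mem_filter /= => /and3P[xr xe xc].
  by apply: ww'; rewrite mem_filter /= inE negb_or xe xr.
have evcst r g : determined [::] g -> ev r g = g.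
  move=> g0; elim: r => // e r IH; rewrite -[RHS]IH -[LHS]/(ev r (resample q g e)); congr (ev r _).
  apply/funext => w; rewrite /resample.
  by rewrite (g0 (set_edge e true w) w)// (g0 (set_edge e false w) w)//; ring.
move=> fa as_ t at_.
have sub0 r : {subset a <= r} -> determined [::] (ev r f).
  move=> ar; have := evdet r f a fa; rewrite (_ : [seq x <- a | x \notin r] = [::])//.
  by apply/eqP; rewrite -[_ == _]negbK -has_filter -all_predC; apply/allP => x /ar /= ->.
rewrite /expect -/(ev s f point) -/(ev t f point).
by rewrite -(evcst t _ (sub0 _ as_)) evCC evcst//; exact: sub0.
Qed.

End expectation.

Lemma expectB (R : realType) (E : choiceType) (q : R) (s : seq E) (f g : config E -> R) :
  expect q s (fun w => f w - g w) = expect q s f - expect q s g.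
Proof.
by rewrite -[in RHS]mulN1r -expectZ -expectD; congr (expect _ _ _);
  apply/funext => w; rewrite mulN1r.
Qed.

Lemma expect_open (R : realType) (E : choiceType) (q : R) (s : seq E) (f : config E -> R) :
  0 <= q <= 1 -> (forall w, 0 <= f w) ->
  (forall w : config E, {in s, forall e, w e} -> 1 <= f w) ->
  q ^+ size s <= expect q s f.
Proof.
move=> /[dup] q01 /andP[q0 q1].
elim: s f => [|e s IH] f f0 f1; first by rewrite expr0; apply: f1.
rewrite expect_cons /=.
apply: (@le_trans _ _ (expect q s (fun w => q * f (set_edge e true w)))).
  rewrite expectZ exprS ler_wpM2l//; apply: IH => // w ws.
  apply: f1 => x; rewrite inE /set_edge; case: eqVneq => //= _; exact: ws.
by apply: expect_le => // w; rewrite /resample lerDl mulr_ge0// subr_ge0.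
Qed.

Lemma expect_comp (R : realType) (E E' : choiceType) (q : R) (h : E' -> E)
    (s : seq E') (f : config E' -> R) : injective h ->
  expect q (map h s) (fun w => f (w \o h)) = expect q s f.
Proof.
move=> hi; elim: s f => //= e s IH f; rewrite !expect_cons -IH.
congr (expect _ _ _); apply/funext => w; rewrite /resample.
have H c : set_edge (h e) c w \o h = set_edge e c (w \o h).
  by apply/funext => x; rewrite /set_edge /= (inj_eq hi).
by rewrite !H.
Qed.

(** * Differentiation in the parameter *)

Lemma is_derive_onemr (R : realType) (q : R) :
  is_derive q 1 (fun r : R => 1 - r) (0 - 1).
Proof. apply: is_deriveB. Qed.

Section russo.
Variables (R : realType) (E : choiceType).
Implicit Types (q : R) (f : config E -> R) (e : E) (s : seq E).
Implicit Types (w : config E).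

Lemma expect_consE q e s f : expect q (e :: s) f =
  q * expect q s (fun w => f (set_edge e true w)) +
  (1 - q) * expect q s (fun w => f (set_edge e false w)).
Proof. by rewrite expect_cons -!expectZ -expectD. Qed.

Definition influence f e : config E -> R :=
  fun w => f (set_edge e true w) - f (set_edge e false w).

(** Product rule applied to [expect_consE]: the difference of the two conditional expectations is
    the influence of the first edge. As [s] has no repetition, the influences of the later edges
    commute with fixing that edge. *)
Lemma russo_formula q s f : uniq s ->
  is_derive q 1 (fun r => expect r s f)
    (\sum_(e <- s) expect q s (influence f e)).
Proof.
elim: s f => [|e s IH] f /=.
  by move=> _; rewrite big_nil; apply: is_derive_cst.
move=> /andP[es us].
under [X in is_derive _ _ X]eq_fun do rewrite expect_consE.
set f1 := fun w => _; set f0 := fun w => f (set_edge e false w).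
have D1 := IH f1 us; have D0 := IH f0 us.
pose D := (q *: \sum_(e <- s) expect q s (influence f1 e) +
  expect q s f1 *: 1) + ((1 - q) *: \sum_(e <- s) expect q s (influence f0 e) +
  expect q s f0 *: (0 - 1)).
have HD : is_derive q 1 ((@id R \* (fun r => expect r s f1)) \+
    ((fun r => 1 - r) \* (fun r => expect r s f0))) D.
  apply: is_deriveD; apply: is_deriveM.
apply: is_derive_eq HD _; rewrite /D big_cons expect_consE.
rewrite !scaler_sumr.
have -> : \sum_(j <- s) expect q (e :: s) (influence f j) =
    \sum_(j <- s) (q *: expect q s (influence f1 j) + (1 - q) *: expect q s (influence f0 j)).
  apply: eq_big_seq => j js; have je : j != e by apply: contraNneq es => <-.
  rewrite expect_consE /GRing.scale /=; congr (_ * _ + _ * _); congr (expect _ _ _);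
  by apply/funext => w; rewrite /influence /f1 /f0 !(@set_edgeC _ j e).
rewrite big_split /=.
set A := \sum_(i <- s) _; set B := \sum_(i <- s) _.
have Hc c : expect q s (fun w => influence f e (set_edge e c w)) =
    expect q s f1 - expect q s f0.
  rewrite -[- _]mulN1r -expectZ -expectD; congr expect; apply/funext => w.
  by rewrite /influence /f1 /f0 !set_edge_set mulN1r.
rewrite !Hc /GRing.scale /=; ring.
Qed.

Lemma expect_continuous s f : continuous (fun q => expect q s f).
Proof.
move=> q; apply: differentiable_continuous; apply/derivable1_diffP.
elim: s f => [|e s IH] f; first exact: derivable_cst.
under [X in derivable X]eq_fun do rewrite expect_consE.
have D1 := IH (fun w => f (set_edge e true w)).
have D0 := IH (fun w => f (set_edge e false w)).
have Di : derivable (@id R) q 1 by exact: derivable_id.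
have Dc : derivable (fun r : R => 1 - r) q 1.
  by have [] := is_derive_onemr q.
exact: (derivableD (derivableM Di D1) (derivableM Dc D0)).
Qed.

End russo.

(** The implied lower bound [(b - a) / (b (1 - a))] for [f b] is the value at [b] of the solution of
    [1 - f = q (1 - q) f'] that vanishes at [a]. *)
Lemma logistic_comparison (R : realType) (f f' : R -> R) (a b : R) :
  0 < a -> a < b -> b < 1 -> (forall q : R, is_derive q 1 f (f' q)) ->
  0 <= f a ->
  (forall q, a < q < b -> 1 - f q <= q * (1 - q) * f' q) ->
  b - a <= b * (1 - a) * f b.
Proof.
move=> a0 ab b1 df fa0 fle.
(* the hypothesis says that [ln (1 - f q) + ln (q / (1 - q))] is nonincreasing *)
pose h (q : R) := (1 - f q) * (q * (1 - q)^-1).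
have dh (q : R) : q < 1 -> is_derive q 1 h
   ((1 - f q) * (1 - q)^-2 - f' q * (q * (1 - q)^-1)).
  move=> q1; have q1' : 1 - q != 0 by rewrite gt_eqF ?subr_gt0.
  have dinv : is_derive q 1 (fun x : R => (1 - x)^-1) (- (1 - q) ^- 2 *: (0 - 1)).
    have d1 := is_derive_onemr q.
    apply: DeriveDef; first by apply: (@derivableV _ _ (fun x : R => 1 - x)) => //; case: d1.
    by rewrite (@deriveV _ _ (fun x : R => 1 - x))//; case: d1 => // _ ->.
  pose D := (1 - f q) *: (q *: (- (1 - q) ^- 2 *: (0 - 1)) + (1 - q)^-1 *: 1) +
    (q * (1 - q)^-1) *: (0 - f' q).
  have HD : is_derive q 1 ((fun x => 1 - f x) \* (@id R \* (fun x : R => (1 - x)^-1))) D.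
    have d2 : is_derive q 1 (fun x => 1 - f x) (0 - f' q) by apply: is_deriveB.
    have d3 : is_derive q 1 (@id R \* (fun x : R => (1 - x)^-1))
        (q *: (- (1 - q) ^- 2 *: (0 - 1)) + (1 - q)^-1 *: 1).
      apply: is_deriveM.
    exact: (is_deriveM d2 d3).
  apply: is_derive_eq HD _; rewrite /D /GRing.scale /=; field.
  exact: q1'.
have hle : h b <= h a.
  apply: (@ler0_derive1_nincr _ h a b) => //; rewrite ?ltW//.
  - move=> x; rewrite in_itv /= => /andP[ax xb].
    by have [] := dh x (lt_trans xb b1).
  - move=> x; rewrite in_itv /= => /andP[ax xb].
    have x1 := lt_trans xb b1; have x0 := lt_trans a0 ax.
    rewrite derive1E (@derive_val _ _ _ _ _ _ _ (dh x x1)) subr_le0.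
    have {}fle := fle x; rewrite ax xb in fle; have {}fle := fle isT.
    have y0 : 0 < 1 - x by rewrite subr_gt0.
    have -> : f' x * (x * (1 - x)^-1) = (x * (1 - x) * f' x) * (1 - x)^-2.
      by field; rewrite gt_eqF.
    by rewrite ler_wpM2r// invr_ge0 exprn_ge0// ltW.
  - apply: derivable_within_continuous => x; rewrite in_itv /= => /andP[ax xb].
    by have [] := dh x (le_lt_trans xb b1).
have a1 : 0 < 1 - a by rewrite subr_gt0 (lt_trans ab).
have b1' : 0 < 1 - b by rewrite subr_gt0.
have b0 := lt_trans a0 ab.
have : (1 - f b) * b * (1 - a) <= (1 - f a) * a * (1 - b).
  have -> : (1 - f b) * b * (1 - a) = h b * ((1 - a) * (1 - b)).
    by rewrite /h; field; rewrite gt_eqF.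
  have -> : (1 - f a) * a * (1 - b) = h a * ((1 - a) * (1 - b)).
    by rewrite /h; field; rewrite gt_eqF.
  by rewrite ler_wpM2r// mulr_ge0// ltW.
have : 0 <= f a * (a * (1 - b)) by rewrite !mulr_ge0// ltW.
nra.
Qed.

(** * Connections in Cayley graphs *)

Section connectivity.
Variable Gr : multigraph.
Implicit Types (x y z : vertex Gr) (w : config (edge Gr)) (e : edge Gr).

Lemma open_adjC w x y : open_adj w x y -> open_adj w y x.
Proof. by case=> e we [] ee; exists e => //; [right|left]. Qed.

Lemma open_walk_cat w k l x y z :
  open_walk w k x y -> open_walk w l y z -> open_walk w (k + l) x z.
Proof.
elim: k x => [x -> //|k IH x [u xu uy] yz] /=; exists u => //; exact: IH yz.
Qed.

Lemma connected_refl w x : connected_in w x x.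
Proof. by exists 0%N. Qed.

Lemma connected_trans w y x z :
  connected_in w x y -> connected_in w y z -> connected_in w x z.
Proof. by move=> [k xy] [l yz]; exists (k + l)%N; apply: open_walk_cat yz. Qed.

Lemma connected_adj w x y : open_adj w x y -> connected_in w x y.
Proof. by move=> xy; exists 1%N => /=; exists y. Qed.

Lemma connected_rcons w y x z :
  connected_in w x y -> open_adj w y z -> connected_in w x z.
Proof. by move=> xy /connected_adj; exact: connected_trans. Qed.

Lemma connected_sym w x y : connected_in w x y -> connected_in w y x.
Proof.
move=> [k]; elim: k x => [x ->|k IH x [u xu /IH uy]]; first exact: connected_refl.
by apply: connected_rcons uy _; exact: open_adjC.
Qed.

Lemma connected_ind w x (Q : vertex Gr -> Prop) : Q x ->
  (forall u v, Q u -> open_adj w u v -> Q v) ->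
  forall y, connected_in w x y -> Q y.
Proof.
move=> Qx Qs y [k]; elim: k x Qx => [x Qx <- //|k IH x Qx [u xu]].
by apply: IH; apply: Qs xu.
Qed.

Lemma open_adj_sub w w' x y : (forall e, w e -> w' e) ->
  open_adj w x y -> open_adj w' x y.
Proof. by move=> ww' [e we ee]; exists e => //; exact: ww'. Qed.

Lemma connected_sub w w' x y : (forall e, w e -> w' e) ->
  connected_in w x y -> connected_in w' x y.
Proof.
move=> ww'; apply: connected_ind; first exact: connected_refl.
by move=> u v xu /(open_adj_sub ww'); exact: connected_rcons.
Qed.

Definition keep_edges (P : pred (edge Gr)) w : config (edge Gr) :=
  fun e => w e && P e.

Lemma connected_restrict P w x y :
  connected_in (keep_edges P w) x y -> connected_in w x y.
Proof. by apply: connected_sub => e /andP[]. Qed.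

End connectivity.

(** Open edges may be collapsed, since the retractions of a free product onto its pieces contract
    the rest of the graph. *)
Lemma connected_map (Gr Gr' : multigraph) (r : vertex Gr -> vertex Gr')
    (w : config (edge Gr)) (w' : config (edge Gr')) x y :
  (forall u v, open_adj w u v -> r u = r v \/ open_adj w' (r u) (r v)) ->
  connected_in w x y -> connected_in w' (r x) (r y).
Proof.
move=> rw; apply: (@connected_ind _ w x (fun y => connected_in w' (r x) (r y))).
  exact: connected_refl.
by move=> u v xu /rw[<- //|]; exact: connected_rcons.
Qed.

(** * Edges around finite sets of vertices *)

Section cayley_geometry.
Variables (G : groupType) (S : set G) (gens : seq (set_type S)).
Hypothesis gensP : forall s, s \in gens.
Local Notation E := (edge (cayley S)).
Implicit Types (x y z u v : G) (w : config E) (e : E) (d : set_type S * bool).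
Implicit Types (B C : {fset G}).

(* The edges at a vertex, in both directions: [(s, true)] leads from [y] to
   [y * s] and [(s, false)] from [y] to [y * s^-1]. *)
Definition darts : seq (set_type S * bool) :=
  undup [seq (s, b) | s <- gens, b <- [:: true; false]].

Lemma mem_darts d : d \in darts.
Proof.
rewrite mem_undup; case: d => s b; apply/allpairsP; exists (s, b).
by split => //; case: b; rewrite !inE.
Qed.

Definition step y d : G :=
  (if d.2 then y * set_val d.1 else y * (set_val d.1)^-1)%g.

Definition dart_edge y d : E :=
  if d.2 then (y, d.1) else ((y * (set_val d.1)^-1)%g, d.1).

Lemma stepM g y d : step (g * y)%g d = (g * step y d)%g.
Proof. by rewrite /step; case: d.2; rewrite mulgA. Qed.

Lemma dart_edge_ends y d :
  ends (dart_edge y d) = (if d.2 then (y, step y d) else (step y d, y)).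
Proof. by rewrite /dart_edge /step; case: d => s [] //=; rewrite mulgVK. Qed.

Lemma open_adjP w x z : open_adj (Gr := cayley S) w x z <->
  exists2 d, w (dart_edge x d) & z = step x d.
Proof.
split=> [[e we ee]|[d wd ->]]; last first.
  by exists (dart_edge x d) => //; rewrite dart_edge_ends; case: d.2; [left|right].
case: e we ee => g s we /= [] [<- <-]; first by exists (s, true).
by exists (s, false); rewrite /dart_edge /step /= mulgK.
Qed.

Lemma connected_dart w x y d : connected_in (Gr := cayley S) w x y ->
  w (dart_edge y d) -> connected_in (Gr := cayley S) w x (step y d).
Proof. by move=> xy wd; apply: connected_rcons xy _; apply/open_adjP; exists d. Qed.

Lemma cayley_ind w x (Q : G -> Prop) : Q x ->
  (forall u d, Q u -> w (dart_edge u d) -> Q (step u d)) ->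
  forall y, connected_in (Gr := cayley S) w x y -> Q y.
Proof.
move=> Qx Qs; apply: (connected_ind (Gr := cayley S) Qx) => u v Qu.
by move=> /open_adjP[d wd ->]; exact: Qs.
Qed.

Definition translate_edge g e : E := ((g * e.1)%g, e.2).

Lemma translate_edge_inj g : injective (translate_edge g).
Proof. by move=> [a s] [b t] [/mulgI -> ->]. Qed.

Lemma translate_dart g u d : translate_edge g (dart_edge u d) = dart_edge (g * u)%g d.
Proof. by rewrite /translate_edge /dart_edge; case: d => s [] //=; rewrite mulgA. Qed.

Lemma connected_translate g w x y :
  connected_in (Gr := cayley S) w (g * x)%g (g * y)%g <->
  connected_in (Gr := cayley S) (w \o translate_edge g) x y.
Proof.
split=> xy; last first.
  apply: (connected_map (Gr := cayley S) (Gr' := cayley S) (r := fun u => (g * u)%g)) xy.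
  move=> u v /open_adjP[d wd ->]; right; apply/open_adjP; exists d; last by rewrite stepM.
  by rewrite -translate_dart.
rewrite -[x](mulKg g) -[y](mulKg g).
apply: (connected_map (Gr := cayley S) (Gr' := cayley S) (r := fun u => (g^-1 * u)%g)) xy.
move=> u v /open_adjP[d wd ->]; right; apply/open_adjP; exists d; last by rewrite stepM.
by rewrite /= translate_dart mulVKg.
Qed.

Definition inside B e := (e.1 \in B) && ((ends e).2 \in B).
Definition avoids B e := (e.1 \notin B) && ((ends e).2 \notin B).

Lemma inside_dart B y d : inside B (dart_edge y d) = (y \in B) && (step y d \in B).
Proof.
rewrite /inside; have /= := dart_edge_ends y d.
by case: d.2 => -[-> ->]//=; rewrite andbC.
Qed.

Lemma avoids_dart B y d :
  avoids B (dart_edge y d) = (y \notin B) && (step y d \notin B).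
Proof.
rewrite /avoids; have /= := dart_edge_ends y d.
by case: d.2 => -[-> ->]//=; rewrite andbC.
Qed.

Definition incident B : seq E := undup [seq dart_edge y d | y <- B, d <- darts].

Lemma incident_uniq B : uniq (incident B).
Proof. exact: undup_uniq. Qed.

Lemma mem_incident B e : (e \in incident B) = ~~ avoids B e.
Proof.
rewrite mem_undup; apply/allpairsP/idP => [[[y d] /= [yB _ ->]]|].
  by rewrite avoids_dart yB.
rewrite /avoids negb_and !negbK; case: e => g s /= /orP[] H.
  by exists (g, (s, true)); rewrite mem_darts.
by exists ((g * set_val s)%g, (s, false)); rewrite mem_darts /dart_edge /= mulgK.
Qed.

Lemma dart_edge_incident B y d : y \in B -> dart_edge y d \in incident B.
Proof. by move=> yB; rewrite mem_incident avoids_dart yB. Qed.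

Lemma inside_incident B e : inside B e -> e \in incident B.
Proof. by move=> /andP[eB _]; rewrite mem_incident /avoids eB. Qed.

(** The two darts of an edge start at its two ends, and only one end of a boundary edge lies in
    [B]. *)
Lemma dart_edge_inj B y d y' d' : y \in B -> step y d \notin B ->
  y' \in B -> step y' d' \notin B -> dart_edge y d = dart_edge y' d' ->
  (y, d) = (y', d').
Proof.
move: d d' => [s b] [s' b'] yB dB y'B d'B.
have := dart_edge_ends y (s, b); have := dart_edge_ends y' (s', b').
rewrite /dart_edge /=; case: b dB => dB; case: b' d'B => d'B //=.
- by move=> _ _ [-> ->].
- move=> _ _ [yE ss]; move: d'B; rewrite /step /= -yE yB //.
- by move=> _ _ [yE ss]; move: dB; rewrite /step /= yE y'B.
- by move=> _ _ [yE ss]; move: yE; rewrite ss => /mulIg ->.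
Qed.

Definition connected_within B w x y :=
  connected_in (Gr := cayley S) (keep_edges (Gr := cayley S) (inside B) w) x y.

Lemma connected_within_sub B w w' x y : {in incident B, forall e, w e -> w' e} ->
  connected_within B w x y -> connected_within B w' x y.
Proof.
move=> ww'; apply: connected_sub => e /andP[we eB]; rewrite /keep_edges eB andbT.
by apply: ww' => //; exact: inside_incident.
Qed.

Lemma connected_within_mem B w x y : x \in B -> connected_within B w x y -> y \in B.
Proof.
move=> xB; move: y; apply: cayley_ind => // u d _ /andP[_].
by rewrite inside_dart => /andP[].
Qed.

Lemma connected_within_determined B x y :
  determined (incident B) (fun w => connected_within B w x y).
Proof.
move=> w w' ww'; apply/propext; split; apply: connected_within_sub => e eB;
by rewrite ww'.
Qed.

Definition escapes B w x :=
  exists2 y, y \notin B & connected_in (Gr := cayley S) w x y.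

(** A path that leaves [B] can be cut at its first vertex outside [B]; up to there it only uses
    edges with an end in [B]. *)
Lemma escapes_sub B w w' x : {in incident B, forall e, w e -> w' e} ->
  escapes B w x -> escapes B w' x.
Proof.
move=> ww' [y yB xy].
suff [//|[yB' _]] : escapes B w' x \/ (y \in B /\ connected_in (Gr := cayley S) w' x y).
  by rewrite yB' in yB.
have out z : connected_in (Gr := cayley S) w' x z ->
    escapes B w' x \/ (z \in B /\ connected_in (Gr := cayley S) w' x z).
  by move=> xz; case: (boolP (z \in B)) => zB; [right|left; exists z].
move: y xy {yB}; apply: cayley_ind; first by apply: out; exact: connected_refl.
move=> u d [|[uB xu] wd]; [by left|apply: out].
by apply: connected_dart => //; apply: ww' => //; exact: dart_edge_incident.
Qed.

Lemma escapes_determined B x : determined (incident B) (fun w => escapes B w x).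
Proof.
move=> w w' ww'; apply/propext; split; apply: escapes_sub => e eB;
by rewrite ww'.
Qed.

Lemma escapes_dart B w y d : w (dart_edge y d) -> escapes B w (step y d) ->
  escapes B w y.
Proof.
move=> wd [z zB yz]; exists z => //; apply: connected_trans yz.
by apply: connected_dart => //; exact: connected_refl.
Qed.

(** * Exploring the cluster of a point inside a finite set *)

Section last_exit.
Variables (B : {fset G}) (o : G).
Hypothesis oB : o \in B.

Definition inner_cluster w : {fset G} :=
  [fset y in B | `[< connected_within B w o y >]]%fset.

Lemma mem_inner_cluster w y : (y \in inner_cluster w) = `[< connected_within B w o y >].
Proof.
rewrite !inE /=; apply/andP/idP => [[]//|H]; split=> //.
by move/asboolP: H; exact: connected_within_mem.
Qed.

Lemma inner_cluster_sub w : (inner_cluster w `<=` B)%fset.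
Proof. by apply/fsubsetP => x; rewrite !inE => /andP[]. Qed.

(** Cut the path at its last visit to the inner cluster. The next edge must leave [B], otherwise its
    far end would belong to the inner cluster as well, and the rest of the path never touches that
    cluster again. *)
Lemma last_exit w x : connected_in (Gr := cayley S) w o x ->
  x \in inner_cluster w \/
  exists y d, [/\ y \in inner_cluster w, step y d \notin B, w (dart_edge y d) &
    connected_in (Gr := cayley S)
      (keep_edges (Gr := cayley S) (avoids (inner_cluster w)) w) (step y d) x].
Proof.
set C := inner_cluster w => ox.
suff [|[_ ?]] : x \in C \/ (x \notin C /\ exists y d, [/\ y \in C, step y d \notin B,
    w (dart_edge y d) & connected_in (Gr := cayley S)
      (keep_edges (Gr := cayley S) (avoids C) w) (step y d) x]); [by left|by right|].
have CB := fsubsetP (inner_cluster_sub w).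
move: x ox; apply: cayley_ind.
  by left; rewrite mem_inner_cluster; apply/asboolP; exact: connected_refl.
move=> u d Qu wd; case: (boolP (step u d \in C)) => vC; [by left|right; split=> //].
case: Qu => [uC|[uC [y [d' [yC dB we yu]]]]].
  exists u, d; split=> //; last exact: connected_refl.
  apply: contra vC => vB; rewrite mem_inner_cluster; apply/asboolP.
  apply: connected_dart; first by apply/asboolP; rewrite -mem_inner_cluster.
  by rewrite /keep_edges wd inside_dart vB CB.
exists y, d'; split=> //; apply: connected_dart yu _.
by rewrite /keep_edges wd avoids_dart uC vC.
Qed.

(** Exploring from [o] only examines edges inside [B] that touch the cluster found so far. The list
    is therefore disjoint from the edges that leave [B] and from those that avoid [C]. *)
Lemma inner_cluster_determined C :
  determined [seq e <- incident B | inside B e && ~~ avoids C e]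
    (fun w => inner_cluster w == C).
Proof.
move=> w w' ww'.
suff H w1 w2 : {in [seq e <- incident B | inside B e && ~~ avoids C e], w1 =1 w2} ->
    inner_cluster w1 == C -> inner_cluster w2 == C.
  by apply/idP/idP; apply: H => // e /ww'.
move=> {ww' w w'} ww /eqP CE; set D := inner_cluster w1 in CE *.
rewrite -CE in ww *.
have eqw e : inside B e -> ~~ avoids D e -> w1 e = w2 e.
  by move=> eB eC; apply: ww; rewrite mem_filter eB eC inside_incident.
suff [H1 H2] : (forall y, connected_within B w1 o y -> connected_within B w2 o y) /\
    (forall y, connected_within B w2 o y -> y \in D).
  apply/eqP/fsetP => y; rewrite mem_inner_cluster.
  apply/asboolP/idP; first exact: H2.
  by rewrite mem_inner_cluster => /asboolP; exact: H1.
split=> y.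
  move=> oy; suff [] : y \in D /\ connected_within B w2 o y by [].
  move: y oy; apply: cayley_ind.
    by rewrite mem_inner_cluster; split; [apply/asboolP|]; exact: connected_refl.
  move=> u d [uD ou] /andP[wd ud]; split.
    rewrite mem_inner_cluster; apply/asboolP; apply: connected_dart.
      by apply/asboolP; rewrite -mem_inner_cluster.
    by rewrite /keep_edges wd ud.
  apply: connected_dart => //; rewrite /keep_edges ud -eqw ?wd//.
  by rewrite avoids_dart uD.
move: y; apply: cayley_ind.
  by rewrite mem_inner_cluster; apply/asboolP; exact: connected_refl.
move=> u d uD /andP[wd ud]; rewrite mem_inner_cluster; apply/asboolP.
apply: connected_dart.
  by apply/asboolP; rewrite -mem_inner_cluster.
rewrite /keep_edges ud eqw ?wd//; by rewrite avoids_dart uD.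
Qed.

End last_exit.

(** * Points that are not joined to the outside of a finite set *)

Section trapped.
Variable B : {fset G}.

Definition trapped w : {fset G} := [fset x in B | ~~ `[< escapes B w x >]]%fset.

Lemma mem_trapped w x : (x \in trapped w) = ~~ `[< escapes B w x >].
Proof.
rewrite !inE /=; apply/andP/idP => [[]//|H]; split=> //.
apply: contraNT H => xB; apply/asboolP; exists x => //; exact: connected_refl.
Qed.

Lemma trapped_sub w : (trapped w `<=` B)%fset.
Proof. by apply/fsubsetP => x; rewrite !inE => /andP[]. Qed.

Lemma trapped_boundary w y d : y \in trapped w -> step y d \notin trapped w ->
  w (dart_edge y d) = false.
Proof.
rewrite !mem_trapped negbK => /asboolPn yn /asboolP sn.
by apply: contra_notF yn => wd; exact: escapes_dart wd sn.
Qed.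

(** The far end of a boundary edge of the trapped set escapes, so opening that edge lets [o] escape
    through [y]. The edge was closed, hence closing it changes nothing. *)
Lemma trapped_pivotal o w y d : y \in trapped w -> step y d \notin trapped w ->
  connected_within (trapped w) w o y -> o \in trapped w ->
  [/\ w (dart_edge y d) = false, escapes B (set_edge (dart_edge y d) true w) o &
     ~ escapes B (set_edge (dart_edge y d) false w) o].
Proof.
move=> yT dT oy oT; have we := trapped_boundary yT dT; split=> //; last first.
  by rewrite set_edge_id//; apply/asboolPn; rewrite -mem_trapped.
have ww e : w e -> set_edge (dart_edge y d) true w e.
  by rewrite /set_edge; case: eqVneq.
move: dT; rewrite mem_trapped negbK => /asboolP[z zB yz]; exists z => //.
apply: connected_trans (connected_sub ww yz).
apply: connected_dart; last by rewrite /set_edge eqxx.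
exact: connected_sub ww (connected_restrict oy).
Qed.

(* When [trapped w = C] every edge leaving [C] is closed, so the edges inside [C]
   have no influence on which points escape. *)
Lemma trapped_determined C :
  determined [seq e <- incident B | ~~ inside C e] (fun w => trapped w == C).
Proof.
move=> w w' ww'.
suff H w1 w2 : {in [seq e <- incident B | ~~ inside C e], w1 =1 w2} ->
    trapped w1 == C -> trapped w2 == C.
  by apply/idP/idP; apply: H => // e /ww'.
move=> {ww' w w'} ww /eqP CE.
have eqw u d : u \in B -> ~~ ((u \in C) && (step u d \in C)) ->
    w1 (dart_edge u d) = w2 (dart_edge u d).
  by move=> uB uC; apply: ww; rewrite mem_filter inside_dart uC dart_edge_incident.
have CB : {subset C <= B} by rewrite -CE; exact/fsubsetP/trapped_sub.
apply/eqP/fsetP => x; rewrite -[in RHS]CE !mem_trapped.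
congr (~~ _); apply/asboolP/asboolP => [[z zB xz]|[z zB xz]].
  apply: contrapT => /asboolPn; rewrite -mem_trapped CE => xC.
  suff : z \in C by move/CB; rewrite (negbTE zB).
  move: z xz {zB}; apply: cayley_ind => // u d uC wd.
  apply: contraT => dC; rewrite -eqw ?CB ?uC//= in wd.
  by rewrite (@trapped_boundary w1 u d) ?CE in wd.
suff [E2|zE] : escapes B w2 x \/ (connected_in (Gr := cayley S) w2 x z).
  - exact: E2.
  - by exists z.
have xn : escapes B w1 x by exists z.
suff [E2|[]] : escapes B w2 x \/
  (connected_in (Gr := cayley S) w2 x z /\ escapes B w1 z); [by left|by right|].
move: z xz {zB}; apply: cayley_ind; first by right; split=> //; exact: connected_refl.
move=> u d [|[xu un] wd]; [by left|].
case: (boolP (u \in B)) => uB; last by left; exists u.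
have sn : escapes B w1 (step u d).
  case: un => v vB uv; exists v => //; apply: connected_trans uv.
  apply: connected_sym; apply: connected_dart => //; exact: connected_refl.
right; split=> //; apply: connected_dart => //; rewrite -eqw//.
by rewrite -CE !mem_trapped; apply/negP => /andP[/negP[]]; apply/asboolP.
Qed.

End trapped.

(** * Balls of the word metric, as finite sets *)

Fixpoint cball n : {fset G} :=
  if n is n'.+1 then
    (cball n' `|` [fset z in [seq step y d | y <- cball n', d <- darts]])%fset
  else [fset (1 : G)%g]%fset.

Lemma in_ballS n x :
  reflect (x \in cball n \/ exists2 y, y \in cball n & exists d, x = step y d)
    (x \in cball n.+1).
Proof.
rewrite /= !inE; apply: (iffP orP) => -[xn|H]; [by left| |by left|right].
  by case/allpairsP: H => -[y d] [/= yn _ ->]; right; exists y => //; exists d.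
by case: H => y yn [d ->]; apply/allpairsP; exists (y, d); rewrite mem_darts.
Qed.

Lemma ball_le n m : (n <= m)%N -> {subset cball n <= cball m}.
Proof.
move=> /subnK <-; elim: (m - n)%N => // k IH x /IH xn; rewrite addSn.
by apply/in_ballS; left.
Qed.

Lemma in_ball0 x : (x \in cball 0) = (x == 1%g).
Proof. by rewrite !inE. Qed.

Lemma ball1 n : 1%g \in cball n.
Proof. by apply: (@ball_le 0) => //; rewrite in_ball0. Qed.

Lemma step_ball n y d : y \in cball n -> step y d \in cball n.+1.
Proof. by move=> yn; apply/in_ballS; right; exists y => //; exists d. Qed.

Lemma ballP n x : reflect
  (exists2 k, (k <= n)%N & open_walk (Gr := cayley S) (fun=> true) k 1%g x)
  (x \in cball n).
Proof.
apply: (iffP idP) => [|[k kn W]].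
  elim: n x => [x|n IH x].
    by rewrite in_ball0 => /eqP ->; exists 0%N.
  case/in_ballS => [/IH[k kn W]|[y /IH[k kn W] [d ->]]].
    by exists k => //; exact: leqW.
  exists (k + 1)%N; first by rewrite addn1.
  by apply: open_walk_cat W _; exists (step y d) => //; apply/open_adjP; exists d.
apply: (ball_le kn); elim: k {kn} x W => [x <-|k IH x W]; first exact: ball1.
(* [open_walk] unfolds at its first step, whereas the balls grow at the last one. *)
have H l a b : open_walk (Gr := cayley S) (fun=> true) l.+1 a b ->
    exists2 c, open_walk (Gr := cayley S) (fun=> true) l a c &
      open_adj (Gr := cayley S) (fun=> true) c b.
  elim: l a => [a [c ac <-]|l IHl a [c ac /IHl[c' cc' c'b]]]; first by exists a.
  by exists c' => //; exists c.
have [c /IH cb /open_adjP[d _ ->]] := H _ _ _ W; exact: step_ball.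
Qed.

Lemma ballD n m x y : x \in cball n -> y \in cball m -> (x * y)%g \in cball (n + m).
Proof.
move=> xn; elim: m y => [y|m IH y].
  by rewrite in_ball0 addn0 => /eqP ->; rewrite mulg1.
case/in_ballS => [/IH|[z /IH zm [d ->]]]; rewrite addnS.
  exact: (ball_le (leqnSn _)).
by rewrite -stepM; exact: step_ball.
Qed.

Lemma ballV n x : x \in cball n -> (x^-1)%g \in cball n.
Proof.
elim: n x => [x|n IH x]; first by rewrite !in_ball0 => /eqP ->; rewrite invg1.
case/in_ballS => [/IH|[y /IH yn [[s b] ->]]]; first exact: (ball_le (leqnSn _)).
rewrite -[n.+1]add1n; have -> : (step y (s, b))^-1%g = (step 1 (s, ~~ b) * y^-1)%g.
  by rewrite /step; case: b; rewrite /= !mul1g invgM ?invgK.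
by apply: ballD => //; apply: step_ball; exact: ball1.
Qed.

End cayley_geometry.

(** * Two-point functions *)

Definition ind (R : realType) (P : Prop) : R := (nat_of_bool `[< P >])%:R.
Arguments ind : clear implicits.

Section indicator.
Variable R : realType.
Implicit Types P Q : Prop.

Lemma ind_ge0 P : 0 <= ind R P. Proof. exact: ler0n. Qed.

Lemma ind_le1 P : ind R P <= 1. Proof. by rewrite /ind; case: asbool. Qed.

Lemma indT P : P -> ind R P = 1. Proof. by rewrite /ind => /asboolP ->. Qed.

Lemma indF P : ~ P -> ind R P = 0.
Proof. by rewrite /ind => /asboolPn /negbTE ->. Qed.

Lemma ind_le P Q : (P -> Q) -> ind R P <= ind R Q.
Proof.
move=> PQ; have [p|p] := pselect P; first by rewrite (indT p) (indT (PQ p)).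
by rewrite (indF p) ind_ge0.
Qed.

Lemma ind_and P Q : ind R (P /\ Q) = ind R P * ind R Q.
Proof. by rewrite /ind -natrM mulnb asbool_and. Qed.

End indicator.

Section percolation.
Variables (R : realType) (E : choiceType) (p : {i01 R}).
Local Notation P := (@bond_percolation R E p).
Local Notation ev := (set (g_sigma_algebraType (@measurable _ (config E)))).
Implicit Types (A : set (config E)).

Lemma i01P : 0 <= p%:num <= 1.
Proof. by apply/andP. Qed.

Lemma cylinder_measurable A : cylinder A -> measurable (A : ev).
Proof. by move=> cA; exact: sub_sigma_algebra. Qed.

(** The bridge from the product measure to finite expectations. *)
Lemma percolationE A s : determined s A -> P A = (expect p%:num s (fun w => ind R (A w)))%:E.
Proof.
move=> As; have cA : cylinder A by exists s.
transitivity (bernoulli_content p A); first exact: measurable_mu_extE.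
rewrite (bernoulli_contentE p As) average_seq_expect; congr (expect _ _ _)%:E.
Qed.

Lemma percolation_le A (B : set (config E)) : measurable (A : ev) -> measurable (B : ev) ->
  A `<=` B -> (P A <= P B)%E.
Proof. by move=> mA mB AB; apply: (le_measure P) => //; exact: mem_set. Qed.

End percolation.

(** * Percolation restricted along an injection of edge sets *)

Section reindexing.
Variables (R : realType) (E E' : choiceType) (p : {i01 R}) (h : E' -> E).
Hypothesis hI : injective h.
Local Notation T := (g_sigma_algebraType (@measurable _ (config E))).
Local Notation T' := (g_sigma_algebraType (@measurable _ (config E'))).

Definition reindex : T -> T' := fun w => (w : config E) \o h.

Lemma reindex_cylinder (A : set (config E')) (s : seq E') :
  determined s A -> determined (map h s) (fun w : config E => A (w \o h)).
Proof. by move=> As w w' ww'; apply: As => e es; apply: ww'; apply: map_f. Qed.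

Lemma measurable_reindex : measurable_fun setT reindex.
Proof.
apply: (@measurability _ _ T T' setT reindex (@measurable _ (config E'))) => //.
move=> _ [A [s As] <-]; rewrite setTI; apply: cylinder_measurable.
by exists (map h s); exact: reindex_cylinder.
Qed.

HB.instance Definition _ := isMeasurableFun.Build _ _ _ _ reindex measurable_reindex.

(** The image measure agrees with percolation on cylinders by [expect_comp], hence everywhere by
    uniqueness of the extension. This serves both for translations and for the copy of a factor
    inside the free product. *)
Lemma percolation_reindex (A : set (config E')) : measurable (A : set T') ->
  bond_percolation p [set w : config E | A (w \o h)] = bond_percolation p A.
Proof.
move=> mA.
rewrite -[LHS]/(pushforward (@bond_percolation R E p) reindex A).
apply/esym; apply: (@measure_extension_unique _ _ _ (@bernoulli_content R E' p)
  _ (pushforward (@bond_percolation R E p) reindex)) => //.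
- by exists (fun=> setT); [rewrite bigcup_const|move=> _; split; [exact: measurableT|
    rewrite (_ : _ setT = 1%E) ?ltry//; exact: bernoulli_contentT]].
- move=> X [s Xs]; transitivity (bond_percolation p X).
    by apply/esym/measurable_mu_extE; exists s.
  rewrite -[RHS]/(bond_percolation p [set w : config E | X (w \o h)]).
  rewrite (percolationE p (reindex_cylinder Xs)) (percolationE p Xs).
  by rewrite -(expect_comp p%:num s (fun w => ind R (X w)) hI).
Qed.

End reindexing.

Section two_point.
Variables (R : realType) (G : groupType) (S : set G) (gens : seq (set_type S)).
Hypothesis gensP : forall s, s \in gens.
Hypothesis Sgen : generates S.
Local Notation E := (edge (cayley S)).
Local Notation ev := (set (g_sigma_algebraType (@measurable _ (config E)))).
Local Notation conn := (connected_in (Gr := cayley S)).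
Local Notation cball := (cball gens).
Local Notation incident := (incident gens).
Implicit Types (x y z : G) (w : config E) (p : {i01 R}) (T : seq E).

(** The union of the balls is a subgroup containing [S]. *)
Lemma ball_exhausts x : exists n, x \in cball n.
Proof.
suff H : [set x | exists n, x \in cball n] = setT.
  by have : [set x | exists n, x \in cball n] x by rewrite H.
apply: Sgen.
  split; first by exists 0%N; exact: (ball1 gensP).
  - by move=> u v [n un] [m vm]; exists (n + m)%N; exact: (ballD gensP un vm).
  - by move=> u [n un]; exists n; exact: (ballV gensP un).
move=> s Ss; exists 1%N; apply/(in_ballS gensP); right; exists 1%g; first exact: (ball1 gensP).
by exists (SigSub (mem_set Ss), true); rewrite /step /= mul1g.
Qed.

Lemma ball_exhausts_fset (B : {fset G}) : exists n, {subset B <= cball n}.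
Proof.
suff [n Hn] : exists n, {subset enum_fset B <= cball n} by exists n => x xB; apply: Hn.
elim: (enum_fset B) => [|x s [n IH]]; first by exists 0%N.
have [m xm] := ball_exhausts x; exists (maxn n m) => y; rewrite inE.
case/orP => [/eqP ->|/IH]; first exact: (ball_le gensP (leq_maxr n m)).
exact: (ball_le gensP (leq_maxl n m)).
Qed.

Definition connected_along T w x y := conn (keep_edges (Gr := cayley S) (fun e => e \in T) w) x y.

Lemma connected_along_determined T x y :
  determined T (fun w => connected_along T w x y).
Proof.
move=> w w' ww'; rewrite /connected_along.
suff -> : keep_edges (Gr := cayley S) (fun e => e \in T) w =
  keep_edges (Gr := cayley S) (fun e => e \in T) w' by [].
apply/funext => e; rewrite /keep_edges; case: (boolP (e \in T)) => eT; last by rewrite !andbF.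
by rewrite (ww' _ eT).
Qed.

Lemma connected_along_le T T' w x y : {subset T <= T'} ->
  connected_along T w x y -> connected_along T' w x y.
Proof.
by move=> TT'; apply: connected_sub => e /andP[we /= eT]; rewrite /keep_edges we /= TT'.
Qed.

Lemma connected_along_incr T w w' x y : (forall e, w e -> w' e) ->
  connected_along T w x y -> connected_along T w' x y.
Proof. by move=> ww'; apply: connected_sub => e /andP[/ww' we ?]; rewrite /keep_edges we. Qed.

Lemma incident_ball_le n m : (n <= m)%N -> {subset incident (cball n) <= incident (cball m)}.
Proof.
move=> nm e; rewrite !mem_incident//; apply: contra => /andP[e1 e2].
apply/andP; split; [apply: contra e1|apply: contra e2]; exact: (ball_le gensP nm).
Qed.

Lemma edge_exhausts (e : E) : exists n, e \in incident (cball n).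
Proof.
have [n en] := ball_exhausts e.1; exists n.
by rewrite mem_incident// /avoids en.
Qed.

Lemma connected_bigcup x y : [set w | conn w x y] =
  \bigcup_n [set w | connected_along (incident (cball n)) w x y].
Proof.
apply/seteqP; split=> w /=; last by move=> [n _]; exact: connected_restrict.
move=> xy; suff [n H] : exists n, connected_along (incident (cball n)) w x y by exists n.
move: y xy; apply: cayley_ind; first by exists 0%N; exact: connected_refl.
move=> u d [n xu] wd; have [m em] := edge_exhausts (dart_edge u d).
exists (maxn n m); apply: (@connected_dart _ S _ x u).
  exact: connected_along_le (incident_ball_le (leq_maxl n m)) xu.
by rewrite /keep_edges wd /=; exact: (incident_ball_le (leq_maxr n m)).
Qed.

Lemma connected_along_cylinder T x y : cylinder [set w | connected_along T w x y].
Proof. by exists T; exact: connected_along_determined. Qed.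

Lemma connected_measurable x y : measurable ([set w | conn w x y] : ev).
Proof.
rewrite connected_bigcup; apply: bigcup_measurable => n _.
apply: cylinder_measurable; exact: connected_along_cylinder.
Qed.

Definition tau p x y : R := fine (bond_percolation p [set w : config E | conn w x y]).

Lemma tauE p x y : bond_percolation p [set w : config E | conn w x y] = (tau p x y)%:E.
Proof. by rewrite /tau fineK// fin_num_measure//; exact: connected_measurable. Qed.

Lemma tau_ge0 p x y : 0 <= tau p x y.
Proof. by rewrite -lee_fin -tauE. Qed.

Lemma tau_le1 p x y : tau p x y <= 1.
Proof. by rewrite -lee_fin -tauE probability_le1//; exact: connected_measurable. Qed.

Definition tau_along q T x y : R := expect q T (fun w => ind R (connected_along T w x y)).

Lemma tau_alongE q T T' x y : {subset T <= T'} ->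
  expect q T' (fun w => ind R (connected_along T w x y)) = tau_along q T x y.
Proof.
move=> TT'; apply: (@expect_indep _ _ _ _ T) => //.
by move=> w w' ww'; rewrite (connected_along_determined x y ww').
Qed.

Lemma tau_along_tau p T x y : tau_along p%:num T x y <= tau p x y.
Proof.
rewrite -lee_fin -tauE /tau_along -(percolationE p (@connected_along_determined T x y)).
apply: percolation_le; last by move=> w; exact: connected_restrict.
  apply: cylinder_measurable; exact: connected_along_cylinder.
exact: connected_measurable.
Qed.

(** Continuity from below along the increasing events of [connected_bigcup]; it reduces upper bounds
    on [tau] to finitely many edges. *)
Lemma tau_le p x y (c : R) :
  (forall n, tau_along p%:num (incident (cball n)) x y <= c) -> tau p x y <= c.
Proof.
move=> H; rewrite -lee_fin -tauE connected_bigcup.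
have mF n : measurable ([set w | connected_along (incident (cball n)) w x y] : ev).
  apply: cylinder_measurable; exact: connected_along_cylinder.
have hF : {homo (fun n => [set w | connected_along (incident (cball n)) w x y]) :
    n m / (n <= m)%N >-> (n <= m)%O}.
  move=> n m nm; apply/subsetPset => w /=; apply: connected_along_le.
  exact: incident_ball_le.
have /cvg_lim := @nondecreasing_cvg_mu _ _ _ (bond_percolation p)
  (fun n => [set w | connected_along (incident (cball n)) w x y] : ev) mF
  (bigcup_measurable (fun n _ => mF n)) hF.
move=> <-//.
apply: lime_le.
  apply: ereal_nondecreasing_is_cvgn => n m nm; apply: percolation_le => //.
  by move=> w /=; apply: connected_along_le; exact: incident_ball_le.
apply: nearW => n /=; rewrite (percolationE p (@connected_along_determined _ x y)) lee_fin.
exact: H.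
Qed.

Lemma tau_along_le q T T' x y : 0 <= q <= 1 -> {subset T <= T'} ->
  tau_along q T x y <= tau_along q T' x y.
Proof.
move=> q01 TT'; rewrite -(tau_alongE q x y TT'); apply: expect_le => // w.
exact/ind_le/connected_along_le.
Qed.

Lemma ind_connected_along_incr T x y :
  increasing (fun w => ind R (connected_along T w x y)).
Proof. by move=> w w' ww'; apply: ind_le; exact: connected_along_incr. Qed.

Lemma tau_mono p p' x y : p%:num <= p'%:num -> tau p x y <= tau p' x y.
Proof.
move=> pp'; apply: tau_le => n; apply: le_trans (tau_along_tau p' _ x y).
apply: expect_le_param => //; exact: ind_connected_along_incr.
Qed.

Lemma tau_refl p x : tau p x x = 1.
Proof.
apply/eqP; rewrite eq_le tau_le1 -lee_fin -tauE /=.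
rewrite (_ : [set w | _] = setT) ?probability_setT//.
by apply/seteqP; split=> // w _; exact: connected_refl.
Qed.

Lemma tau_translate p g x y : tau p (g * x)%g (g * y)%g = tau p x y.
Proof.
apply/EFin_inj; rewrite -!tauE.
rewrite -(percolation_reindex p (@translate_edge_inj _ S g) (connected_measurable x y)).
by congr (bond_percolation p _); apply/seteqP; split=> w /= /connected_translate.
Qed.

Lemma tau1 p x y : tau p x y = tau p 1%g (x^-1 * y)%g.
Proof. by rewrite -(tau_translate p x^-1%g) mulVg. Qed.

Lemma tau_harris p x y z : tau p x y * tau p y z <= tau p x z.
Proof.
pose T n := incident (cball n).
have main n m : tau_along p%:num (T n) x y * tau_along p%:num (T m) y z <= tau p x z.
  pose k := maxn n m; apply: le_trans (tau_along_tau p (T k) x z).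
  apply: (@le_trans _ _ (tau_along p%:num (T k) x y * tau_along p%:num (T k) y z)).
    apply: ler_pM; try (apply: expect_ge0 => [|w]; [exact: i01P|exact: ind_ge0]).
      by apply: tau_along_le; [exact: i01P|exact: incident_ball_le (leq_maxl n m)].
    by apply: tau_along_le; [exact: i01P|exact: incident_ball_le (leq_maxr n m)].
  apply: le_trans (expect_harris _ (i01P p) (ind_connected_along_incr _ _ _)
    (ind_connected_along_incr _ _ _)) _.
  apply: expect_le => [|w]; first exact: i01P.
  rewrite -ind_and; apply: ind_le => -[]; exact: connected_trans.
have pos n u v : 0 <= tau_along p%:num (T n) u v.
  by apply: expect_ge0 => [|w]; [exact: i01P|exact: ind_ge0].
(* The two volumes are sent to infinity one after the other; dividing by the remaining factor puts
   each limit in the form of [tau_le]. *)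
have step1 m : tau p x y * tau_along p%:num (T m) y z <= tau p x z.
  have [->|b0] := eqVneq (tau_along p%:num (T m) y z) 0; first by rewrite mulr0 tau_ge0.
  have b1 : 0 < tau_along p%:num (T m) y z by rewrite lt0r b0 pos.
  by rewrite -ler_pdivlMr//; apply: tau_le => n; rewrite ler_pdivlMr//; exact: main.
have [->|b0] := eqVneq (tau p x y) 0; first by rewrite mul0r tau_ge0.
have b1 : 0 < tau p x y by rewrite lt0r b0 tau_ge0.
rewrite mulrC -ler_pdivlMr//; apply: tau_le => n; rewrite ler_pdivlMr// mulrC.
exact: step1.
Qed.

Lemma escapes_incr (B : {fset G}) x w w' : (forall e, w e -> w' e) ->
  escapes B w x -> escapes B w' x.
Proof. by move=> ww' [y yB xy]; exists y => //; exact: connected_sub xy. Qed.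

(* Isolated vertices occur with positive probability. *)
Lemma tau_lt1 p : p%:num < 1 -> exists2 d : R, 0 < d & forall x, x <> 1%g -> tau p 1%g x <= 1 - d.
Proof.
move=> p1; pose B := [fset (1 : G)%g]%fset.
exists ((1 - p%:num) ^+ size (incident B)); first by rewrite exprn_gt0// subr_gt0.
move=> x x1; rewrite lerBrDr -lerBrDl.
have cE := escapes_determined (S := S) gensP (B := B) 1%g.
have : tau p 1%g x <= expect p%:num (incident B) (fun w => ind R (escapes B w 1%g)).
  rewrite -lee_fin -tauE -(percolationE p cE); apply: percolation_le.
  - exact: connected_measurable.
  - by apply: cylinder_measurable; exists (incident B).
  - by move=> w /= ox; exists x => //; rewrite !inE; apply/eqP.
move=> /(lerB (lexx 1)); apply: le_trans.
rewrite -[X in _ <= 1 + X]mulN1r -expectZ.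
rewrite -[X in _ <= X + _](expect_cst p%:num (incident B)) -expectD.
apply: expect_closed => [|w|w wB]; first exact: i01P.
  by rewrite mulN1r subr_ge0 ind_le1.
rewrite indF ?mulr0 ?addr0//= => -[y yB oy].
suff : y = 1%g by move=> y1; rewrite y1 !inE eqxx in yB.
move: y oy {yB}; apply: cayley_ind => // u d -> wd.
by rewrite (wB (dart_edge 1%g d)) in wd => //; apply: dart_edge_incident => //; rewrite !inE.
Qed.

End two_point.

(** * Sharpness of the phase transition *)

Lemma ler_sum_subset (R : realType) (T : eqType) (s t : seq T) (h : T -> R) :
  uniq s -> uniq t -> {subset s <= t} -> (forall x, 0 <= h x) ->
  \sum_(x <- s) h x <= \sum_(x <- t) h x.
Proof.
move=> us ut st h0; rewrite [leRHS](bigID (mem s)) /=.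
have -> : \sum_(x <- t | x \in s) h x = \sum_(x <- s) h x.
  rewrite -big_filter; apply: perm_big; apply: uniq_perm => //.
    exact: filter_uniq.
  by move=> x; rewrite mem_filter; case: (boolP (x \in s)) => // /st ->.
by rewrite lerDl sumr_ge0.
Qed.

Lemma continuous_bigsum (R : realType) (I : Type) (r : seq I) (P : pred I)
    (F : I -> R -> R) : (forall i, continuous (F i)) ->
  continuous (fun q => \sum_(i <- r | P i) F i q).
Proof.
move=> Fc; elim: r => [|i r IH].
  rewrite (_ : (fun q => _) = fun=> 0); first exact: cst_continuous.
  by apply/funext => q; rewrite big_nil.
rewrite (_ : (fun q => _) = if P i
    then fun q => F i q + \sum_(j <- r | P j) F j q
    else fun q => \sum_(j <- r | P j) F j q); last first.
  by apply/funext => q; rewrite big_cons; case: ifP.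
by case: ifP => // _ q; apply: continuousD; [exact: Fc|exact: IH].
Qed.

Section sharpness.
Variables (R : realType) (G : groupType) (S : set G) (gens : seq (set_type S)).
Hypothesis gensP : forall s, s \in gens.
Hypothesis Sgen : generates S.
Local Notation E := (edge (cayley S)).
Local Notation conn := (connected_in (Gr := cayley S)).
Local Notation cball := (cball gens).
Local Notation incident := (incident gens).
Local Notation darts := (darts gens).
Implicit Types (x y z : G) (w : config E) (p : {i01 R}) (T : seq E) (B C : {fset G}).
Implicit Types (q : R) (d : set_type S * bool).

Definition tau_within q B y : R :=
  expect q (incident B) (fun w => ind R (connected_within B w 1%g y)).

(* The quantity [phi_p(S)] of Duminil-Copin and Tassion. *)
Definition phi q B : R :=
  \sum_(y <- B) \sum_(d <- darts | step y d \notin B) q * tau_within q B y.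

(** A shorter list than [incident B]: for [B = C] it is disjoint from the edges on which
    [trapped w == C] depends. *)
Lemma connected_within_determined_inside B x y :
  determined [seq e <- incident B | inside B e] (fun w => connected_within B w x y).
Proof.
move=> w w' ww'; rewrite /connected_within.
suff -> : keep_edges (Gr := cayley S) (inside B) w =
  keep_edges (Gr := cayley S) (inside B) w' by [].
apply/funext => e; rewrite /keep_edges; case: (boolP (inside B e)) => eB; last by rewrite !andbF.
by rewrite ww'// mem_filter eB inside_incident.
Qed.

Lemma tau_within_expect q B T y : {subset incident B <= T} ->
  expect q T (fun w => ind R (connected_within B w 1%g y)) = tau_within q B y.
Proof.
move=> BT; apply: (@expect_indep _ _ _ _ (incident B)) => //.
by move=> w w' ww'; rewrite (connected_within_determined gensP 1%g y ww').
Qed.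

Lemma tau_within_ge0 q B y : 0 <= q <= 1 -> 0 <= tau_within q B y.
Proof. by move=> q01; apply: expect_ge0 => // w; exact: ind_ge0. Qed.

Lemma tau_within_mono q q' B y : 0 <= q -> q <= q' -> q' <= 1 ->
  tau_within q B y <= tau_within q' B y.
Proof.
move=> q0 qq' q1; apply: expect_le_param => // w w' ww'; apply: ind_le.
by apply: connected_within_sub => // e _; exact: ww'.
Qed.

Lemma phi_mono q q' B : 0 <= q -> q <= q' -> q' <= 1 -> phi q B <= phi q' B.
Proof.
move=> q0 qq' q1; apply: ler_sum => y _; apply: ler_sum => d _.
apply: ler_pM => //; last exact: tau_within_mono.
by apply: tau_within_ge0; rewrite q0 (le_trans qq').
Qed.

Lemma phi_continuous B : continuous (fun q => phi q B).
Proof.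
apply: continuous_bigsum => y; apply: continuous_bigsum => d q.
by apply: cvgM; [exact: cvg_id|exact: expect_continuous].
Qed.

(** Condition on the inner cluster [C] and apply [last_exit]. The event that the inner cluster is
    [C], the state of the exit edge and the connection from its far end to [x] depend respectively
    on edges inside [B] touching [C], on an edge leaving [B] from [C], and on edges avoiding [C]:
    three disjoint lists. Summing over [C] restores [tau_within]. *)
Lemma simon_lieb_along q B T x : 0 <= q <= 1 -> 1%g \in B ->
  {subset incident B <= T} ->
  tau_along q T 1%g x <= (x \in B)%:R +
  \sum_(y <- B) \sum_(d <- darts | step y d \notin B)
    q * tau_within q B y * tau_along q T (step y d) x.
Proof.
move=> q01 B1 BT.
pose K w : config E := keep_edges (Gr := cayley S) (fun e => e \in T) w.
pose X w := inner_cluster B 1%g (K w).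
have XB w : (X w `<=` B)%fset by exact: inner_cluster_sub.
have Xdet C : determined [seq e <- incident B | inside B e && ~~ avoids C e] (fun w => X w == C).
  move=> w w' ww'; apply: (inner_cluster_determined gensP B1) => e /ww'.
  by rewrite /K /keep_edges => ->.
pose F y d C w : R := (y \in C)%:R * ((w (dart_edge y d))%:R *
   ind R (conn (keep_edges (Gr := cayley S) (avoids C) (K w)) (step y d) x)).
have F0 y d C w : 0 <= F y d C w by rewrite !mulr_ge0// ind_ge0.
have point w : ind R (connected_along T w 1%g x) <= (x \in B)%:R +
    \sum_(y <- B) \sum_(d <- darts | step y d \notin B) F y d (X w) w.
  have sum0 : 0 <= \sum_(y <- B) \sum_(d <- darts | step y d \notin B) F y d (X w) w.
    by apply: sumr_ge0 => y _; apply: sumr_ge0.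
  have [ox|no] := pselect (conn (K w) 1%g x); last first.
    by rewrite indF// addr_ge0.
  case: (last_exit B1 ox) => [/(fsubsetP (XB w)) ->|].
    by apply: (@le_trans _ _ 1); [exact: ind_le1|rewrite lerDl].
  move=> [y [d [yC dB wd zx]]].
  apply: (@le_trans _ _ (F y d (X w) w)).
    rewrite /F yC mul1r (indT R zx) mulr1.
    by move: wd => /andP[-> _]; exact: ind_le1.
  apply: ler_wpDl => //.
  rewrite (big_rem y) /=; last exact: (fsubsetP (XB w)).
  rewrite (big_rem d) /=; last exact: mem_darts.
  rewrite dB -addrA lerDl addr_ge0// sumr_ge0// => *; exact: sumr_ge0.
apply: (le_trans (expect_le _ q01 point)).
rewrite expectD expect_cst lerD2l expect_sum big_seq [leRHS]big_seq; apply: ler_sum => y yB.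
rewrite expect_sum; apply: ler_sum => d dB.
rewrite (expect_partition _ _ _ XB) /=.
set t := tau_along q T (step y d) x.
have t0 : 0 <= t by apply: expect_ge0 => // w; exact: ind_ge0.
have eT : dart_edge y d \in T by apply/BT/dart_edge_incident.
apply: (@le_trans _ _ (\sum_(C <- fpowerset B)
    expect q T (fun w => (X w == C)%:R * (y \in C)%:R) * (q * t))).
  apply: ler_sum => C _; case: (boolP (y \in C)) => yC; last first.
    have -> : (fun w => (X w == C)%:R * F y d C w) = fun=> 0.
      by apply/funext => w; rewrite /F (negbTE yC) mul0r mulr0.
    rewrite expect_cst mulr_ge0 ?mulr_ge0//; last by case/andP: q01.
    by apply: expect_ge0 => // w; rewrite mulr_ge0.
  have -> : (fun w => (X w == C)%:R * F y d C w) = fun w => (X w == C)%:R *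
    ((w (dart_edge y d))%:R *
     ind R (conn (keep_edges (Gr := cayley S) (avoids C) (K w)) (step y d) x)).
    by apply/funext => w; rewrite /F yC mul1r.
  have -> : (fun w => (X w == C)%:R * true%:R) = fun w => (X w == C)%:R :> R.
    by apply/funext => w; rewrite mulr1.
  have det2 : determined [seq e <- T | avoids C e]
     (fun w => ind R (conn (keep_edges (Gr := cayley S) (avoids C) (K w)) (step y d) x)).
    move=> w w' ww'; suff -> : keep_edges (Gr := cayley S) (avoids C) (K w) =
      keep_edges (Gr := cayley S) (avoids C) (K w') by [].
    apply/funext => e; rewrite /K /keep_edges; case: (boolP (avoids C e)) => eC; last by rewrite !andbF.
    case: (boolP (e \in T)) => eT'; last by rewrite !andbF.
    by rewrite (ww' e)// mem_filter eC.
  have det1 : determined [:: dart_edge y d] (fun w => (w (dart_edge y d))%:R : R).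
    by move=> w w' ->//; rewrite inE.
  rewrite (@expectM _ _ _ _ [seq e <- incident B | inside B e && ~~ avoids C e]
    (dart_edge y d :: [seq e <- T | avoids C e])); first last.
  - move=> e; rewrite mem_filter inE negb_or => /andP[/andP[eB eC] _].
    apply/andP; split; last by rewrite mem_filter (negbTE eC).
    by apply: contraTneq eB => ->; rewrite inside_dart (negbTE dB) andbF.
  - move=> w w' ww' /=; rewrite (ww' (dart_edge y d)) ?mem_head// (det2 w w')// => e eT'.
    by apply: ww'; rewrite inE eT' orbT.
  - by move=> w w' ww'; rewrite (Xdet C w w' ww').
  apply: ler_wpM2l; first by apply: expect_ge0.
  rewrite (@expectM _ _ _ _ _ _ _ _ det1 det2); last first.
    by move=> e; rewrite inE mem_filter => /eqP ->; rewrite avoids_dart yC.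
  rewrite expect_edge// ler_wpM2l//; first by case/andP: q01.
  by apply: expect_le => // w; apply: ind_le; exact: connected_restrict.
rewrite -mulr_suml -(expect_partition q T (fun C (w : config E) => (y \in C)%:R) XB).
rewrite mulrA [q * _]mulrC ler_wpM2r// ler_wpM2r//; first by case/andP: q01.
rewrite -(tau_within_expect q y BT); apply: expect_le => // w.
rewrite mem_inner_cluster// ; apply: ind_le.
by apply: connected_within_sub => // e _ /andP[].
Qed.

End sharpness.

(** * Consequences of [phi < 1] *)

Section subcritical.
Variables (R : realType) (G : groupType) (S : set G) (gens : seq (set_type S)).
Hypothesis gensP : forall s, s \in gens.
Hypothesis Sgen : generates S.
Local Notation E := (edge (cayley S)).
Local Notation conn := (connected_in (Gr := cayley S)).
Local Notation cball := (cball gens).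
Local Notation incident := (incident gens).
Local Notation darts := (darts gens).
Local Notation tau := (@tau R G S).
Local Notation tau_within := (@tau_within R G S gens).
Local Notation phi := (@phi R G S gens).
Implicit Types (x y z : G) (w : config E) (p : {i01 R}) (T : seq E) (B C : {fset G}).
Implicit Types (q : R) (d : set_type S * bool) (F : seq G).

Lemma simon_lieb p B x : 1%g \in B ->
  tau p 1%g x <= (x \in B)%:R +
  \sum_(y <- B) \sum_(d <- darts | step y d \notin B)
    p%:num * tau_within p%:num B y * tau p (step y d) x.
Proof.
move=> B1; have [m Bm] := ball_exhausts_fset gensP Sgen B.
apply: (tau_le gensP Sgen) => n; pose k := maxn n m.
apply: (@le_trans _ _ (tau_along p%:num (incident (cball k)) 1%g x)).
  by apply: tau_along_le; [exact: i01P|exact: incident_ball_le (leq_maxl n m)].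
apply: (le_trans (simon_lieb_along gensP _ (i01P p) B1 _)).
  move=> e; rewrite !mem_incident//; apply: contra => /andP[e1 e2].
  have sub z : z \in B -> z \in cball k.
    by move=> /Bm; exact: (ball_le gensP (leq_maxr n m)).
  by apply/andP; split; [apply: contra e1|apply: contra e2]; exact: sub.
rewrite lerD2l; apply: ler_sum => y _; apply: ler_sum => d _.
apply: ler_wpM2l; last exact: tau_along_tau.
by apply: mulr_ge0 => //; exact: tau_within_ge0 (i01P p).
Qed.

Lemma phi_ge0 p B : 0 <= phi p%:num B.
Proof.
apply: sumr_ge0 => y _; apply: sumr_ge0 => d _; apply: mulr_ge0 => //.
exact: tau_within_ge0 (i01P p).
Qed.

(** Summing the Simon-Lieb inequality over [F], and translating each inner sum by its exit point,
    bounds a partial sum by [size B] plus [phi] times a bound for all partial sums of the same size.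
    The trivial bound [size F] starts the iteration and its contribution decays geometrically. *)
Lemma phi_lt1_susceptibility p B : 1%g \in B -> phi p%:num B < 1 ->
  forall F, uniq F ->
  \sum_(x <- F) tau p 1%g x <= (size B)%:R / (1 - phi p%:num B).
Proof.
move=> B1 phi1; set f := phi p%:num B; set b := (size B)%:R.
have f0 : 0 <= f by exact: phi_ge0.
have f1 : 0 < 1 - f by rewrite subr_gt0.
(* [k] iterations of the Simon-Lieb inequality *)
have iter k : forall F, uniq F ->
    \sum_(x <- F) tau p 1%g x <= b / (1 - f) + f ^+ k * (size F)%:R.
  elim: k => [|k IH] F uF.
    rewrite expr0 mul1r; apply: (@le_trans _ _ (size F)%:R); last first.
      by rewrite lerDr divr_ge0// ?ler0n// ltW.
    rewrite -sum1_size natr_sum; apply: ler_sum => x _; exact: (tau_le1 gensP Sgen).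
  apply: (@le_trans _ _ (b + \sum_(y <- B) \sum_(d <- darts | step y d \notin B)
    p%:num * tau_within p%:num B y * (b / (1 - f) + f ^+ k * (size F)%:R))).
    apply: (le_trans (ler_sum _ (fun x _ => simon_lieb p x B1))).
    rewrite big_split /= lerD//.
      rewrite -natr_sum ler_nat -sum1_size.
      rewrite (eq_bigr (fun x => if x \in B then 1%N else 0%N)); last first.
        by move=> x _; case: (x \in B).
      rewrite -big_mkcond -big_filter !sum1_size; apply: uniq_leq_size.
        exact: filter_uniq.
      by move=> x; rewrite mem_filter => /andP[].
    rewrite exchange_big; apply: ler_sum => y _.
    rewrite exchange_big; apply: ler_sum => d _.
    rewrite -mulr_sumr ler_wpM2l//.
      by apply: mulr_ge0 => //; exact: tau_within_ge0 (i01P p).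
    pose F' := [seq ((step y d)^-1 * x)%g | x <- F].
    have uF' : uniq F' by rewrite map_inj_uniq// => u v; exact: mulgI.
    have := IH _ uF'; rewrite big_map size_map; apply: le_trans.
    by apply: ler_sum => x _; rewrite (tau1 gensP Sgen).
  rewrite (_ : \sum_(y <- B) _ = f * (b / (1 - f) + f ^+ k * (size F)%:R)); last first.
    rewrite /f /phi mulr_suml; apply: eq_bigr => y _; rewrite mulr_suml.
    by apply: eq_bigr.
  rewrite exprS le_eqVlt; apply/orP; left; apply/eqP.
  by field; rewrite gt_eqF.
move=> F uF; rewrite leNgt; apply/negP => lt_sum.
set s := \sum_(x <- F) _ in lt_sum.
have gap : 0 < s - b / (1 - f) by rewrite subr_gt0.
have : (fun k => f ^+ k * (size F)%:R) @ \oo --> (0 : R).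
  rewrite -[X in _ --> X](mul0r (size F)%:R); apply: cvgMr_tmp.
  by apply: cvg_expr; rewrite ger0_norm// -subr_gt0.
move=> /cvgrPdist_lt /(_ _ gap) [k _ /(_ k (leqnn k))].
rewrite sub0r normrN ger0_norm ?mulr_ge0 ?exprn_ge0// => lt_k.
by have := iter k F uF; rewrite -lerBlDl leNgt lt_k.
Qed.

(** Exit points of [B] lie in the ball of radius [L.+1], so one factor [phi] is gained for every
    [L.+1] units of distance. *)
Lemma phi_lt1_decay p B : 1%g \in B -> phi p%:num B < 1 ->
  exists L, forall k x, x \notin cball (k * L.+1) -> tau p 1%g x <= phi p%:num B ^+ k.
Proof.
move=> B1 phi1; have [L BL] := ball_exhausts_fset gensP Sgen B.
exists L; elim=> [|k IH] x xk; first by rewrite expr0 (tau_le1 gensP Sgen).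
apply: (le_trans (simon_lieb p x B1)).
have -> : (x \in B) = false.
  apply: contraNF xk => /BL; apply: (ball_le gensP).
  by rewrite mulSn; lia.
rewrite add0r exprS /phi big_distrl /=.
rewrite big_seq [leRHS]big_seq; apply: ler_sum => y yB.
rewrite big_distrl /=; apply: ler_sum => d _.
apply: ler_wpM2l.
  by apply: mulr_ge0 => //; exact: tau_within_ge0 (i01P p).
rewrite (tau1 gensP Sgen); apply: IH; apply: contra xk => H.
rewrite -[x](mulVKg (step y d)) mulSn; apply: (ballD gensP) => //.
exact: step_ball (BL _ yB).
Qed.

Lemma graph_dist_ball x n : x \in cball n -> (graph_dist (Gr := cayley S) 1%g x <= n)%N.
Proof.
move=> /(ballP gensP)[k kn W]; rewrite /graph_dist; case: pselect => // H.
case: ex_minnP => m _ mm; apply: leq_trans kn; apply: mm; exact/asboolP.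
Qed.

Lemma ball_graph_dist x : x \in cball (graph_dist (Gr := cayley S) 1%g x).
Proof.
have [n /(ballP gensP)[k kn W]] := ball_exhausts gensP Sgen x.
rewrite /graph_dist; case: pselect => [H|[]]; last by exists k; apply/asboolP.
case: ex_minnP => m /asboolP Wm _.
by apply/(ballP gensP); exists m.
Qed.

Lemma open_walk_translate g k x y :
  open_walk (Gr := cayley S) (fun=> true) k x y ->
  open_walk (Gr := cayley S) (fun=> true) k (g * x)%g (g * y)%g.
Proof.
elim: k x => [x -> //|k IH x [u /open_adjP[d _ ->] /IH W]].
by exists (step (g * x)%g d); [apply/open_adjP; exists d|rewrite stepM].
Qed.

Lemma graph_dist_translate x y :
  graph_dist (Gr := cayley S) x y = graph_dist (Gr := cayley S) 1%g (x^-1 * y)%g.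
Proof.
rewrite /graph_dist; suff -> : walk_length (Gr := cayley S) x y =
  walk_length (Gr := cayley S) 1%g (x^-1 * y)%g by [].
apply/funext => k; apply/asboolP/asboolP => /open_walk_translate H.
  by have := H x^-1%g; rewrite mulVg.
by have := H x; rewrite mulg1 mulVKg.
Qed.

Lemma exponential_decayP p :
  exponential_decay (cayley S) p <-> exists C gamma : R, [/\ 0 < C, 0 < gamma &
    forall x, tau p 1%g x <= C * expR (- gamma * (graph_dist (Gr := cayley S) 1%g x)%:R)].
Proof.
split=> -[C [gamma [C0 g0 H]]]; exists C, gamma; split=> // x.
  by have := H 1%g x; rewrite (tauE gensP Sgen) lee_fin.
move=> y; rewrite (tauE gensP Sgen) lee_fin (tau1 gensP Sgen) graph_dist_translate.
exact: H.
Qed.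

Lemma ball_decay_exponential p L (r : R) : r < 1 ->
  (forall k x, x \notin cball (k * L.+1) -> tau p 1%g x <= r ^+ k) ->
  exponential_decay (cayley S) p.
Proof.
(* The maximum makes the base positive, so that its logarithm gives a rate. *)
move=> r1 H; pose s := Num.max r (1 / 2).
have s0 : 0 < s by rewrite lt_max; apply/orP; right.
have s1 : s < 1 by rewrite gt_max r1/=; lra.
have ls : ln s < 0 by rewrite ln_lt0// s0.
apply/exponential_decayP; exists s^-1, (- ln s / L.+1%:R); split.
- by rewrite invr_gt0.
- by rewrite divr_gt0 ?oppr_gt0.
move=> x; set n := graph_dist _ _.
(* With [n.-1] the radius [k * L.+1] is strictly below [n] when [n > 0], so [x] lies outside that
   ball. *)
pose k := (n.-1 %/ L.+1)%N.
have rk : tau p 1%g x <= s ^+ k.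
  have [n0|n0] := posnP n; first by rewrite /k n0 div0n expr0 (tau_le1 gensP Sgen).
  have [r0|r0] := ltP r 0; last first.
    apply: (@le_trans _ _ (r ^+ k)); last first.
      by apply: lerXn2r; rewrite ?nnegrE// ?(ltW s0)// /s le_max lexx.
    apply: H; apply/negP => /graph_dist_ball; rewrite -/n.
    have := leq_trunc_div n.-1 L.+1; rewrite -/k; lia.
  have [k0|k0] := posnP k; first by rewrite k0 expr0 (tau_le1 gensP Sgen).
  apply: (@le_trans _ _ 0); last by rewrite exprn_ge0// ltW.
  apply: (le_trans (H 1%N x _)); last by rewrite expr1 ltW.
  apply/negP => /graph_dist_ball; rewrite -/n mul1n => nL.
  by move: k0; rewrite /k divn_small//; lia.
apply: (le_trans rk).
(* The constant [s^-1] pays for rounding the distance down to a multiple of [L.+1]. *)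
have -> : s ^+ k = s^-1 * s ^+ k.+1 by rewrite exprS mulKf// gt_eqF.
rewrite ler_pM2l ?invr_gt0//.
rewrite -[s in leLHS](@lnK _ s) ?posrE// -expRM_natl ler_expR -mulr_natl.
have nk : (n <= k.+1 * L.+1)%N.
  have := ltn_ceil n.-1 (ltn0Sn L); rewrite -/k; lia.
rewrite mulr1 !mulNr opprK [leRHS]mulrAC ler_pdivlMr ?ltr0n//.
by rewrite mulrAC [leRHS]mulrC ler_nM2r// -natrM ler_nat.
Qed.

End subcritical.

(** * Consequences of [phi >= 1] *)

Section supercritical.
Variables (R : realType) (G : groupType) (S : set G) (gens : seq (set_type S)).
Hypothesis gensP : forall s, s \in gens.
Hypothesis Sgen : generates S.
Local Notation E := (edge (cayley S)).
Local Notation ev := (set (g_sigma_algebraType (@measurable _ (config E)))).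
Local Notation conn := (connected_in (Gr := cayley S)).
Local Notation cball := (cball gens).
Local Notation incident := (incident gens).
Local Notation darts := (darts gens).
Local Notation tau := (@tau R G S).
Local Notation tau_within := (@tau_within R G S gens).
Local Notation phi := (@phi R G S gens).
Implicit Types (x y z : G) (w : config E) (p : {i01 R}) (T : seq E) (B C : {fset G}).
Implicit Types (q : R) (d : set_type S * bool) (F : seq G) (e : E).

Definition escape_prob q B : R :=
  expect q (incident B) (fun w => ind R (escapes B w 1%g)).

Lemma escape_prob_ge0 q B : 0 <= q <= 1 -> 0 <= escape_prob q B.
Proof. by move=> q01; apply: expect_ge0 => // w; exact: ind_ge0. Qed.

Lemma escape_prob_derive q B : is_derive q 1 (fun r => escape_prob r B)
  (\sum_(e <- incident B) expect q (incident B)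
    (influence (fun w => ind R (escapes B w 1%g)) e)).
Proof. by apply: russo_formula; exact: incident_uniq. Qed.

(* The pivotal edges counted here are the boundary edges of the random set of
   trapped points; given this set, its inner edges are still independent. *)
Lemma duminil_copin_tassion q B : 0 < q < 1 -> 1%g \in B ->
  (forall C, 1%g \in C -> 1 <= phi q C) ->
  1 - escape_prob q B <= q * (1 - q) * \sum_(e <- incident B)
    expect q (incident B) (influence (fun w => ind R (escapes B w 1%g)) e).
Proof.
move=> /andP[q0 q1] B1 phi1.
have q01 : 0 <= q <= 1 by rewrite !ltW.
set T := incident B; set f := fun w => ind R (escapes B w 1%g).
have finc : increasing f by move=> w w' ww'; apply: ind_le; exact: escapes_incr.
have infl0 e w : 0 <= influence f e w.
  by rewrite subr_ge0; apply: finc => x; exact: set_edge_ft.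
have fdet : determined T f.
  by move=> w w' ww'; rewrite /f (escapes_determined gensP 1%g ww').
(* The influence of [e] does not depend on the state of [e], so asking in addition that [e] be
   closed costs exactly [1 - q]. *)
have closedE e : e \in T ->
    expect q T (fun w => (1 - (w e)%:R) * influence f e w) =
    (1 - q) * expect q T (influence f e).
  move=> eT; rewrite (@expectM _ _ _ _ [:: e] [seq x <- T | x != e]).
  - by rewrite expectB expect_cst expect_edge.
  - by move=> w w' ww'; rewrite (ww' e) ?mem_head.
  - move=> w w' ww'; rewrite /influence; congr (_ - _); apply: fdet => x xT;
    by rewrite /set_edge; case: eqVneq => // xe; apply: ww'; rewrite mem_filter xe.
  - by move=> x; rewrite inE mem_filter => /eqP ->; rewrite eqxx.
pose X w := trapped B w.
have XB w : (X w `<=` B)%fset by exact: trapped_sub.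
pose D C := [seq yd <- allpairs pair C darts | step yd.1 yd.2 \notin C].
pose g C w := \sum_(y <- C) \sum_(d <- darts | step y d \notin C)
  ind R (connected_within C w 1%g y).
have point w : (1%g \in X w)%:R * g (X w) w <=
    \sum_(e <- T) (1 - (w e)%:R) * influence f e w.
  have h0 e : 0 <= (1 - (w e)%:R) * influence f e w.
    by apply: mulr_ge0 => //; rewrite subr_ge0; case: (w e).
  case: (boolP (1%g \in X w)) => X1; last by rewrite mul0r sumr_ge0.
  rewrite mul1r; set C := X w in X1 *.
  have -> : g C w = \sum_(yd <- D C) ind R (connected_within C w 1%g yd.1).
    rewrite /g /D big_filter [RHS]big_mkcond big_allpairs /=.
    by apply: eq_bigr => y _; rewrite -big_mkcond.
  apply: (@le_trans _ _ (\sum_(yd <- D C) (fun e => (1 - (w e)%:R) * influence f e w)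
      (dart_edge yd.1 yd.2))).
    rewrite big_seq [leRHS]big_seq; apply: ler_sum => -[y d].
    rewrite mem_filter /= => /andP[dC /allpairsP[[y' d'] [/= yC _ [yE dE]]]].
    rewrite -{}yE {y'} in yC.
    have [cy|ncy] := pselect (connected_within C w 1%g y); last by rewrite indF.
    have [we e1 e0] := trapped_pivotal yC dC cy X1.
    by rewrite we subr0 mul1r /influence /f (indT R e1) (indF R e0) subr0 ind_le1.
  rewrite -(big_map (fun yd => dart_edge yd.1 yd.2) xpredT
    (fun e => (1 - (w e)%:R) * influence f e w)).
  have memD yd : yd \in D C -> yd.1 \in C /\ step yd.1 yd.2 \notin C.
    case: yd => y d; rewrite mem_filter /= => /andP[dC /allpairsP[[y' d'] [/= yC _ [yE dE]]]].
    by split=> //; rewrite yE.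
  apply: ler_sum_subset => //.
  - rewrite map_inj_in_uniq.
      rewrite filter_uniq// allpairs_uniq ?undup_uniq// => -[y d] [y' d'] _ _ /=.
      by [].
    move=> [y d] [y' d'] /memD[/= yC dC] /memD[/= yC' dC'] /=.
    exact: (dart_edge_inj yC dC yC' dC').
  - exact: incident_uniq.
  - move=> _ /mapP[[y d] /memD[/= yC _] ->]; apply: dart_edge_incident => //.
    exact: (fsubsetP (XB w)).
have step1 : q * expect q T (fun w => (1%g \in X w)%:R * g (X w) w) <=
    q * (1 - q) * \sum_(e <- T) expect q T (influence f e).
  rewrite -mulrA ler_wpM2l ?(ltW q0)// mulr_sumr.
  apply: (le_trans (expect_le _ q01 point)); rewrite expect_sum.
  by rewrite big_seq [leRHS]big_seq; apply: ler_sum => e eT; rewrite closedE.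
apply: le_trans step1.
have -> : 1 - escape_prob q B = expect q T (fun w => (1%g \in X w)%:R).
  rewrite /escape_prob -/T -[X in X - _ = _](expect_cst q T) -expectB.
  congr (expect _ _ _); apply/funext => w; rewrite /X mem_trapped// /ind.
  by case: asbool; rewrite /= ?subr0 ?subrr.
rewrite (expect_partition q T (fun C (w : config E) => (1%g \in C)%:R * g C w) XB) mulr_sumr.
rewrite (expect_partition q T (fun C (w : config E) => (1%g \in C)%:R) XB).
rewrite big_seq [leRHS]big_seq; apply: ler_sum => C; rewrite fpowersetE => CB.
case: (boolP (1%g \in C)) => C1; last first.
  rewrite (_ : (fun w => _) = fun=> 0); last by apply/funext => w; rewrite mulr0.
  rewrite expect_cst mulr_ge0 ?(ltW q0)// expect_ge0// => w.
  by rewrite mul0r mulr0.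
have -> : (fun w => (X w == C)%:R * true%:R) = fun w => (X w == C)%:R :> R.
  by apply/funext => w; rewrite mulr1.
have -> : (fun w => (X w == C)%:R * (true%:R * g C w)) =
    fun w => (X w == C)%:R * g C w :> R.
  by apply/funext => w; rewrite mul1r.
rewrite (@expectM _ _ _ _ [seq e <- T | ~~ inside C e] [seq e <- incident C | inside C e]).
- rewrite mulrCA ler_peMr ?expect_ge0//.
  apply: le_trans (phi1 C C1) _; rewrite /g expect_sum mulr_sumr /phi.
  apply: ler_sum => y _; rewrite expect_sum mulr_sumr; apply: ler_sum => d _.
  rewrite (tau_within_expect gensP)// => e; rewrite !mem_incident//; apply: contra => /andP[e1 e2].
  by apply/andP; split; [apply: contra e1|apply: contra e2]; exact: (fsubsetP CB).
- move=> w w' ww'; congr (nat_of_bool _)%:R.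
  exact: (trapped_determined gensP (B := B) (C := C) ww').
- move=> w w' ww'; rewrite /g; apply: eq_bigr => y _; apply: eq_bigr => d _.
  by rewrite (connected_within_determined_inside gensP 1%g y ww').
- by move=> e; rewrite !mem_filter => /andP[/negbTE ->].
Qed.

(** Since [phi] is monotone in the parameter, the differential inequality holds on all of [(a, p)]
    and can be integrated. The bound is uniform in [B], hence survives the limit along balls. *)
Lemma phi_ge1_escape (a : R) p B : 0 < a -> a < p%:num -> p%:num < 1 ->
  (forall C, 1%g \in C -> 1 <= phi a C) -> 1%g \in B ->
  (p%:num - a) / (p%:num * (1 - a)) <= escape_prob p%:num B.
Proof.
move=> a0 ap p1 phi1 B1; have a1 := lt_trans ap p1.
rewrite ler_pdivrMr ?mulr_gt0 ?subr_gt0 ?(lt_trans a0 ap)// mulrC.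
apply: (@logistic_comparison _ (fun q => escape_prob q B) _ _ _ a0 ap p1
  (fun q => escape_prob_derive q B)).
  by apply: escape_prob_ge0; rewrite !ltW.
move=> q /andP[aq qp]; apply: duminil_copin_tassion => //.
  by rewrite (lt_trans a0 aq) (lt_trans qp p1).
move=> C C1; apply: le_trans (phi1 C C1) _; apply: phi_mono => //; rewrite ?ltW//.
exact: lt_trans qp p1.
Qed.

(** Balls are finite and exhaust the group, which makes an infinite cluster a countable intersection
    of cylinders. *)
Lemma infinite_clusterE x : [set w | infinite_set (cluster_of (Gr := cayley S) w x)] =
  \bigcap_n [set w | escapes (cball n) w x].
Proof.
apply/seteqP; split=> w /=.
  move=> infC n _; apply: contrapT => nesc; apply: infC.
  apply: (@sub_finite_set _ _ [set` cball n]); last exact: finite_fset.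
  move=> y xy /=; apply: contrapT => /negP yn; apply: nesc; by exists y.
move=> esc /finite_fsetP[C CE].
have [n Cn] := ball_exhausts_fset gensP Sgen C.
have [y yn xy] := esc n I.
have : [set` C] y by rewrite -CE.
by move=> /= /Cn; rewrite (negbTE yn).
Qed.

Lemma escapes_measurable B x : measurable ([set w | escapes B w x] : ev).
Proof.
by apply: cylinder_measurable; exists (incident B); exact: escapes_determined.
Qed.

Lemma escapes_ball_le n m w x : (n <= m)%N -> escapes (cball m) w x -> escapes (cball n) w x.
Proof.
by move=> nm [y yB xy]; exists y => //; apply: contra yB; exact: (ball_le gensP nm).
Qed.

Lemma infinite_cluster_measurable x :
  measurable ([set w | infinite_set (cluster_of (Gr := cayley S) w x)] : ev).
Proof.
rewrite infinite_clusterE; apply: bigcap_measurable => // n _.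
exact: escapes_measurable.
Qed.

Lemma percolation_probability_le p B :
  (percolation_probability (Gr := cayley S) 1%g p <= (escape_prob p%:num B)%:E)%E.
Proof.
rewrite /escape_prob -(percolationE p (escapes_determined gensP 1%g)).
apply: percolation_le; [exact: infinite_cluster_measurable|exact: escapes_measurable|].
move=> w /= infC; apply: contrapT => nesc; apply: infC.
apply: (@sub_finite_set _ _ [set` B]); last exact: finite_fset.
by move=> y xy /=; apply: contrapT => /negP yn; apply: nesc; exists y.
Qed.

(** Continuity from above. The joint event is the one to which Harris' inequality is applied when
    uniqueness is discussed; equal points give the bound on [theta]. *)
Lemma infinite_clusters_ge p x y (c : R) :
  (forall n, c%:E <= bond_percolation p [set w : config E | escapes (cball n) w x /\
    escapes (cball n) w y])%E ->
  (c%:E <= bond_percolation p [set w : config E |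
    infinite_set (cluster_of (Gr := cayley S) w x) /\
    infinite_set (cluster_of (Gr := cayley S) w y)])%E.
Proof.
move=> H; rewrite -[X in bond_percolation p X]/([set w : config E | _] `&` [set w : config E | _]).
rewrite !infinite_clusterE -bigcapI.
have mF n : measurable ([set w : config E | escapes (cball n) w x] `&` [set w : config E | escapes (cball n) w y] : ev).
  by apply: measurableI; exact: escapes_measurable.
have hF : {homo (fun n => [set w : config E | escapes (cball n) w x] `&`
   [set w : config E | escapes (cball n) w y]) : n m / (n <= m)%N >-> (m <= n)%O}.
  by move=> n m nm; apply/subsetPset => w /= [ex ey]; split; exact: escapes_ball_le nm _.
have /cvg_lim <- := @nonincreasing_cvg_mu _ _ _ (bond_percolation p)
  (fun n => [set w : config E | escapes (cball n) w x] `&` [set w : config E | escapes (cball n) w y] : ev)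
  (le_lt_trans (probability_le1 _ (mF 0%N)) (ltry 1)) mF
  (bigcap_measurable (ex_intro _ 0%N I) (fun n _ => mF n)) hF => //.
apply: lime_ge; last by apply: nearW => n; exact: H.
apply: ereal_nonincreasing_is_cvgn => n m nm; apply: percolation_le => //.
by move=> w /= [ex ey]; split; exact: escapes_ball_le nm _.
Qed.

Lemma percolation_probability_ge p (c : R) :
  (forall n, c <= escape_prob p%:num (cball n)) ->
  (c%:E <= percolation_probability (Gr := cayley S) 1%g p)%E.
Proof.
move=> H; rewrite /percolation_probability.
have -> : [set w : config E | infinite_set (cluster_of (Gr := cayley S) w 1%g)] =
  [set w : config E | infinite_set (cluster_of (Gr := cayley S) w 1%g) /\
    infinite_set (cluster_of (Gr := cayley S) w 1%g)].
  by apply/seteqP; split=> w //= [].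
apply: infinite_clusters_ge => n.
have -> : [set w : config E | escapes (cball n) w 1%g /\ escapes (cball n) w 1%g] =
  [set w : config E | escapes (cball n) w 1%g] by apply/seteqP; split=> w //= [].
by rewrite (percolationE p (escapes_determined gensP 1%g)) lee_fin; exact: H.
Qed.

End supercritical.

Lemma i01_between (R : realType) (a b : R) : 0 <= a -> b <= 1 -> a < b ->
  exists p : {i01 R}, a < p%:num < b.
Proof.
move=> a0 b1 ab; have c0 : 0 <= (a + b) / 2 by lra.
have c1 : (a + b) / 2 <= 1 by lra.
by exists (Itv01 c0 c1) => /=; apply/andP; split; lra.
Qed.

(** * The critical point *)

Section critical.
Variables (R : realType) (G : groupType) (S : set G) (gens : seq (set_type S)).
Hypothesis gensP : forall s, s \in gens.
Hypothesis Sgen : generates S.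
Local Notation E := (edge (cayley S)).
Local Notation ev := (set (g_sigma_algebraType (@measurable _ (config E)))).
Local Notation conn := (connected_in (Gr := cayley S)).
Local Notation cball := (cball gens).
Local Notation incident := (incident gens).
Local Notation darts := (darts gens).
Local Notation tau := (@tau R G S).
Local Notation tau_within := (@tau_within R G S gens).
Local Notation phi := (@phi R G S gens).
Local Notation theta := (percolation_probability (Gr := cayley S) 1%g).
Local Notation pc := (p_c R (1%g : vertex (cayley S))).
Implicit Types (x y z : G) (w : config E) (p : {i01 R}) (T : seq E) (B C : {fset G}).
Implicit Types (q : R) (d : set_type S * bool) (F : seq G) (e : E).

Lemma tau_within_along q B T y : 0 <= q <= 1 -> {subset incident B <= T} ->
  tau_within q B y <= tau_along q T 1%g y.
Proof.
move=> q01 BT; rewrite -(tau_within_expect gensP q y BT).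
apply: expect_le => // w; apply: ind_le; apply: connected_sub => e /andP[we eB].
by rewrite /keep_edges we /=; apply: BT; exact: inside_incident.
Qed.

Lemma big_ball_succ (f : G -> R) n :
  \sum_(x <- cball n.+1) f x = \sum_(x <- cball n) f x +
    \sum_(x <- cball n.+1 | x \notin cball n) f x.
Proof.
rewrite (bigID (fun x => x \in cball n)) /=; congr (_ + _).
rewrite -big_filter; apply: perm_big; apply: uniq_perm; rewrite ?filter_uniq ?fset_uniq//.
move=> x; rewrite mem_filter; case: (boolP (x \in cball n)) => // xn.
exact: (ball_le gensP (leqnSn n) xn).
Qed.

(** Union bound over the first vertex of the path outside the ball. *)
Lemma escape_prob_sphere p n : escape_prob gens p%:num (cball n) <=
  \sum_(x <- cball n.+1 | x \notin cball n) tau p 1%g x.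
Proof.
pose B := cball n.+1.
have sub : {subset incident (cball n) <= incident B} by exact: incident_ball_le.
have -> : escape_prob gens p%:num (cball n) =
    expect p%:num (incident B) (fun w => ind R (escapes (cball n) w 1%g)).
  apply/esym; apply: (@expect_indep _ _ _ _ (incident (cball n))) => //.
  by move=> w w' ww'; rewrite (escapes_determined gensP 1%g ww').
apply: (@le_trans _ _ (\sum_(x <- B | x \notin cball n) expect p%:num (incident B)
    (fun w => ind R (connected_within B w 1%g x)))); last first.
  apply: ler_sum => x _; rewrite (tau_within_expect gensP)//.
  apply: le_trans (tau_along_tau gensP Sgen p (incident B) 1%g x).
  exact: tau_within_along (i01P p) _.
rewrite -expect_sum; apply: expect_le => [|w]; first exact: i01P.
have sum0 (s : seq G) : 0 <= \sum_(x <- s | x \notin cball n) ind R (connected_within B w 1%g x).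
  by apply: sumr_ge0 => *; exact: ind_ge0.
have [[y yn oy]|ne] := pselect (escapes (cball n) w 1%g); last by rewrite (indF R ne).
suff [[x [xB xn ox]]|[yB _]] : (exists x, [/\ x \in B, x \notin cball n &
    connected_within B w 1%g x]) \/ (y \in cball n /\ connected_within B w 1%g y).
- apply: (le_trans (ind_le1 _ _)); rewrite (big_rem x)//= xn.
  by rewrite (indT R ox) lerDl.
- by rewrite yB in yn.
move: y oy {yn}; apply: cayley_ind; first by right; split; [exact: ball1|exact: connected_refl].
move=> u d [|[un ou] wd]; [by left|].
have vB : step u d \in B by exact: step_ball.
have ov : connected_within B w 1%g (step u d).
  apply: connected_dart ou _; rewrite /keep_edges wd inside_dart vB andbT.
  exact: (ball_le gensP (leqnSn n) un).
by case: (boolP (step u d \in cball n)) => vn; [right|left; exists (step u d)].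
Qed.

(** If [theta p > 0], every sphere contributes at least [theta p] to the susceptibility, against
    [phi_lt1_susceptibility]. *)
Lemma phi_lt1_theta p B : 1%g \in B -> phi p%:num B < 1 -> ~ (0 < theta p)%E.
Proof.
move=> B1 phi1 th0; have := percolation_probability_le gensP Sgen p.
case: (theta p) th0 => [c| |//]; last first.
  by move=> _ /(_ (cball 0)); rewrite leye_eq.
rewrite lte_fin => c0 le_esc.
have lin n : n%:R * c <= \sum_(x <- cball n) tau p 1%g x.
  elim: n => [|n IH]; first by rewrite mul0r sumr_ge0// => x _; exact: tau_ge0 gensP Sgen _ _ _.
  rewrite big_ball_succ -natr1 mulrDl mul1r lerD//.
  by apply: le_trans (escape_prob_sphere p n); rewrite -lee_fin.
set K := (size B)%:R / (1 - phi p%:num B).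
have [k _ /(_ k (leqnn k))] := nbhs_infty_gtr (K / c).
rewrite ltr_pdivrMr// => /(le_lt_trans (le_trans (lin k)
  (phi_lt1_susceptibility gensP Sgen B1 phi1 (fset_uniq _)))).
by rewrite ltxx.
Qed.

Lemma p_c_ge0 : 0 <= pc.
Proof.
rewrite /p_c; set A := [set _ | _ in _].
have [->|/set0P A0] := eqVneq A set0; first by rewrite inf0.
by apply: lb_le_inf => // _ [p _ <-].
Qed.

Lemma p_c_le p : (0 < theta p)%E -> pc <= p%:num.
Proof. by move=> th; apply: ge_inf; [exists 0 => _ [r _ <-]|exists p]. Qed.

Lemma phi_ge1_p_c p : 0 < p%:num -> (forall C, 1%g \in C -> 1 <= phi p%:num C) ->
  pc <= p%:num.
Proof.
move=> p0 phi1; rewrite leNgt; apply/negP => lt_pc.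
have [r /andP[pr rc]] := i01_between (ltW p0) (p_c_le1 R _) lt_pc.
have r1 : r%:num < 1 by exact: lt_le_trans rc (p_c_le1 R _).
have r0 := lt_trans p0 pr.
suff /p_c_le : (0 < theta r)%E by rewrite leNgt rc.
pose c := (r%:num - p%:num) / (r%:num * (1 - p%:num)).
have c0 : 0 < c by rewrite divr_gt0 ?mulr_gt0 ?subr_gt0 ?(lt_trans pr r1).
apply: (@lt_le_trans _ _ c%:E); first by rewrite lte_fin.
apply: (percolation_probability_ge gensP Sgen) => n.
by apply: phi_ge1_escape => //; exact: ball1.
Qed.

Lemma p_exp_ub p : exponential_decay (cayley S) p -> p%:num <= p_exp R (cayley S).
Proof. by move=> H; apply: ub_le_sup; [exists 1 => _ [r _ <-]|exists p]. Qed.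

Lemma p_exp_ge0 : 0 <= p_exp R (cayley S).
Proof.
rewrite /p_exp; set A := [set _ | _ in _].
have [->|/set0P[_ [p pA _]]] := eqVneq A set0; first by rewrite sup0.
by apply: le_trans (p_exp_ub pA).
Qed.

Lemma p_c_le_p_exp : pc <= p_exp R (cayley S).
Proof.
rewrite leNgt; apply/negP => lt_c.
have [p /andP[ep pp]] := i01_between p_exp_ge0 (p_c_le1 R _) lt_c.
have p0 : 0 < p%:num by exact: le_lt_trans p_exp_ge0 ep.
suff : pc <= p%:num by rewrite leNgt pp.
apply: phi_ge1_p_c => // C C1; rewrite leNgt; apply/negP => phi1.
have [L H] := phi_lt1_decay gensP Sgen C1 phi1.
by have := p_exp_ub (ball_decay_exponential gensP Sgen phi1 H); rewrite leNgt ep.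
Qed.

Section infinite.
Hypothesis Ginf : ~ finite_set [set: G].

Lemma ball_proper B : exists x, x \notin B.
Proof.
apply: contrapT => nx; apply: Ginf.
apply: (@sub_finite_set _ _ [set` B]); last exact: finite_fset.
by move=> x _ /=; apply: contrapT => /negP xB; apply: nx; exists x.
Qed.

Lemma connected_full x : conn (fun=> true) 1%g x.
Proof.
have [n /(ballP gensP)[k _ W]] := ball_exhausts gensP Sgen x.
by exists k.
Qed.

(** It makes the set whose infimum is [p_c] non-empty, so that this infimum can be approached. *)
Lemma theta1 p : p%:num = 1 -> (0 < theta p)%E.
Proof.
move=> p1; apply: (@lt_le_trans _ _ 1%E); first exact: lte01.
apply: (percolation_probability_ge gensP Sgen) => n.
apply: (@le_trans _ _ (p%:num ^+ size (incident (cball n)))); first by rewrite p1 expr1n.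
apply: expect_open => [|w|w wn]; [exact: i01P|exact: ind_ge0|].
rewrite indT//; have [x xn] := ball_proper (cball n).
apply: (@escapes_sub _ _ gens gensP (cball n) (fun=> true)) => [e en _|]; first exact: wn.
by exists x => //; exact: connected_full.
Qed.

(** For fixed [B] the condition [phi < 1] is open in the parameter. If it held at [p_c] it would
    hold at some [p] arbitrarily close to [p_c] with [theta p > 0], against [phi_lt1_theta]. *)
Lemma phi_p_c_ge1 B : 1%g \in B -> 1 <= phi pc B.
Proof.
move=> B1; rewrite leNgt; apply/negP => phi1.
have gap : 0 < 1 - phi pc B by rewrite subr_gt0.
have /cvgrPdist_lt/(_ _ gap) := @phi_continuous R G S gens B pc.
move=> [del /= del0 Hdel].
have hasinf : has_inf [set p%:num | p in [set p : {i01 R} | (0 < theta p)%E]].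
  split; last by exists 0 => _ [r _ <-].
  have H1 : (1 : R) <= 1 by [].
  pose one : {i01 R} := Itv01 ler01 H1.
  by exists one%:num; exists one => //=; exact: theta1.
have [_ [p /= thp <-] pl] := inf_adherent del0 hasinf.
have pcp := p_c_le thp.
apply: (@phi_lt1_theta p B B1 _ thp).
have := Hdel p%:num; rewrite /ball_ /= distrC ger0_norm ?subr_ge0// ltrBlDl => /(_ pl).
by rewrite ltr_distlC => /andP[_]; rewrite addrC subrK.
Qed.

(** [phi] vanishes at parameter 0 but is at least 1 at [p_c]. *)
Lemma p_c_gt0 : 0 < pc.
Proof.
rewrite lt_neqAle p_c_ge0 andbT; apply/eqP => pc0.
have := @phi_p_c_ge1 (cball 0) (ball1 gensP 0).
rewrite -pc0 /phi big1 ?ler10// => y _; rewrite big1// => d _; by rewrite mul0r.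
Qed.

(** In [phi] of a ball only the outer sphere counts, and each of its points has at most [size darts]
    exits; so every sphere carries at least [1 / size darts] of the susceptibility. The sum is kept
    in finite volume because it will be moved below [p_c] by continuity. *)
Lemma critical_susceptibility N :
  N%:R <= (size darts)%:R *
    \sum_(x <- cball N) tau_along pc (incident (cball N)) 1%g x.
Proof.
have pc01 : 0 <= pc <= 1 by rewrite p_c_ge0 p_c_le1.
suff H n : (n <= N)%N -> n%:R <= (size darts)%:R *
    \sum_(x <- cball n) tau_along pc (incident (cball N)) 1%g x by exact: H.
elim: n => [|n IH] nN.
  rewrite mulr_ge0// sumr_ge0// => x _; apply: expect_ge0 => // w; exact: ind_ge0.
rewrite big_ball_succ mulrDr -natr1 lerD//; first by apply: IH; exact: ltnW.
apply: (le_trans (phi_p_c_ge1 (ball1 gensP n.+1))).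
rewrite /phi mulr_sumr (bigID (fun x => x \in cball n)) /= big1_seq; last first.
  move=> y /andP[yn _]; rewrite big1// => d.
  by rewrite (step_ball gensP).
rewrite add0r; apply: ler_sum => y yn.
apply: (@le_trans _ _ (\sum_(d <- darts) tau_within pc (cball n.+1) y)).
  rewrite big_mkcond; apply: ler_sum => d _.
  have t0 := tau_within_ge0 gens (cball n.+1) y pc01.
  case: ifP => // _; rewrite -[leRHS]mul1r ler_wpM2r//; exact: p_c_le1.
rewrite big_const_seq count_predT iter_addr_0 mulr_natl ler_wMn2r//.
by apply: tau_within_along => //; exact: incident_ball_le.
Qed.

End infinite.
End critical.

(** * Free products *)

Section free_product_words.
Variables (I : choiceType) (G : I -> groupType).
Local Open Scope group_scope.
Local Notation FP := (free_product G).
Local Notation letter := {i : I & G i}.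
Implicit Types (u v : seq letter) (a : letter) (x y : FP).

Lemma fp_ind (Q : FP -> Prop) : Q 1 ->
  (forall i (g : G i) x, g != 1 -> headfree i (word_of x) -> Q x -> Q (fp_in g * x)) ->
  forall x, Q x.
Proof.
move=> Q1 Qs [u ru]; elim: u ru => [|[i g] u IH] rau.
  by rewrite (_ : FreeProduct rau = 1)//; apply/val_inj.
have := rau; rewrite reduced_cons => /and3P[/= g1 hu ru].
rewrite (_ : FreeProduct rau = fp_in g * FreeProduct ru); first exact: Qs.
apply/val_inj; rewrite /= word_mul_push//.
exact/esym/(lact_cons rau).
Qed.

Lemma word_of_in i (g : G i) : word_of (fp_in g) = push g [::].
Proof. by []. Qed.

Lemma fp_in1 i : fp_in (1 : G i) = 1.
Proof. by apply/val_inj; rewrite /= /push eqxx. Qed.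

Lemma word_of_inM i (g : G i) x : g != 1 -> headfree i (word_of x) ->
  word_of (fp_in g * x) = Tagged G g :: word_of x.
Proof.
move=> g1 hx; rewrite -[LHS]/(word_mul (push g [::]) (word_of x)).
rewrite word_mul_push; last exact: valP.
have r : reduced (Tagged G g :: word_of x) by rewrite reduced_cons /= g1 hx; exact: valP.
exact: (lact_cons r).
Qed.

(** Right multiplication by one letter acts at the far end of the word; the first letter is affected
    only when it is the whole word. *)
Lemma word_mul_in a u j (t : G j) : reduced (a :: u) ->
  (u = [::] /\ tag a = j) \/
  word_mul (a :: u) (push t [::]) = a :: word_mul u (push t [::]).
Proof.
have rt : reduced (push t [::]) by exact: push_reduced.
elim: u a => [|b u IH] a rau; have := rau; rewrite reduced_cons => /and3P[a1 hu ru].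
  have [->|aj] := eqVneq (tag a) j; [by left|right].
  rewrite -[LHS]/(lact (tagged a) (push t [::])); apply: lact_cons.
  rewrite reduced_cons a1 rt andbT /=.
  by rewrite /push; case: ifP => //= _; rewrite eq_sym.
right; rewrite -[LHS]/(lact (tagged a) (word_mul (b :: u) (push t [::]))).
apply: lact_cons; rewrite reduced_cons a1 word_mul_reduced// andbT.
have [[-> bj]|->] := IH b ru; last exact: hu.
case: b bj hu {IH rau ru} => k g /= kj; subst k => hu.
have -> : lact g (push t [::]) = push (g * t) [::] by rewrite /lact peel_push.
by rewrite /push; case: ifP.
Qed.

(** The retraction of the free product onto the copy of [G i] at the identity, sending whatever
    hangs at a point of this copy to that point. It is a map of graphs up to collapsing edges, not
    in general a group morphism. *)
Definition fp_head i x : G i := (peel i (word_of x)).1.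

Lemma fp_head1 i : fp_head i 1 = 1. Proof. by []. Qed.

Lemma fp_head_in i (g : G i) : fp_head i (fp_in g) = g.
Proof. by rewrite /fp_head word_of_in peel_push. Qed.

Lemma fp_head_inM i (g : G i) x : g != 1 -> headfree i (word_of x) ->
  fp_head i (fp_in g * x) = g.
Proof. by move=> g1 hx; rewrite /fp_head word_of_inM//= eqxx untagE. Qed.

(* A generator changes the head only inside the copy of [G i] at the identity. *)
Lemma fp_headM i j x (t : G j) :
  fp_head i (x * fp_in t) = fp_head i x \/
  exists e : j = i, x = fp_in (fp_head i x) /\
    fp_head i (x * fp_in t) = fp_head i x * ecast k (G k) e t.
Proof.
case: x => u ru; rewrite /fp_head -[word_of (_ * _)]/(word_mul u (push t [::])).
case: u ru => [|a u] rau.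
  have [ji|ji] := eqVneq j i.
    right; exists ji; subst i => /=; rewrite mul1g; split.
      by apply/val_inj; rewrite /= /push eqxx.
    by rewrite peel_push.
  left; rewrite /= /push; case: ifP => //= _; by rewrite (negbTE ji).
have [[u0 aj]|E] := word_mul_in t rau; last by left; rewrite E /=; case: (tag a == i).
subst u; case: a aj rau => k g /= kj; subst k => rau.
have -> : lact g (push t [::]) = push (g * t) [::] by rewrite /lact peel_push.
have [ji|ji] := eqVneq j i; last first.
  by left; rewrite /push; case: ifP => //= _; rewrite (negbTE ji).
right; exists ji; subst i; rewrite /= peel_push//= untagE; split=> //.
apply/val_inj => /=; rewrite /push; have := rau; rewrite reduced_cons /=.
by case: eqVneq.
Qed.

End free_product_words.

Lemma finite_gens (T : choiceType) (S : set T) : finite_set S ->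
  exists gens : seq (set_type S), forall s, s \in gens.
Proof.
move=> /finite_fsetP[B SB].
exists (pmap insub (enum_fset B)) => s; rewrite mem_pmap_sub /=.
have SsubB x : S x -> x \in B by rewrite SB.
by apply: SsubB; apply: set_mem; exact: valP.
Qed.

(** * Comparison of the free product with its factors *)

Section free_product_cayley.
Variables (R : realType) (I : choiceType) (G : I -> groupType).
Variable S : forall i, set (G i).
Arguments S : clear implicits.
Variable gens : forall i, seq (set_type (S i)).
Hypothesis gensP : forall i s, s \in gens i.
Hypothesis Sgen : forall i, generates (S i).
Local Notation FP := (free_product G).
Local Notation SF := (free_product_gens S).
Variable gensF : seq (set_type SF).
Hypothesis gensFP : forall s, s \in gensF.
Local Notation connF := (connected_in (Gr := cayley SF)).
Local Notation conn i := (connected_in (Gr := cayley (S i))).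
Local Notation EF := (edge (cayley SF)).
Local Notation tauF := (@tau R FP SF).
Local Notation tau i := (@tau R (G i) (S i)).
Local Notation ev T := (set (g_sigma_algebraType (@measurable _ (config T)))).
Implicit Types (p : {i01 R}) (x y : FP) (T : seq EF).
Implicit Types (w : config EF).

Lemma free_product_gens_generates : generates SF.
Proof.
move=> H [H1 HM HV] SH; apply/seteqP; split=> // x _.
have HG i (g : G i) : H (fp_in g).
  suff HT : [set g : G i | H (fp_in g)] = setT :> set (G i).
    by have : [set g : G i | H (fp_in g)] g by rewrite HT.
  apply: Sgen; first split => /=.
  - by rewrite fp_in1.
  - by move=> a b Ha Hb; rewrite fp_inM; exact: HM.
  - move=> a Ha; have -> : fp_in (a^-1)%g = (fp_in a)^-1%g.
      by apply: (@mulgI _ (fp_in a)); rewrite -fp_inM !mulgV fp_in1.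
    exact: HV.
  - by move=> s Ss /=; apply: SH; exists i => //; exists s.
elim/fp_ind: x => [|i g x _ _ Hx]; first exact: H1.
by apply: HM => //; exact: HG.
Qed.

Lemma mem_free_product_gens i (s : set_type (S i)) :
  fp_in (set_val s) \in (SF : set FP).
Proof.
apply: mem_set; exists i => //; exists (set_val s) => //.
by apply: set_mem; exact: valP.
Qed.

Definition gen_in i (s : set_type (S i)) : set_type SF := SigSub (mem_free_product_gens s).

Definition edge_in i (e : edge (cayley (S i))) : EF := (fp_in e.1, gen_in e.2).

Lemma edge_in_inj i : injective (@edge_in i).
Proof.
move=> [u s] [v t] uvst; have /fp_in_inj uv : fp_in u = fp_in v := congr1 fst uvst.
have /(congr1 val) /fp_in_inj st : gen_in s = gen_in t := congr1 snd uvst.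
by rewrite uv (val_inj st).
Qed.

Lemma gens_cases (s : set_type SF) : exists i (t : set_type (S i)), s = gen_in t.
Proof.
have [i _ [t St tE]] : SF (val s) by apply: set_mem; exact: valP.
exists i, (SigSub (mem_set St)); apply: val_inj => /=; exact: esym tE.
Qed.

Lemma dart_in i (g : G i) d :
  dart_edge (fp_in g) (gen_in d.1, d.2) = edge_in (dart_edge g d).
Proof.
rewrite /dart_edge /edge_in /=; case: d => s [] //=; congr (_, _).
by rewrite fp_inM; congr (_ * _)%g; apply: (@mulgI _ (fp_in (set_val s)));
  rewrite -fp_inM !mulgV fp_in1.
Qed.

Lemma step_in i (g : G i) d : step (fp_in g) (gen_in d.1, d.2) = fp_in (step g d).
Proof.
rewrite /step; case: d => s [] /=; rewrite fp_inM //; congr (_ * _)%g.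
by apply: (@mulgI _ (fp_in (set_val s))); rewrite -fp_inM !mulgV fp_in1.
Qed.

Lemma fp_head_step i x d : fp_head i (step x d) = fp_head i x \/
  exists d', [/\ d = (gen_in d'.1, d'.2), x = fp_in (fp_head i x) &
    fp_head i (step x d) = step (fp_head i x) d'].
Proof.
case: d => s b; have [j [t ->]] := gens_cases s.
pose t' : G j := if b then set_val t else (set_val t)^-1%g.
have stepE : step x (gen_in t, b) = (x * fp_in t')%g.
  rewrite /step /t' /= {t'}; case: b => //; congr (_ * _)%g.
  by apply: (@mulgI _ (fp_in (set_val t))); rewrite -fp_inM !mulgV fp_in1.
rewrite stepE; have [->|[e [xE hE]]] := fp_headM i x t'; [by left|right].
subst j; exists (t, b); split=> //; by rewrite hE /step /t' /= {t' stepE xE hE}; case: b.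
Qed.

Lemma connected_in_factor i w (g h : G i) :
  conn i (w \o @edge_in i) g h -> connF w (fp_in g) (fp_in h).
Proof.
apply: (connected_map (Gr := cayley (S i)) (Gr' := cayley SF) (r := @fp_in _ _ i)).
move=> u v /open_adjP[d wd ->]; right; apply/open_adjP; exists (gen_in d.1, d.2).
  by rewrite dart_in.
by rewrite step_in.
Qed.

Lemma connected_fp_head i w x y :
  connF w x y -> conn i (keep_edges (Gr := cayley SF)
     (fun e => fp_head i e.1 != fp_head i (ends e).2) w \o @edge_in i)
    (fp_head i x) (fp_head i y).
Proof.
apply: (connected_map (Gr := cayley SF) (Gr' := cayley (S i)) (r := fp_head i)).
move=> u v /open_adjP[d wd ->].
have [->|ne] := eqVneq (fp_head i u) (fp_head i (step u d)); [by left|right].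
have [E|[d' [dE uE vE]]] := fp_head_step i u d; first by rewrite E eqxx in ne.
apply/open_adjP; exists d' => //.
rewrite /= -dart_in -uE -dE /keep_edges wd /=.
by have /= := dart_edge_ends u d; case: d.2 => -[-> ->] //; rewrite eq_sym.
Qed.

(** The words of head [g] form the part of the graph hanging at [g]; all the rest is collapsed to
    its root. *)
Definition subtree_proj i (g : G i) x := if fp_head i x == g then x else fp_in g.

(** An edge that changes the head lies in the copy of [G i], so both its ends go to the root. The
    edges kept here are thus complementary to those of [connected_fp_head]. *)
Lemma connected_subtree i (g : G i) w x y : connF w x y ->
  connF (keep_edges (Gr := cayley SF)
     (fun e => fp_head i e.1 == fp_head i (ends e).2) w)
    (subtree_proj g x) (subtree_proj g y).
Proof.
apply: (connected_map (Gr := cayley SF) (Gr' := cayley SF) (r := subtree_proj g)).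
move=> u v /open_adjP[d wd ->].
have [E|ne] := eqVneq (fp_head i u) (fp_head i (step u d)).
  rewrite /subtree_proj -E; case: ifP => _; [right|by left].
  apply/open_adjP; exists d => //; rewrite /keep_edges wd /=.
  by have /= := dart_edge_ends u d; case: d.2 => -[-> ->] //=; rewrite E eqxx.
have [E|[d' [dE uE vE]]] := fp_head_step i u d; first by rewrite E eqxx in ne.
have sE : step u d = fp_in (fp_head i (step u d)).
  by rewrite vE {1}uE dE step_in.
have eqg z : z = fp_in (fp_head i z) -> subtree_proj g z = fp_in g.
  by rewrite /subtree_proj; case: eqP => // <-.
by left; rewrite !eqg.
Qed.

(** The edges of the copy of [G i] at the identity carry Bernoulli percolation on the Cayley graph
    of [G i]. *)
Lemma tau_fp_in p i (g : G i) : tau i p 1%g g <= tauF p 1%g (fp_in g).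
Proof.
have FG := free_product_gens_generates.
rewrite -lee_fin -(tauE (@gensP i) (@Sgen i)) -(tauE gensFP FG).
have mA := connected_measurable (@gensP i) (@Sgen i) 1%g g.
rewrite -(percolation_reindex p (@edge_in_inj i) mA).
apply: percolation_le; last first.
- by move=> w /= /connected_in_factor; rewrite fp_in1.
- exact: connected_measurable gensFP FG _ _.
- rewrite -[X in measurable X]setTI.
  exact: (measurable_reindex (@edge_in i) measurableT mA).
Qed.

(* A path from [1] to [g x] projects both to a path from [1] to [g] in [G i] and to
   a path from [g] to [g x] in the subtree at [g], along disjoint sets of edges. *)
Lemma tau_fp_cons p i (g : G i) x : g != 1%g -> headfree i (word_of x) ->
  tauF p 1%g (fp_in g * x)%g <= tau i p 1%g g * tauF p 1%g x.
Proof.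
move=> g1 hx; have FG := free_product_gens_generates.
apply: (tau_le gensFP FG) => n; set T := incident _ _.
pose B (e : EF) := fp_head i e.1 != fp_head i (ends e).2.
pose K w : config EF := keep_edges (Gr := cayley SF) (fun e => e \in T) w.
pose KB w : config EF := keep_edges (Gr := cayley SF) B (K w).
pose KC w : config EF := keep_edges (Gr := cayley SF)
  (fun e => fp_head i e.1 == fp_head i (ends e).2) (K w).
pose A1 w : Prop := conn i (KB w \o @edge_in i) 1%g g.
pose A2 w : Prop := connF (KC w) (fp_in g) (fp_in g * x)%g.
have det1 : determined [seq e <- T | B e] (fun w => A1 w).
  move=> w w' ww'; rewrite /A1; suff -> : KB w = KB w' by [].
  apply/funext => e; rewrite /KB /K /keep_edges; case: (boolP (B e)) => eB; last by rewrite !andbF.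
  case: (boolP (e \in T)) => eT; last by rewrite !andbF.
  by rewrite (ww' e)// mem_filter eB.
have det2 : determined [seq e <- T | ~~ B e] (fun w => A2 w).
  move=> w w' ww'; rewrite /A2; suff -> : KC w = KC w' by [].
  apply/funext => e; rewrite /KC /K /keep_edges; case: (boolP (B e)) => eB.
    by rewrite (negbTE eB) !andbF.
  case: (boolP (e \in T)) => eT; last by rewrite !andbF.
  by rewrite (ww' e)// mem_filter eB.
apply: (@le_trans _ _ (expect p%:num T (fun w => ind R (A1 w) * ind R (A2 w)))).
  apply: expect_le => [|w]; first exact: i01P.
  rewrite -ind_and; apply: ind_le => H; split.
    have := connected_fp_head i H; by rewrite fp_head_inM.
  have := connected_subtree g H; rewrite /subtree_proj fp_head1 fp_head_inM// eqxx.
  by rewrite eq_sym (negbTE g1).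
rewrite (@expectM _ _ _ _ [seq e <- T | B e] [seq e <- T | ~~ B e]); first last.
- by move=> e; rewrite !mem_filter => /andP[-> _].
- by move=> w w' ww'; rewrite (det2 w w' ww').
- by move=> w w' ww'; rewrite (det1 w w' ww').
apply: ler_pM; try (apply: expect_ge0 => [|w]; [exact: i01P|exact: ind_ge0]).
  have mA := connected_measurable (@gensP i) (@Sgen i) 1%g g.
  have dT : determined T (fun w => A1 w).
    by apply: determinedW det1 => e; rewrite mem_filter => /andP[].
  rewrite -lee_fin -(percolationE p dT) -(tauE (@gensP i) (@Sgen i)).
  rewrite -(percolation_reindex p (@edge_in_inj i) mA).
  apply: percolation_le.
  - by apply: cylinder_measurable; exists T.
  - rewrite -[X in measurable X]setTI.
    exact: (measurable_reindex (@edge_in i) measurableT mA).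
  - by move=> w; apply: connected_sub => e /= /andP[/andP[]].
rewrite -[tauF p 1%g x](tau_translate gensFP FG p (fp_in g)) mulg1.
apply: le_trans (tau_along_tau gensFP FG p T _ _).
apply: expect_le => [|w]; first exact: i01P.
by apply: ind_le; apply: connected_sub => e /andP[].
Qed.

(** Neither [fp_head] nor [fp_in] increases distances to the identity, so the factors are
    isometrically embedded and rates of decay compare without loss. *)
Lemma cball_fp_head n i x : x \in cball gensF n -> fp_head i x \in cball (gens i) n.
Proof.
elim: n x => [|n IH] x; first by rewrite !in_ball0 => /eqP ->; rewrite fp_head1.
case/(in_ballS gensFP) => [/IH|[y /IH yn [d ->]]]; first exact: (ball_le (@gensP i) (leqnSn n)).
have [->|[d' [_ _ ->]]] := fp_head_step i y d; last exact: step_ball.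
exact: (ball_le (@gensP i) (leqnSn n)).
Qed.

Lemma cball_fp_in n i (g : G i) : g \in cball (gens i) n -> fp_in g \in cball gensF n.
Proof.
elim: n g => [|n IH] g; first by rewrite !in_ball0 => /eqP ->; rewrite fp_in1.
case/(in_ballS (@gensP i)) => [/IH|[y /IH yn [d ->]]]; first exact: (ball_le gensFP (leqnSn n)).
by rewrite -step_in; exact: step_ball.
Qed.

Lemma graph_dist_fp_in i (g : G i) :
  (graph_dist (Gr := cayley (S i)) 1%g g <= graph_dist (Gr := cayley SF) 1%g (fp_in g))%N.
Proof.
apply: (graph_dist_ball (@gensP i)); rewrite -[g in g \in _]fp_head_in.
apply: cball_fp_head; exact: ball_graph_dist gensFP free_product_gens_generates _.
Qed.

Lemma graph_dist_fp_cons i (g : G i) x :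
  (graph_dist (Gr := cayley SF) 1%g (fp_in g * x)%g <=
   graph_dist (Gr := cayley (S i)) 1%g g + graph_dist (Gr := cayley SF) 1%g x)%N.
Proof.
apply: (graph_dist_ball gensFP); apply: (ballD gensFP).
  by apply: cball_fp_in; exact: ball_graph_dist (@gensP i) (@Sgen i) _.
exact: ball_graph_dist gensFP free_product_gens_generates _.
Qed.

(** Along a reduced word [tau] is submultiplicative and [graph_dist] subadditive; with constant 1
    nothing accumulates in the induction. *)
Lemma tau_fp_decay p (gamma : R) :
  (forall i (g : G i), tau i p 1%g g <=
    expR (- gamma * (graph_dist (Gr := cayley (S i)) 1%g g)%:R)) ->
  0 <= gamma ->
  forall x, tauF p 1%g x <= expR (- gamma * (graph_dist (Gr := cayley SF) 1%g x)%:R).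
Proof.
have FG := free_product_gens_generates.
move=> Hi g0; elim/fp_ind => [|i g x g1 hx IH].
  rewrite (_ : graph_dist _ _ = 0%N) ?mulr0 ?expR0 ?(tau_le1 gensFP FG)//.
  by apply/eqP; rewrite -leqn0; apply: (graph_dist_ball gensFP); exact: ball1.
apply: (le_trans (tau_fp_cons p g1 hx)).
apply: (@le_trans _ _ (expR (- gamma * (graph_dist (Gr := cayley (S i)) 1%g g)%:R) *
  expR (- gamma * (graph_dist (Gr := cayley SF) 1%g x)%:R))).
  by apply: ler_pM => //; [exact: tau_ge0 (@gensP i) (@Sgen i) _ _ _|exact: tau_ge0 gensFP FG _ _ _].
rewrite -expRD ler_expR -mulrDr -natrD !mulNr lerN2 ler_wpM2l// ler_nat.
exact: graph_dist_fp_cons.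
Qed.

End free_product_cayley.

(** * Absorbing the constant of the exponential decay *)

Section decay_with_unit_constant.
Variables (R : realType) (G : groupType) (S : set G) (gens : seq (set_type S)).
Hypothesis gensP : forall s, s \in gens.
Hypothesis Sgen : generates S.
Local Notation tau := (@tau R G S).
Local Notation dist := (graph_dist (Gr := cayley S)).
Implicit Types (p : {i01 R}).

Lemma exponential_decay_le p p' : p%:num <= p'%:num ->
  exponential_decay (cayley S) p' -> exponential_decay (cayley S) p.
Proof.
move=> pp' /(exponential_decayP gensP Sgen)[C [gamma [C0 g0 H]]].
apply/(exponential_decayP gensP Sgen); exists C, gamma; split=> // x.
exact: (le_trans (tau_mono gensP Sgen 1%g x pp') (H x)).
Qed.

Lemma lt_p_exp_decay p : p%:num < p_exp R (cayley S) -> exponential_decay (cayley S) p.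
Proof.
(* The supremum of the empty set is 0, and no parameter lies below 0. *)
move=> pe; have [A0|/set0P A0] :=
  eqVneq [set p%:num | p in exponential_decay (R := R) (cayley S)] set0.
  by move: pe; rewrite /p_exp A0 sup0 => /lt_geF; rewrite ge0.
have hs : has_sup [set p%:num | p in exponential_decay (R := R) (cayley S)].
  by split => //; exists 1 => _ [r _ <-].
have gap : 0 < p_exp R (cayley S) - p%:num by rewrite subr_gt0.
have [_ [p' p'A <-] pp'] := sup_adherent gap hs.
apply: exponential_decay_le p'A; apply/ltW; move: pp'.
by rewrite -/(p_exp R (cayley S)) subKr.
Qed.

(* Since [tau p 1 g] is bounded away from 1 for [g <> 1], the multiplicative
   constant in the exponential decay can be absorbed in the rate. *)
Lemma tau_unit_decay p : p%:num < 1 ->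
  finite_set [set: G] \/ exponential_decay (cayley S) p ->
  exists2 gamma : R, 0 < gamma &
    forall g, tau p 1%g g <= expR (- gamma * (dist 1%g g)%:R).
Proof.
move=> p1 fin_or_decay.
have [D [gamma0 g0 H]] : exists D : nat, exists2 gamma0 : R, 0 < gamma0 &
    forall g, (D < dist 1%g g)%N -> tau p 1%g g <= expR (- gamma0 * (dist 1%g g)%:R).
  case: fin_or_decay => [/finite_fsetP[C CE]|].
    have [n Cn] := ball_exhausts_fset gensP Sgen C.
    (* No point is farther than [n], so the claim is vacuous and the rate 1 arbitrary. *)
    exists n, 1 => // g; rewrite ltnNge (graph_dist_ball gensP)//.
    by apply: Cn; have : [set: G] g by []; rewrite CE.
  move=> /(exponential_decayP gensP Sgen)[C [gamma [C0 gam0 Hd]]].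
  (* Half of the rate is spent on the constant: [C <= 1 + gamma d / 2 <= exp (gamma d / 2)] as soon
     as [d > 2 C / gamma]. *)
  have [D _ /(_ D (leqnn D)) HD] := nbhs_infty_gtr (C * 2 / gamma).
  exists D, (gamma / 2); first by rewrite divr_gt0.
  move=> g Dg; apply: (le_trans (Hd g)); set d := (dist 1%g g)%:R.
  have Dd : D%:R <= d by rewrite ler_nat ltnW.
  have -> : - gamma * d = gamma / 2 * - d + - (gamma / 2) * d by field.
  rewrite expRD mulrA ger_pMl ?expR_gt0// mulrN expRN ler_pdivrMr ?expR_gt0// mul1r.
  apply: le_trans (expR_ge1Dx _).
  have : C * 2 / gamma < d by exact: lt_le_trans HD Dd.
  rewrite ltr_pdivrMr//; lra.
have [delta d0 Hd] := tau_lt1 gensP Sgen p1.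
pose e := Num.max (1 - delta) (1 / 2).
have e0 : 0 < e by rewrite lt_max; apply/orP; right.
have e1 : e < 1 by rewrite gt_max; apply/andP; split; lra.
have le0 : ln e < 0 by rewrite ln_lt0// e0.
(* Chosen so that [expR (- gamma1 * D.+1)] equals [e], the bound on [tau] within distance [D]. *)
pose gamma1 := - ln e / D.+1%:R.
have gamma10 : 0 < gamma1 by rewrite divr_gt0// oppr_gt0.
exists (Num.min gamma0 gamma1); first by rewrite lt_min g0.
move=> g; have [->|/eqP g1] := eqVneq g 1%g.
  rewrite (_ : dist 1%g 1%g = 0%N) ?mulr0 ?expR0 ?(tau_le1 gensP Sgen)//.
  by apply/eqP; rewrite -leqn0; apply: (graph_dist_ball gensP); exact: ball1.
have [Dg|gD] := ltnP D (dist 1%g g).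
  apply: (le_trans (H g Dg)); rewrite ler_expR !mulNr lerN2 ler_wpM2r//.
  by rewrite ge_min lexx.
apply: (le_trans (Hd g g1)); apply: (@le_trans _ _ e); first by rewrite le_max lexx.
rewrite -[leLHS]lnK ?posrE// ler_expR mulNr lerNr.
have -> : - ln e = gamma1 * D.+1%:R by rewrite /gamma1; field.
apply: ler_pM => //; first by rewrite le_min !ltW.
  by rewrite ge_min lexx orbT.
by rewrite ler_nat ltnW.
Qed.

End decay_with_unit_constant.

(** * Equality of the decay thresholds *)

Section exponents.
Variables (R : realType) (n : nat) (G : 'I_n -> groupType).
Variable S : forall i, set (G i).
Arguments S : clear implicits.
Variable gens : forall i, seq (set_type (S i)).
Hypothesis gensP : forall i s, s \in gens i.
Hypothesis Sgen : forall i, generates (S i).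
Local Notation FP := (free_product G).
Local Notation SF := (free_product_gens S).
Variable gensF : seq (set_type SF).
Hypothesis gensFP : forall s, s \in gensF.
Let FG := free_product_gens_generates Sgen.

Lemma p_exp_free_product_le i : p_exp R (cayley SF) <= p_exp R (cayley (S i)).
Proof.
have [A0|/set0P A0] := eqVneq [set p%:num | p in exponential_decay (R := R) (cayley SF)] set0.
  by rewrite {1}/p_exp A0 sup0; exact: p_exp_ge0.
apply: ge_sup => // _ [p Hp <-]; apply: p_exp_ub.
have [C [gamma [C0 g0 H]]] := (exponential_decayP gensFP FG p).1 Hp.
apply/(exponential_decayP (@gensP i) (@Sgen i)); exists C, gamma; split=> // g.
apply: (le_trans (tau_fp_in gensP Sgen gensFP p g)); apply: (le_trans (H _)).
rewrite ler_pM2l// ler_expR !mulNr lerN2 ler_pM2l// ler_nat.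
exact: (graph_dist_fp_in gensP Sgen gensFP g).
Qed.

(** Below the minimum every factor decays with constant 1, a finite factor merely because [p < 1],
    and the smallest of the finitely many rates serves the whole product. *)
Lemma bigmin_p_exp : ~ finite_set [set: FP] ->
  \big[Num.min/1]_(i < n) cayley_p_exp R (S i) = cayley_p_exp R SF.
Proof.
move=> Finf; have -> : cayley_p_exp R SF = p_exp R (cayley SF).
  by rewrite /cayley_p_exp; case: asboolP.
apply/eqP; rewrite eq_le; apply/andP; split; last first.
  apply/bigmin_geP; split=> [|i _]; first exact: p_exp_le1.
  rewrite /cayley_p_exp; case: ifP => _; first exact: p_exp_le1.
  exact: p_exp_free_product_le.
rewrite leNgt; apply/negP => lt_e.
have m1 : \big[Num.min/1]_(i < n) cayley_p_exp R (S i) <= 1 by exact: bigmin_le_id.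
have [p /andP[ep pm]] := i01_between (p_exp_ge0 R SF) m1 lt_e.
have p1 : p%:num < 1 := lt_le_trans pm m1.
have /choice[gamma Hgamma] : forall i, exists gamma : R, 0 < gamma /\
    forall g, tau (S i) p 1%g g <= expR (- gamma * (graph_dist (Gr := cayley (S i)) 1%g g)%:R).
  move=> i; have [|gam g0 H] := tau_unit_decay (@gensP i) (@Sgen i) p1; last by exists gam.
  have : p%:num < cayley_p_exp R (S i) by exact: lt_le_trans pm (bigmin_le _ _ _).
  rewrite /cayley_p_exp; case: asboolP => fi; [by left|right].
  exact: lt_p_exp_decay.
pose gam := \big[Num.min/1]_(i < n) gamma i.
have gam0 : 0 < gam by apply/bigmin_gtP; split=> // i _; have [] := Hgamma i.
suff : p%:num <= p_exp R (cayley SF) by rewrite leNgt ep.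
apply: p_exp_ub; apply/(exponential_decayP gensFP FG); exists 1, gam; split=> // x.
rewrite mul1r; apply: (tau_fp_decay gensP Sgen gensFP) (ltW gam0) x => i g.
apply: (le_trans ((Hgamma i).2 g)).
by rewrite ler_expR !mulNr lerN2 ler_wpM2r// bigmin_le.
Qed.

End exponents.

Lemma ler_of_geometric (R : realType) (a b : R) : 0 <= b -> b < 1 ->
  (forall k, a <= b ^+ k) -> a <= 0.
Proof.
move=> b0 b1 H; rewrite leNgt; apply/negP => a0.
have : (fun k => b ^+ k) @ \oo --> (0 : R) by apply: cvg_expr; rewrite ger0_norm.
move=> /cvgrPdist_lt /(_ _ a0) [k _ /(_ k (leqnn k))].
by rewrite sub0r normrN ger0_norm ?exprn_ge0// ltNge H.
Qed.

(** * Uniqueness of the infinite cluster *)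

Section uniqueness_harris.
Variables (R : realType) (G : groupType) (S : set G) (gens : seq (set_type S)).
Hypothesis gensP : forall s, s \in gens.
Hypothesis Sgen : generates S.
Local Notation E := (edge (cayley S)).
Local Notation ev := (set (g_sigma_algebraType (@measurable _ (config E)))).
Local Notation conn := (connected_in (Gr := cayley S)).
Local Notation cball := (cball gens).
Local Notation incident := (incident gens).
Local Notation tau := (@tau R G S).
Local Notation theta := (percolation_probability (Gr := cayley S) 1%g).
Local Notation inf_at w x := (infinite_set (cluster_of (Gr := cayley S) w x)).
Implicit Types (x y z : G) (w : config E) (p : {i01 R}).

Lemma percolation_translate p x :
  bond_percolation p [set w : config E | inf_at w x] = theta p.
Proof.
have mA := infinite_cluster_measurable gensP Sgen 1%g.
rewrite /percolation_probability -(percolation_reindex p (@translate_edge_inj _ S x) mA).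
congr (bond_percolation p _); apply/seteqP; split=> w /=; apply: contra_not => fin.
  apply: sub_finite_set (finite_image (fun z => (x * z)%g) fin).
  move=> z xz; exists (x^-1 * z)%g; last by rewrite mulVKg.
  by apply/connected_translate; rewrite mulg1 mulVKg.
apply: sub_finite_set (finite_image (fun z => (x^-1 * z)%g) fin).
move=> z xz; exists (x * z)%g; last by rewrite mulKg.
by have /connected_translate := xz; rewrite mulg1.
Qed.

Lemma theta_fin p : exists2 c : R, 0 <= c & theta p = c%:E.
Proof.
exists (fine (theta p)); first by rewrite fine_ge0// measure_ge0.
rewrite fineK// fin_num_measure//; exact: infinite_cluster_measurable gensP Sgen 1%g.
Qed.

(** The group is enumerated by its balls; if [theta p = 0], almost surely none of these countably
    many points lies in an infinite cluster. *)
Lemma unique_infinite_theta p :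
  {ae bond_percolation p, forall w : config E, exists! K, infinite_cluster w K} ->
  (0 < theta p)%E.
Proof.
move=> uniq; rewrite lt_neqAle measure_ge0 andbT; apply/eqP => th0.
have neg n k : (bond_percolation p).-negligible
    ([set w | inf_at w (nth 1%g (cball n) k)] : ev).
  apply/negligibleP; first exact: infinite_cluster_measurable gensP Sgen _.
  by have := percolation_translate p (nth 1%g (cball n) k); rewrite -th0.
have bad : (bond_percolation p).-negligible
    ((~` [set w : config E | exists! K, infinite_cluster w K]) `|`
      \bigcup_n \bigcup_k [set w | inf_at w (nth 1%g (cball n) k)] : ev).
  apply: negligibleU; first exact: uniq.
  by apply: negligible_bigcup => n; apply: negligible_bigcup => k; exact: neg.
have /negligibleP : (bond_percolation p).-negligible ([set: config E] : ev).
  apply: negligibleS bad.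
  move=> w _; have [[K [[Kinf [x Kx]] _]]|nu] :=
    pselect (exists! K, infinite_cluster w K); last by left.
  right; have [n xn] := ball_exhausts gensP Sgen x.
  exists n => //; exists (index x (cball n)) => //=.
  by rewrite nth_index// -Kx.
move=> /(_ measurableT) P0.
have P1 : bond_percolation p [set: config E] = 1%E by exact: probability_setT.
have : 1%E = 0%E :> \bar R by rewrite -P1; exact: P0.
by move=> /eqP; rewrite eqe oner_eq0.
Qed.

(** By Harris and translation invariance both points lie in infinite clusters with probability at
    least [theta ^ 2], and uniqueness merges the two clusters off a null set. *)
Lemma unique_infinite_tau p x :
  {ae bond_percolation p, forall w : config E, exists! K, infinite_cluster w K} ->
  fine (theta p) ^+ 2 <= tau p 1%g x.
Proof.
move=> uniq; have [c c0 thc] := theta_fin p; rewrite thc /=.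
have low : ((c ^+ 2)%:E <= bond_percolation p
    [set w : config E | inf_at w 1%g /\ inf_at w x])%E.
  apply: (infinite_clusters_ge gensP Sgen) => n; set T := incident (cball n).
  have dT : determined T (fun w => escapes (cball n) w 1%g /\ escapes (cball n) w x).
    move=> w w' ww'; rewrite (escapes_determined gensP 1%g ww').
    by rewrite (escapes_determined gensP x ww').
  rewrite (percolationE p dT) lee_fin.
  have ge z : c <= expect p%:num T (fun w => ind R (escapes (cball n) w z)).
    rewrite -lee_fin -thc -(percolation_translate p z).
    rewrite -(percolationE p (escapes_determined gensP z)).
    apply: percolation_le.
    - exact: infinite_cluster_measurable gensP Sgen z.
    - exact: escapes_measurable.
    - by rewrite (infinite_clusterE gensP Sgen) => w /(_ n I).
  apply: (@le_trans _ _ (expect p%:num T (fun w => ind R (escapes (cball n) w 1%g)) *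
      expect p%:num T (fun w => ind R (escapes (cball n) w x)))).
    by rewrite expr2; apply: ler_pM.
  apply: (le_trans (expect_harris _ (i01P p) _ _)).
  - by move=> w w' ww'; apply: ind_le; exact: escapes_incr.
  - by move=> w w' ww'; apply: ind_le; exact: escapes_incr.
  - by apply: expect_le => [|w]; [exact: i01P|rewrite ind_and].
rewrite -lee_fin -(tauE gensP Sgen); apply: (le_trans low).
have [N [mN N0 sub]] := uniq.
have mC := connected_measurable gensP Sgen 1%g x.
apply: (@le_trans _ _ (bond_percolation p ([set w : config E | conn w 1%g x] `|` N))).
  apply: percolation_le; [|exact: measurableU|].
    rewrite -[X in measurable X]/([set w : config E | _] `&` [set w : config E | _]).
    by apply: measurableI; exact: infinite_cluster_measurable gensP Sgen _.
  move=> w /= [i1 ix]; have [[K [_ KU]]|nu] := pselect (exists! K, infinite_cluster w K).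
    left; have K1 : K = cluster_of (Gr := cayley S) w 1%g by apply: KU; split=> //; exists 1%g.
    have Kx : K = cluster_of (Gr := cayley S) w x by apply: KU; split=> //; exists x.
    have : cluster_of (Gr := cayley S) w x x by exact: connected_refl.
    by rewrite -Kx K1.
  by right; apply: sub.
apply: (le_trans (measureU2 _ mC mN)).
rewrite -[leRHS]adde0; apply: leeD; first exact: lexx.
by rewrite le_eqVlt; apply/orP; left; apply/eqP; exact: N0.
Qed.

Lemma all_open_unique p : ~ finite_set [set: G] -> p%:num = 1 ->
  {ae bond_percolation p, forall w : config E, exists! K, infinite_cluster w K}.
Proof.
move=> Ginf p1.
have dA n : determined (incident (cball n)) (fun w : config E => {in incident (cball n), forall e, w e}).
  move=> w w' ww'; apply/propext; split=> H e en; [rewrite -ww'//|rewrite ww'//]; exact: H.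
have mA n : measurable ([set w : config E | {in incident (cball n), forall e, w e}] : ev).
  by apply: cylinder_measurable; exists (incident (cball n)).
have neg n : (bond_percolation p).-negligible
    (~` [set w : config E | {in incident (cball n), forall e, w e}] : ev).
  apply/negligibleP; first exact: measurableC.
  transitivity (1 - bond_percolation p [set w : config E |
      {in incident (cball n), forall e, w e}])%E; first exact: probability_setC.
  rewrite (percolationE p (dA n)).
  suff -> : expect p%:num (incident (cball n))
      (fun w => ind R {in incident (cball n), forall e, w e}) = 1 by rewrite subee.
  apply/eqP; rewrite eq_le; apply/andP; split.
    rewrite -[leRHS](expect_cst p%:num (incident (cball n))).
    by apply: expect_le => [|w]; [exact: i01P|exact: ind_le1].
  apply: (@le_trans _ _ (p%:num ^+ size (incident (cball n)))); first by rewrite p1 expr1n.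
  apply: expect_open => [|w|w wn]; [exact: i01P|exact: ind_ge0|].
  by rewrite indT.
apply: (negligibleS _ (negligible_bigcup neg)).
move=> w /= nu; apply: contrapT => nb; apply: nu.
have open e : w e.
  have [n en] := edge_exhausts gensP Sgen e.
  apply: contrapT => we; apply: nb; exists n => //= H; exact: we (H e en).
have wE : w = fun=> true by apply/funext => e; rewrite open.
have cl x : cluster_of (Gr := cayley S) w x = setT.
  apply/seteqP; split=> // y _; rewrite /cluster_of /= wE.
  apply: connected_trans (connected_full gensP Sgen y).
  by apply: connected_sym; exact: connected_full.
exists setT; split.
  by split=> //; exists 1%g.
by move=> K [_ [x ->]]; rewrite cl.
Qed.

End uniqueness_harris.

Section alternating_words.
Variables (I : choiceType) (G : I -> groupType) (i j : I) (g : G i) (h : G j).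
Hypotheses (ij : i != j) (g1 : g != 1%g) (h1 : h != 1%g).
Local Notation FP := (free_product G).

Definition alternate k : FP := iter k (fun x => fp_in g * (fp_in h * x))%g 1%g.

Lemma alternateS k : alternate k.+1 = (fp_in g * (fp_in h * alternate k))%g.
Proof. by []. Qed.

Lemma alternate_headfree2 k : headfree j (word_of (alternate k)) ->
  headfree i (word_of (fp_in h * alternate k)%g).
Proof. by move=> hk; rewrite word_of_inM//= eq_sym. Qed.

Lemma alternate_headfree k : headfree j (word_of (alternate k)).
Proof.
by elim: k => // k IH; rewrite alternateS word_of_inM// alternate_headfree2.
Qed.

Lemma size_alternate k : size (word_of (alternate k)) = k.*2.
Proof.
have hk := alternate_headfree; elim: k => // k IH.
rewrite alternateS word_of_inM//; last exact: alternate_headfree2.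
by rewrite word_of_inM// [RHS]doubleS -IH.
Qed.

Lemma free_product_infinite : ~ finite_set [set: FP].
Proof.
move=> /finite_fsetP[C CE].
pose N := (\max_(x <- C) size (word_of x))%N.
have : alternate N.+1 \in C by have : [set: FP] (alternate N.+1) by []; rewrite CE.
move=> /(@leq_bigmax_seq _ _ xpredT (fun x => size (word_of x))) => /(_ isT).
rewrite size_alternate -/N; lia.
Qed.

End alternating_words.

Section uniqueness_threshold.
Variables (R : realType) (I : choiceType) (G : I -> groupType).
Variable S : forall i, set (G i).
Arguments S : clear implicits.
Variable gens : forall i, seq (set_type (S i)).
Hypothesis gensP : forall i s, s \in gens i.
Hypothesis Sgen : forall i, generates (S i).
Local Notation SF := (free_product_gens S).
Variable gensF : seq (set_type SF).
Hypothesis gensFP : forall s, s \in gensF.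
Variables (i j : I) (g : G i) (h : G j).
Hypotheses (ij : i != j) (g1 : g != 1%g) (h1 : h != 1%g).
Let FG := free_product_gens_generates Sgen.

(** In the words [(g h)^k] each letter [g] costs a factor at most [1 - d], the letters [h] being
    bounded by 1, so no positive lower bound on [tau] can hold when [p < 1]. At [p = 1] uniqueness
    does hold, which makes the infimum equal to 1. *)
Lemma p_u_free_product : p_u R (cayley SF) = 1.
Proof.
have Finf := free_product_infinite ij g1 h1.
have H1 : (1 : R) <= 1 by [].
pose one : {i01 R} := Itv01 ler01 H1.
apply/eqP; rewrite eq_le; apply/andP; split.
  apply: ge_inf; first by exists 0 => _ [r _ <-].
  by exists one => //=; exact: (all_open_unique gensFP FG).
apply: lb_le_inf; first by exists 1, one => //=; exact: (all_open_unique gensFP FG).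
move=> _ [p /= uniq <-]; rewrite leNgt; apply/negP => p1.
have [d d0 Hd] := tau_lt1 (gensP (i := i)) (Sgen (i := i)) p1.
have th0 := unique_infinite_theta gensFP FG uniq.
have [c c0 thc] := theta_fin gensFP FG p; rewrite thc lte_fin in th0.
have tg : tau (S i) p 1%g g <= 1 - d by apply: Hd; exact/eqP.
have d1 : 0 <= 1 - d by apply: le_trans tg; exact: tau_ge0 (gensP (i := i)) (Sgen (i := i)) _ _ _.
suff : c ^+ 2 <= 0 by rewrite leNgt exprn_gt0.
apply: (@ler_of_geometric _ _ (1 - d)) => //; first by rewrite ltrBlDr ltrDl.
move=> k; have := unique_infinite_tau gensFP FG (alternate g h k) uniq.
rewrite thc /= => /le_trans; apply; elim: k => [|k IH].
  by rewrite expr0; exact: (tau_le1 gensFP FG).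
rewrite exprS; apply: (le_trans (tau_fp_cons gensP Sgen gensFP p g1
  (alternate_headfree2 ij h1 (alternate_headfree ij g1 h1 k)))).
apply: ler_pM => //; first exact: tau_ge0 (gensP (i := i)) (Sgen (i := i)) _ _ _.
  exact: tau_ge0 gensFP FG _ _ _.
apply: (le_trans (tau_fp_cons gensP Sgen gensFP p h1 (alternate_headfree ij g1 h1 k))).
apply: le_trans IH; rewrite -[leRHS]mul1r; apply: ler_wpM2r.
  exact: tau_ge0 gensFP FG _ _ _.
exact: (tau_le1 (gensP (i := j)) (Sgen (i := j))).
Qed.

End uniqueness_threshold.

(** * Strict inequality *)

Section open_path.
Variables (R : realType) (G : groupType) (S : set G) (gens : seq (set_type S)).
Hypothesis gensP : forall s, s \in gens.
Hypothesis Sgen : generates S.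

(** Open all edges around a ball containing [x]. The exponent is the same for all [p], which gives a
    minorant of [tau] continuous in the parameter. *)
Lemma tau_ge_expr x : exists K, forall p : {i01 R}, p%:num ^+ K <= tau S p 1%g x.
Proof.
have [n xn] := ball_exhausts gensP Sgen x; set T := incident gens (cball gens n).
exists (size T) => p; apply: le_trans (tau_along_tau gensP Sgen p T 1%g x).
apply: expect_open => [|w|w wT]; [exact: i01P|exact: ind_ge0|rewrite indT//].
suff H m : (m <= n)%N -> forall y, y \in cball gens m -> connected_along T w 1%g y.
  exact: H (leqnn n) x xn.
elim: m => [|m IH] mn y.
  by rewrite in_ball0 => /eqP ->; exact: connected_refl.
have IHm := IH (ltnW mn).
case/(in_ballS gensP) => [/IHm//|[z zm [d ->]]].
apply: connected_dart (IHm z zm) _.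
have zT : dart_edge z d \in T.
  apply: dart_edge_incident => //; exact: (ball_le gensP (ltnW mn)).
by rewrite /keep_edges zT wT.
Qed.

End open_path.

(** * Words that multiply without cancellation *)

Section two_letter_words.
Variables (I : choiceType) (G : I -> groupType) (i : I).
Local Notation FP := (free_product G).
Implicit Types (x y : FP) (W : seq FP).

(** The second letter lies outside the factor in which the next word starts, so concatenations of
    such words are reduced. *)
Definition two_letters x : bool :=
  if word_of x is [:: a; b] then (tag a == i) && (tag b != i) else false.

Definition starts_in x : bool := if word_of x is a :: _ then tag a == i else true.

Lemma two_lettersP j (g : G i) (h : G j) : i != j -> g != 1%g -> h != 1%g ->
  two_letters (fp_in g * fp_in h)%g.
Proof.
move=> ij g1 h1; have wh : word_of (fp_in h) = [:: Tagged G h].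
  by rewrite word_of_in /push (negbTE h1).
by rewrite /two_letters word_of_inM// ?wh//= ?eqxx eq_sym.
Qed.

Lemma word_of_block x y : two_letters x -> starts_in y ->
  word_of (x * y)%g = word_of x ++ word_of y.
Proof.
rewrite /two_letters /starts_in -[word_of (x * y)%g]/(word_mul (word_of x) (word_of y)).
have := valP x; have := valP y; rewrite /=.
move: (word_of x) (word_of y) => [|a [|b []]]// v rv rab /andP[/eqP ai bi] hv.
have [/and3P[a1 ba /and3P[b1 _ _]]] :
    [&& tagged a != 1%g, headfree (tag a) [:: b] & [&& tagged b != 1%g, true & true]].
  by move: rab; rewrite !reduced_cons.
have rbv : reduced (b :: v).
  rewrite reduced_cons b1 rv andbT /=; case: v hv {rv} => //= c v /eqP ->.
  by rewrite eq_sym.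
rewrite -[LHS]/(lact (tagged a) (lact (tagged b) v)) (lact_cons rbv).
by apply: lact_cons; rewrite reduced_cons a1 rbv andbT.
Qed.

Fixpoint block_words W k : seq FP :=
  if k is k'.+1 then [seq (x * y)%g | x <- W, y <- block_words W k'] else [:: 1%g].

Lemma block_words_starts W k : all two_letters W -> {in block_words W k, forall y, starts_in y}.
Proof.
move=> /allP WP; elim: k => [|k IH] y; first by rewrite inE => /eqP ->.
case/allpairsP => -[u v] [/= /WP u2 /IH vi ->].
rewrite /starts_in word_of_block//; move: u2; rewrite /two_letters.
by case: (word_of u) => [|a [|b []]]//= /andP[].
Qed.

(** All blocks have length two, so a concatenation can be cut back into its blocks: distinct words
    of this shape freely generate a monoid. *)
Lemma block_words_uniq W k : uniq W -> all two_letters W -> uniq (block_words W k).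
Proof.
move=> uW WP; elim: k => // k IH; apply: allpairs_uniq => // -[u v] [u' v'].
move=> /allpairsP[[a b] [/= aW bW [-> ->]]] /allpairsP[[a' b'] [/= aW' bW' [-> ->]]].
move=> {u v u' v'} /(congr1 (@word_of _ _)).
have a2 := allP WP _ aW; have a2' := allP WP _ aW'.
have sb := block_words_starts WP bW; have sb' := block_words_starts WP bW'.
rewrite !word_of_block//.
have sz x : two_letters x -> size (word_of x) = 2%N.
  by rewrite /two_letters; case: (word_of x) => [|? [|? []]].
move=> /eqP; rewrite eqseq_cat ?sz// => /andP[/eqP/val_inj -> /eqP/val_inj ->].
by [].
Qed.

End two_letter_words.

Section strict_inequality.
Variables (R : realType) (I : choiceType) (G : I -> groupType).
Variable S : forall i, set (G i).
Arguments S : clear implicits.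
Variable gens : forall i, seq (set_type (S i)).
Hypothesis gensP : forall i s, s \in gens i.
Hypothesis Sgen : forall i, generates (S i).
Local Notation FP := (free_product G).
Local Notation SF := (free_product_gens S).
Variable gensF : seq (set_type SF).
Hypothesis gensFP : forall s, s \in gensF.
Let FG := free_product_gens_generates Sgen.
Local Notation tauF := (@tau R FP SF).
Local Notation pcF := (p_c R (1%g : vertex (cayley SF))).
Implicit Types (p : {i01 R}) (x y : FP) (W : seq FP).

Lemma tau_harris_mul p x y : tauF p 1%g x * tauF p 1%g y <= tauF p 1%g (x * y)%g.
Proof.
rewrite -[X in _ * X](tau_translate gensFP FG p x) mulg1.
exact: tau_harris gensFP FG _ _ _ _.
Qed.

Lemma p_c_le_growth i p W : 0 < p%:num -> uniq W -> all (two_letters i) W ->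
  1 < \sum_(x <- W) tauF p 1%g x -> pcF <= p%:num.
Proof.
move=> p0 uW W2; set mu := \sum_(x <- W) _ => mu1; have mu0 := lt_trans ltr01 mu1.
apply: (phi_ge1_p_c gensFP FG p0) => C C1; rewrite leNgt; apply/negP => phi1.
set K := (size C)%:R / (1 - phi gensF p%:num C).
have growth k : mu ^+ k <= \sum_(x <- block_words W k) tauF p 1%g x.
  elim: k => [|k IH]; first by rewrite big_seq1 (tau_refl gensFP FG).
  rewrite exprS big_allpairs_dep mulr_suml; apply: ler_sum => x _.
  apply: (@le_trans _ _ (tauF p 1%g x * \sum_(y <- block_words W k) tauF p 1%g y)).
    by rewrite ler_wpM2l//; exact: tau_ge0 gensFP FG _ _ _.
  by rewrite mulr_sumr; apply: ler_sum => y _; exact: tau_harris_mul.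
have bound k : mu ^+ k <= K.
  apply: (le_trans (growth k)); apply: (phi_lt1_susceptibility gensFP FG C1 phi1).
  exact: block_words_uniq uW W2.
have K0 : 0 < K by apply: lt_le_trans (bound 0%N); rewrite expr0.
have : K^-1 <= 0.
  apply: (@ler_of_geometric _ _ mu^-1); rewrite ?invr_ge0 ?(ltW mu0)//.
    by rewrite invf_lt1.
  by move=> k; rewrite exprVn lef_pV2 ?posrE// exprn_gt0.
by rewrite leNgt invr_gt0 K0.
Qed.

(** By continuity the sum of the minorants [c] still exceeds 1 at some [p < m], where
    [p_c_le_growth] applies. *)
Lemma p_c_lt_growth i (m : R) W (c : FP -> R -> R) : 0 < m -> m <= 1 ->
  uniq W -> all (two_letters i) W -> (forall x, continuous (c x)) ->
  (forall p x, x \in W -> c x p%:num <= tauF p 1%g x) ->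
  1 < \sum_(x <- W) c x m -> pcF < m.
Proof.
move=> m0 m1 uW W2 cc ctau sum1.
have gap : 0 < \sum_(x <- W) c x m - 1 by rewrite subr_gt0.
have /cvgrPdist_lt/(_ _ gap) := continuous_bigsum (r := W) (P := xpredT) cc (x := m).
move=> [del /= del0 Hdel].
have lt_m : Num.max 0 (m - del) < m by rewrite gt_max m0 ltrBlDr ltrDl.
have max0 : 0 <= Num.max 0 (m - del) by rewrite le_max lexx.
have [p /andP[lp pm]] := i01_between max0 m1 lt_m.
move: lp; rewrite gt_max => /andP[p0 lp].
suff pcp : pcF <= p%:num by exact: le_lt_trans pcp pm.
apply: (p_c_le_growth p0 uW W2).
have near_m : `|m - p%:num| < del.
  by rewrite ger0_norm; lra.
apply: (@lt_le_trans _ _ (\sum_(x <- W) c x p%:num)).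
  by have := Hdel p%:num near_m; rewrite ltr_distlC => /andP[]; rewrite subKr.
by rewrite big_seq [leRHS]big_seq; apply: ler_sum => x xW; exact: ctau.
Qed.

Lemma p_c_lt_infinite_factor i j (h : G j) : i != j -> h != 1%g ->
  ~ finite_set [set: G i] -> pcF < p_c R (1%g : vertex (cayley (S i))).
Proof.
move=> ij h1 Ginf; set m := ltRHS.
have m0 : 0 < m by exact: (p_c_gt0 R (@gensP i) (@Sgen i) Ginf).
have m1 : m <= 1 by exact: p_c_le1.
have [K HK] := tau_ge_expr R gensFP FG (fp_in h).
have mK : 0 < m ^+ K by rewrite exprn_gt0.
pose D : R := (size (darts (gens i)))%:R.
(* [m ^+ K] bounds below the cost of the letter [h]; the additional 1 makes up for [g = 1], which
   gives no two-letter word. *)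
have [N _ /(_ N (leqnn N)) HN] := nbhs_infty_gtr (D * ((m ^+ K)^-1 + 1)).
set T := incident (gens i) (cball (gens i) N).
pose W := [seq (fp_in g * fp_in h)%g | g <- enum_fset (cball (gens i) N) & g != 1%g].
pose c (x : FP) (q : R) := tau_along q T 1%g (fp_head i x) * q ^+ K.
have hh : headfree i (word_of (fp_in h)) by rewrite word_of_in /push (negbTE h1) /= eq_sym.
apply: (@p_c_lt_growth i m W c m0 m1).
- rewrite map_inj_in_uniq ?filter_uniq ?fset_uniq// => g g'.
  rewrite !mem_filter => /andP[g1 _] /andP[g1' _] /(congr1 (fp_head i)).
  by rewrite !fp_head_inM.
- by apply/allP => z /mapP[g]; rewrite mem_filter => /andP[g1 _] ->; exact: two_lettersP.
- move=> x q; apply: cvgM; first exact: expect_continuous.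
  by apply: exprn_continuous.
- move=> p z /mapP[g]; rewrite mem_filter => /andP[g1 _] ->.
  apply: le_trans (tau_harris_mul p _ _); rewrite /c fp_head_inM//.
  apply: ler_pM => //; first by apply: expect_ge0 => [|w]; [exact: i01P|exact: ind_ge0].
  apply: le_trans (tau_fp_in gensP Sgen gensFP p g).
  exact: tau_along_tau (@gensP i) (@Sgen i) _ _ _ _.
have crit := critical_susceptibility R (@gensP i) (@Sgen i) Ginf N.
rewrite -/m -/D -/T in crit.
have D0 : 0 < D.
  rewrite lt0r ler0n andbT; apply/eqP => D0; move: HN; rewrite D0 mul0r.
  by move=> /lt_le_trans/(_ crit); rewrite D0 mul0r ltxx.
have sumN : (m ^+ K)^-1 + 1 < \sum_(x <- cball (gens i) N) tau_along m T 1%g x.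
  by rewrite -(ltr_pM2l D0); exact: lt_le_trans HN crit.
rewrite big_map big_filter.
have -> : \sum_(g <- cball (gens i) N | g != 1%g) c (fp_in g * fp_in h)%g m =
    (\sum_(g <- cball (gens i) N | g != 1%g) tau_along m T 1%g g) * m ^+ K.
  by rewrite mulr_suml; apply: eq_bigr => g g1; rewrite /c fp_head_inM.
rewrite -ltr_pdivrMr// mul1r.
move: sumN; rewrite (bigD1_seq 1%g (ball1 (@gensP i) N) (fset_uniq _)) /= addrC.
move=> sumN; rewrite -(ltrD2r 1); apply: (lt_le_trans sumN); rewrite lerD2l.
rewrite -[leRHS](expect_cst m T); apply: expect_le => [|w]; last exact: ind_le1.
by rewrite ltW.
Qed.

(** The minorants [q ^+ K] equal 1 at [q = 1], so the two words already have total weight 2. *)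
Lemma p_c_lt1_two_words i x y : two_letters i x -> two_letters i y -> x != y -> pcF < 1.
Proof.
move=> x2 y2 xy.
have /choice[K HK] := tau_ge_expr R gensFP FG.
apply: (@p_c_lt_growth i 1 [:: x; y] (fun z q => q ^+ K z)) => //.
- by rewrite /= inE xy.
- by rewrite /= x2 y2.
- by move=> z; exact: exprn_continuous.
by rewrite big_cons big_seq1 !expr1n; lra.
Qed.

End strict_inequality.

(** * The infinite dihedral group *)

Section infinite_dihedral.
Variables (G : groupType) (a b : G).
Local Open Scope group_scope.
Hypotheses (aa : a * a = 1) (bb : b * b = 1).
Hypothesis ab_free : forall k, (a * b) ^+ k.+1 <> 1.
Hypothesis ab_ind : forall Q : G -> Prop, Q 1 -> (forall x, Q x -> Q (a * x)) ->
  (forall x, Q x -> Q (b * x)) -> forall x, Q x.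

Let c := a * b.
Let f (m : int) : G :=
  match m with Posz k => c ^+ k | Negz k => c^-1 ^+ k.+1 end.

Let f0 : f 0%R = 1. Proof. exact: expg0. Qed.
Let f1 : f 1%R = c. Proof. exact: expg1. Qed.

Let f_succ m : f (m + 1)%R = f m * c.
Proof.
case: m => [k|[|k]].
- by rewrite -[(Posz k + 1)%R]/(Posz (k + 1)) addn1 /f expgSr.
- by rewrite -[(Negz 0 + 1)%R]/(Posz 0) /f expg1 mulVg expg0.
- have -> : (Negz k.+1 + 1)%R = Negz k by lia.
  by rewrite /f [in RHS]expgSr mulgVK.
Qed.

Let f_pred m : f (m - 1)%R = f m * c^-1.
Proof. by rewrite -[in RHS](subrK 1%R m) f_succ mulgK. Qed.

Let fM m n : f (m + n)%R = f m * f n.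
Proof.
elim/int_ind: n => [|n IH|n IH].
- by rewrite addr0 f0 mulg1.
- have -> : n.+1%:Z = (n%:Z + 1)%R by lia.
  by rewrite addrA !f_succ IH -mulgA.
- have -> : (- n.+1%:Z = - n%:Z - 1)%R by lia.
  by rewrite addrA !f_pred IH -mulgA.
Qed.

Let f_inj : injective f.
Proof.
have ker m : f m = 1 -> m = 0%R.
  case: m => [[//|k]|k] /=; first by move=> /ab_free.
  by rewrite expVgn => /(congr1 (fun x => x^-1)); rewrite invgK invg1 => /ab_free.
have fN m : f (- m)%R = (f m)^-1.
  by apply: (@mulgI _ (f m)); rewrite -fM subrr f0 mulgV.
move=> m n mn; apply/eqP; rewrite -subr_eq0; apply/eqP/ker.
by rewrite fM fN mn mulgV.
Qed.

Let fV m : (f m)^-1 = f (- m)%R.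
Proof. by apply: (@mulgI _ (f m)); rewrite -fM subrr mulgV f0. Qed.

(** With [c = a b] one has [b = a c] and [b a = c^-1], so left multiplication by [a] or [b]
    exchanges the two kinds of elements. *)
Let cosets x : (exists m, x = f m) \/ exists m, x = a * f m.
Proof.
move: x; apply: ab_ind.
- by left; exists 0%R; rewrite f0.
- move=> x [[m ->]|[m ->]]; [by right; exists m|left; exists m].
  by rewrite mulgA aa mul1g.
- move=> x [[m ->]|[m ->]]; [right; exists (1 + m)%R|left; exists (- 1 + m)%R].
    by rewrite fM f1 /c !mulgA aa mul1g.
  rewrite fM -fV f1 /c mulgA; congr (_ * _).
  by apply: (@mulgI _ (a * b)); rewrite mulgV -mulgA (mulgA b) bb mul1g.
Qed.

Lemma dihedral_virtually_Z : virtually_Z G.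
Proof.
exists (range f); split; last by exists f.
- split=> [|_ _ [m _ <-] [n _ <-]|_ [m _ <-]].
  + by exists 0%R => //; rewrite f0.
  + by exists (m + n)%R.
  + by exists (- m)%R => //; rewrite fV.
- have Hm m : [set f m * h | h in range f] = range f.
    apply/seteqP; split=> [_ [_ [n _ <-] <-]|_ [n _ <-]].
      by exists (m + n)%R => //; rewrite fM.
    exists (f (- m + n)%R); first by exists (- m + n)%R.
    by rewrite -fM addrA subrr add0r.
  apply: (@sub_finite_set _ _ [set range f; [set a * h | h in range f]]); last exact: finite_set2.
  move=> _ [x _ <-]; have [[m ->]|[m ->]] := cosets x; [left|right].
    exact: Hm.
  apply/seteqP; split=> [_ [_ [n _ <-] <-]|_ [_ [n _ <-] <-]].
    by exists (f (m + n)%R); [exists (m + n)%R|rewrite fM mulgA].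
  exists (f (- m + n)%R); first by exists (- m + n)%R.
  by rewrite -mulgA -fM addrA subrr add0r.
Qed.

End infinite_dihedral.

Lemma free_product_order2_virtually_Z (I : choiceType) (G : I -> groupType)
    (i j : I) (g : G i) (h : G j) : i != j -> g != 1%g -> h != 1%g ->
  (forall k, k = i \/ k = j) ->
  (forall k (x y : G k), x != 1%g -> y != 1%g -> x = y) ->
  virtually_Z (free_product G).
Proof.
move=> ij g1 h1 Iij G2.
(* If [x * x] were non-trivial it would be the only non-trivial element [x], forcing [x = 1]. *)
have sq k (x : G k) : x != 1%g -> (fp_in x * fp_in x = 1)%g.
  move=> x1; rewrite -fp_inM; have [->|xx] := eqVneq (x * x)%g 1%g; first exact: fp_in1.
  by case/eqP: (x1); apply: (@mulgI _ x); rewrite mulg1; exact: G2.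
apply: (@dihedral_virtually_Z _ (fp_in g) (fp_in h)); [exact: sq|exact: sq| |].
  move=> k; have -> : ((fp_in g * fp_in h) ^+ k.+1)%g = alternate g h k.+1.
    elim: k.+1 => [|l IH]; first by rewrite expg0.
    by rewrite expgS IH alternateS mulgA.
  by move=> /(congr1 (fun x => size (word_of x))); rewrite size_alternate.
move=> Q Q1 Qa Qb; elim/fp_ind => // k x y x1 _ Qy.
case: (Iij k) => ke; subst k.
  by rewrite (G2 _ _ _ x1 g1); exact: Qa.
by rewrite (G2 _ _ _ x1 h1); exact: Qb.
Qed.

Theorem corollary7 (R : realType) (n : nat) (G : 'I_n -> groupType)
    (S : forall i : 'I_n, set (G i)) :
  (2 <= n)%N ->
  (forall i, nontrivial (G i)) ->
  (forall i, finite_set (S i)) ->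
  (forall i, generates (S i)) ->
  ~ virtually_Z (free_product G) ->
  [/\ cayley_p_c R (free_product_gens S)
        < \big[Num.min/1]_(i < n) cayley_p_c R (S i),
      \big[Num.min/1]_(i < n) cayley_p_c R (S i)
        <= \big[Num.min/1]_(i < n) cayley_p_exp R (S i),
      \big[Num.min/1]_(i < n) cayley_p_exp R (S i)
        = cayley_p_exp R (free_product_gens S),
      cayley_p_exp R (free_product_gens S)
        <= cayley_p_u R (free_product_gens S)
    & cayley_p_u R (free_product_gens S) = 1].
Proof.
move=> n2 nontriv Sfin Sgen nvZ.
pose gens i := projT1 (cid (finite_gens (Sfin i))).
have gensP i s : s \in gens i := projT2 (cid (finite_gens (Sfin i))) s.
have SFfin : finite_set (free_product_gens S).
  by apply: bigcup_finite => [|i _]; [exact: finite_finset|exact: finite_image].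
have [gensF gensFP] := finite_gens SFfin.
pose el i := projT1 (cid (nontriv i)).
have el1 i : el i != 1%g by apply/eqP; exact: projT2 (cid (nontriv i)).
have other (i : 'I_n) : exists j, i != j.
  pose i0 := Ordinal (ltnW n2); pose i1 := Ordinal n2.
  have [->|ii] := eqVneq i i0; last by exists i0.
  by exists i1.
pose i0 := Ordinal (ltnW n2); have [j0 ij0] := other i0.
have Finf := free_product_infinite ij0 (el1 i0) (el1 j0).
have pu := p_u_free_product R gensP Sgen gensFP ij0 (el1 i0) (el1 j0).
have pcE : cayley_p_c R (free_product_gens S) =
    p_c R (1%g : vertex (cayley (free_product_gens S))).
  by rewrite /cayley_p_c; case: asboolP.
have lt_inf i : ~ finite_set [set: G i] ->
    cayley_p_c R (free_product_gens S) < p_c R (1%g : vertex (cayley (S i))).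
  move=> Ginf; have [j ij] := other i; rewrite pcE.
  exact: (p_c_lt_infinite_factor R gensP Sgen gensFP ij (el1 j) Ginf).
have two_words (i : 'I_n) (x y : free_product G) : two_letters i x -> two_letters i y -> x != y ->
    cayley_p_c R (free_product_gens S) < 1.
  move=> x2 y2 xy; rewrite pcE; exact: (p_c_lt1_two_words R Sgen gensFP x2 y2 xy).
(* This handles the finite factors, whose [p_c] is 1 by convention, and the initial value 1 of the
   minimum. *)
have lt1 : cayley_p_c R (free_product_gens S) < 1.
  have [[i [x [y [x1 y1 xy]]]]|none] :=
      pselect (exists i (x y : G i), [/\ x != 1%g, y != 1%g & x != y]).
    (* Some factor has two non-trivial elements: vary the first letter. *)
    have [j ij] := other i.
    apply: (two_words i _ _ (two_lettersP ij x1 (el1 j)) (two_lettersP ij y1 (el1 j))).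
    by apply: contra xy => /eqP /mulIg /fp_in_inj ->.
  (* With a third factor available, vary the second letter. Otherwise there are two factors, each of
     order 2. *)
  have [[k [ik jk]]|two] := pselect (exists k, i0 != k /\ j0 != k).
    apply: (two_words i0 _ _ (two_lettersP ij0 (el1 i0) (el1 j0))
      (two_lettersP ik (el1 i0) (el1 k))).
    apply: contra jk => /eqP /mulgI /(congr1 (@word_of _ _)).
    by rewrite !word_of_in /push !(negbTE (el1 _)) => -[] /eqP.
  exfalso; apply: nvZ.
  apply: (free_product_order2_virtually_Z ij0 (el1 i0) (el1 j0)) => [k|k x y x1 y1].
    apply: contrapT => nk; apply: two; exists k.
    by split; apply/eqP => e; apply: nk; [left|right].
  by apply/eqP; apply: contrapT => /negP xy; apply: none; exists k, x, y.
have pexp := bigmin_p_exp R gensP Sgen gensFP Finf.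
split.
- apply/bigmin_gtP; split=> // i _; rewrite {2}/cayley_p_c.
  by case: asboolP => // Ginf; exact: lt_inf.
- apply/bigmin_geP; split; first exact: bigmin_le_id.
  move=> i _; apply: (le_trans (bigmin_le _ i _)).
  rewrite /cayley_p_c /cayley_p_exp; case: asboolP => // _.
  exact: p_c_le_p_exp (@gensP i) (Sgen i).
- exact: pexp.
- by rewrite /cayley_p_u pu; exact: cayley_p_exp_le1.
- exact: pu.
Qed.
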